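(* Let $R$ be a noetherian integral domain over $\mathbb{F}_q$ with quotient field $K$, let $\phi$ be a (standard) Drinfeld $A$-module of rank $r\ge1$ over $R$ with characteristic $c^*:A\to R$ and associated $A$-motive $\mathcal{M}$, and put $\wp:=\ker(c^* )$. If $\wp$ is a maximal ideal, with height $h$ of $\phi$ over $K$ and element $\epsilon_\wp\in R\smallsetminus\{0\}$ as in the context, then $\mathcal{M}$ gives rise to an $F_\wp$-isocrystal $\mathcal{M}_{F,\wp}$ over $R[\epsilon_\wp^{-1}]$ that possesses a slope filtration and has slope $0$ with multiplicity $r-h$ and slope $1/h$ with multiplicity $h$.
   Context: $F$ is the function field of a smooth connected projective curve $C$ over the finite field $\mathbb{F}_q$, $\infty\in C$ a fixed closed point, $A\subset F$ the subring of functions regular outside $\infty$. $\deg_A(a):=\dim_{\mathbb{F}_q}(A/Aa)$ for $0\neq a\in A$. A (standard) Drinfeld $A$-module of rank $r$ over $R$ is an $\mathbb{F}_q$-algebra homomorphism $\phi:A\to R[\tau]$ ($\tau\xi=\xi^q\tau$), $a\mapsto\phi_a$, such that for each $0\neq a\in A$ the polynomial $\phi_a$ has degree $r\deg_A(a)$ in $\tau$ with highest coefficient a unit of $R$. $c^*(a)$ is the constant coefficient of $\phi_a$. If $\wp$ is maximal, choose $a_\wp\in A$ with $(a_\wp)=\wp^n$ for some $n\ge1$; there is a unique integer $1\le h\le r$ (the height of $\phi$ over $K$) with $\phi_{a_\wp}=\epsilon_\wp\tau^{h\deg_A(a_\wp)}+(\text{higher terms})$ and $\epsilon_\wp\in R\smallsetminus\{0\}$.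 The associated $A$-motive is $\mathcal{M}:=R[\tau]$ with $(a\otimes\xi)m:=\xi m\phi_a$ for $a\otimes\xi\in A\otimes_{\mathbb{F}_q}R$ and $\tau$ acting by left multiplication. $F_\wp$ is the completion of $F$ at $\wp$, with ring of integers $A_\wp$, uniformizer $z_\wp$, and residue field of degree $d_\wp$ over $\mathbb{F}_q$. For an $\mathbb{F}_q$-algebra $R'$ (discrete) let $\mathcal{E}_{F_\wp,R'}:=F_\wp\widehat\otimes_{\mathbb{F}_q}R'$, $\mathcal{E}_{A_\wp,R'}:=A_\wp\widehat\otimes_{\mathbb{F}_q}R'$, $\sigma(a\widehat\otimes\xi)=a\widehat\otimes\xi^q$. An $F_\wp$-isocrystal over $R'$ is a finitely generated projective $\mathcal{E}_{F_\wp,R'}$-module $\mathcal{N}$ with an additive map $\tau$, $\tau(em)=\sigma(e)\tau(m)$, whose linearization $\sigma^*\mathcal{N}\to\mathcal{N}$ is an isomorphism. $\mathcal{M}_{F,\wp}$ over $R':=R[\epsilon_\wp^{-1}]$ is the base change of $\mathcal{M}$ along $A\otimes_{\mathbb{F}_q}R\to\mathcal{E}_{F_\wp,R'}$. A lattice in $\mathcal{N}$ is a finitely generated projective $\mathcal{E}_{A_\wp,R'}$-submodule $\mathcal{L}$ with $\mathcal{L}[z_\wp^{-1}]=\mathcal{N}$. $\mathcal{N}$ is pure of slope $\alpha\in\mathbb{Q}$ if for some $n>0$ with $n\alpha\in\mathbb{Z}$ and some lattice $\mathcal{L}$, $\tau^{nd_\wp}\mathcal{L}$ generates $z_\wp^{n\alpha}\mathcal{L}$.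 A slope filtration of $\mathcal{N}$ is a separated exhaustive right continuous ascending filtration by $F_\wp$-isocrystals $\mathcal{N}_{\le\alpha}$ ($\alpha\in\mathbb{Q}$) such that each $\mathcal{N}_\alpha:=\mathcal{N}_{\le\alpha}/\bigcup_{\beta<\alpha}\mathcal{N}_{\le\beta}$ is an $F_\wp$-isocrystal pure of slope $\alpha$; the multiplicity of $\alpha$ is the rank of the locally free $\mathcal{E}_{F_\wp,R'}$-module $\mathcal{N}_\alpha$. *)

(* Defs.v *)
From HB Require Import structures.
From mathcomp Require Import all_boot all_order all_algebra all_field.
From mathcomp Require Import pgroup abelian.
From mathcomp Require Import zify.
From mathcomp Require Import boolp classical_sets.
Set Implicit Arguments.
Unset Strict Implicit.
Unset Printing Implicit Defensive.
Import Order.TTheory GRing.Theory Num.Theory.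
Local Open Scope classical_set_scope.
Local Open Scope ring_scope.

(** * Ideals, dimensions, localization at one element *)

Section Ideals.
Variable T : comNzRingType.

Definition is_ideal (I : set T) : Prop :=
  [/\ I 0, forall x y, I x -> I y -> I (x + y) & forall a x, I x -> I (a * x)].

Definition maximal_ideal (I : set T) : Prop :=
  [/\ is_ideal I, ~ I 1 &
      forall J : set T, is_ideal J -> I `<=` J -> J = I \/ J = setT].

Definition prime_ideal (I : set T) : Prop :=
  [/\ is_ideal I, ~ I 1 & forall x y, I (x * y) -> I x \/ I y].

Definition noetherian : Prop :=
  forall I : set T, is_ideal I ->
    exists (n : nat) (g : 'I_n -> T),
      I = [set x | exists c : 'I_n -> T, x = \sum_i c i * g i].

Definition principal_ideal (a : T) : set T := [set x | exists y, x = y * a].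

Definition ideal_mul (I J : set T) : set T :=
  [set x | exists (n : nat) (f g : 'I_n -> T),
      [/\ forall i, I (f i), forall i, J (g i) & x = \sum_i f i * g i]].

Fixpoint ideal_exp (I : set T) (n : nat) : set T :=
  if n is n'.+1 then ideal_mul I (ideal_exp I n') else setT.

End Ideals.

Section Dimension.
Variables (k : fieldType) (T : nzRingType) (f : {rmorphism k -> T}).

(* The [k]-vector space [V / W] has dimension [d]; here [W `<=` V] are
   [k]-subspaces of [T]. *)
Definition has_quotient_dim (V W : set T) (d : nat) : Prop :=
  exists2 b : 'I_d -> T, (forall i, V (b i)) &
    forall x, V x ->
      exists! c : {ffun 'I_d -> k}, W (x - \sum_i f (c i) * b i).

(* By convention [0] if the dimension is infinite. *)
Definition quotient_dim (V W : set T) : nat :=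
  xget 0%N [set d | has_quotient_dim V W d].

End Dimension.

Section LocalizeAway.
Variables (R : idomainType) (eps : R).

Definition away_pred : {pred {fraction R}} :=
  fun x => `[< exists (a : R) (n : nat),
                 x = FracField.tofrac a / FracField.tofrac eps ^+ n >].

Lemma away_subring : subring_closed away_pred.
Proof.
set t := @FracField.tofrac R.
split.
- by apply/asboolP; exists 1, 0%N; rewrite tofrac1 expr0 divr1.
- move=> x y /asboolP[a [m ->]] /asboolP[b [n ->]]; apply/asboolP.
  have [e0|e0] := eqVneq eps 0.
    exists ((if m is 0%N then a else 0) - (if n is 0%N then b else 0)), 0%N.
    rewrite e0 tofracB tofrac0.
    by case: m => [|m]; case: n => [|n];
      rewrite ?expr0 ?exprS ?mul0r ?invr0 ?mulr0 ?divr1 ?tofrac0 ?subr0 ?sub0r.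
  exists (a * eps ^+ n - b * eps ^+ m), (m + n)%N.
  have te : FracField.tofrac eps != 0 by rewrite tofrac_eq0.
  rewrite tofracB !tofracM !tofracXn exprD mulrBl; congr (_ - _).
    by rewrite -mulf_div divff ?mulr1 // expf_neq0.
  by rewrite [_ ^+ m * _ ^+ n]mulrC -mulf_div divff ?mulr1 // expf_neq0.
- move=> x y /asboolP[a [m ->]] /asboolP[b [n ->]]; apply/asboolP.
  by exists (a * b), (m + n)%N; rewrite tofracM exprD mulf_div.
Qed.

HB.instance Definition _ :=
  GRing.isSubringClosed.Build {fraction R} away_pred away_subring.

(* [R[1/eps]], as a subring of the quotient field of [R]. *)
Record away := Away { away_val :> {fraction R}; _ : away_val \in away_pred }.

HB.instance Definition _ := [isSub for away_val].
HB.instance Definition _ := [Choice of away by <:].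
HB.instance Definition _ := [SubChoice_isSubComNzRing of away by <:].

Lemma to_away_proof (a : R) : FracField.tofrac a \in away_pred.
Proof. by apply/asboolP; exists a, 0%N; rewrite expr0 divr1. Qed.

Definition to_away (a : R) : away := Away (to_away_proof a).

Lemma to_away_zmod : zmod_morphism to_away.
Proof. by move=> a b; apply: val_inj; rewrite /= tofracB. Qed.

Lemma to_away_monoid : monoid_morphism to_away.
Proof.
by split=> [|a b]; apply: val_inj; rewrite /= ?tofrac1 ?tofracM.
Qed.

HB.instance Definition _ := GRing.isZmodMorphism.Build R away to_away to_away_zmod.
HB.instance Definition _ :=
  GRing.isMonoidMorphism.Build R away to_away to_away_monoid.

End LocalizeAway.

(** * Curves over finite fields *)

(* A smooth connected projective curve over a finite field [Fq] is encoded by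
   its function field [F]; its closed points are the discrete valuation rings
   of [F], i.e. the normalized discrete valuations of [F].  These are
   automatically trivial on [Fq].  A valuation is a map [v : F -> int] with the
   convention [v 0 = 0]; [val_ge v n x] reads [v x >= n] with [v 0 = +oo]. *)

Section Places.
Variables (F : fieldType).

Definition val_ge (v : F -> int) (n : int) : set F :=
  [set x | x = 0 \/ n <= v x].

Record is_place (v : F -> int) : Prop := IsPlace {
  place0 : v 0 = 0;
  placeM : forall x y, x != 0 -> y != 0 -> v (x * y) = v x + v y;
  placeD : forall n x y, val_ge v n x -> val_ge v n y -> val_ge v n (x + y);
  place_norm : exists x, v x = 1
}.

Lemma place1 v : is_place v -> v 1 = 0.
Proof.
move=> vP; have := placeM vP (oner_neq0 F) (oner_neq0 F).
by rewrite mulr1 -[X in X = _]addr0 => /addrI.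
Qed.

Lemma placeX v x n : is_place v -> x != 0 -> v (x ^+ n) = v x *+ n.
Proof.
move=> vP x0; elim: n => [|n IH]; first by rewrite expr0 mulr0n place1.
by rewrite exprS (placeM vP) ?expf_neq0 // IH mulrS.
Qed.

Lemma place_fin v x n : is_place v -> x ^+ n.+1 = 1 -> v x = 0.
Proof.
move=> vP xn1; have x0 : x != 0.
  by apply: contra_eq_neq xn1 => ->; rewrite expr0n eq_sym oner_neq0.
have := placeX n.+1 vP x0; rewrite xn1 place1 // => /esym/eqP.
by rewrite mulrn_eq0 /= => /eqP.
Qed.

Lemma placeN v x : is_place v -> v (- x) = v x.
Proof.
move=> vP; have [->|x0] := eqVneq x 0; first by rewrite oppr0.
rewrite -mulN1r (placeM vP) ?oppr_eq0 ?oner_neq0 //.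
by rewrite (@place_fin v (-1) 1 vP) ?add0r // sqrrN expr1n.
Qed.

Section CoordinateRing.
Variable infty : F -> int.

Definition coord_pred : {pred F} :=
  fun x => `[< forall v, is_place v -> v <> infty -> 0 <= v x >].

Lemma coord_subring : subring_closed coord_pred.
Proof.
split.
- by apply/asboolP => v vP _; rewrite place1.
- move=> x y /asboolP xA /asboolP yA; apply/asboolP => v vP vi.
  have gx : val_ge v 0 x by right; exact: xA vP vi.
  have gy : val_ge v 0 (- y) by right; rewrite placeN //; exact: yA vP vi.
  by case: (placeD vP gx gy) => [->|//]; rewrite place0.
- move=> x y /asboolP xA /asboolP yA; apply/asboolP => v vP vi.
  have [->|x0] := eqVneq x 0; first by rewrite mul0r place0.
  have [->|y0] := eqVneq y 0; first by rewrite mulr0 place0.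
  by rewrite (placeM vP) //; apply: addr_ge0; [exact: xA vP vi|exact: yA vP vi].
Qed.

HB.instance Definition _ :=
  GRing.isSubringClosed.Build F coord_pred coord_subring.

(* The ring [A] of functions regular outside the closed point [infty]. *)
Record coord_ring := CoordRing { coord_val :> F; _ : coord_val \in coord_pred }.

HB.instance Definition _ := [isSub for coord_val].
HB.instance Definition _ := [Choice of coord_ring by <:].
HB.instance Definition _ := [SubChoice_isSubComNzRing of coord_ring by <:].

End CoordinateRing.
End Places.

Section Curve.
Variables (Fq : finFieldType) (F : fieldType) (iF : {rmorphism Fq -> F}).

(* [F] is finitely generated of transcendence degree [1] over [Fq]. *)
Definition function_field : Prop :=
  exists x : F,
    (forall p : {poly Fq}, p != 0 -> (map_poly iF p).[x] != 0) /\
    exists (n : nat) (b : 'I_n -> F), forall f : F,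
      exists (den : {poly Fq}) (num : 'I_n -> {poly Fq}),
        den != 0 /\
        (map_poly iF den).[x] * f = \sum_i (map_poly iF (num i)).[x] * b i.

Variable infty : F -> int.

Lemma coord_const_proof (c : Fq) : iF c \in coord_pred infty.
Proof.
apply/asboolP => v vP _; have [->|c0] := eqVneq c 0.
  by rewrite rmorph0 place0.
rewrite (@place_fin _ v (iF c) #|Fq|.-2 vP) //.
have q1 := finNzRing_gt1 Fq; rewrite -rmorphXn.
have -> : c ^+ #|Fq|.-2.+1 = 1.
  by apply: (mulfI c0); rewrite -exprS mulr1; case: #|Fq| q1 (expf_card c) => [|[]].
by rewrite rmorph1.
Qed.

Definition coord_const (c : Fq) : coord_ring infty := CoordRing (coord_const_proof c).

Lemma coord_const_zmod : zmod_morphism coord_const.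
Proof. by move=> a b; apply: val_inj; rewrite /= rmorphB. Qed.

Lemma coord_const_monoid : monoid_morphism coord_const.
Proof. by split=> [|a b]; apply: val_inj; rewrite /= ?rmorph1 ?rmorphM. Qed.

HB.instance Definition _ :=
  GRing.isZmodMorphism.Build Fq (coord_ring infty) coord_const coord_const_zmod.
HB.instance Definition _ :=
  GRing.isMonoidMorphism.Build Fq (coord_ring infty) coord_const coord_const_monoid.

Definition degA (a : coord_ring infty) : nat :=
  quotient_dim coord_const setT (principal_ideal a).

End Curve.

(** * Completions *)

(* [iFp : F -> Fp] with the valuation [w] is the completion of [F] at [v]. *)
Record is_completion (F : fieldType) (v : F -> int) (Fp : fieldType)
    (iFp : {rmorphism F -> Fp}) (w : Fp -> int) : Prop := IsCompletion {
  compl_place : is_place w;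
  compl_ext : forall x, w (iFp x) = v x;
  compl_dense : forall (y : Fp) (n : int), exists x, val_ge w n (y - iFp x);
  compl_complete : forall s : nat -> Fp,
    (forall n : nat, exists k0 : nat, forall k l, (k0 <= k)%N -> (k0 <= l)%N ->
       val_ge w n%:Z (s k - s l)) ->
    exists y, forall n : nat, exists k0 : nat, forall k, (k0 <= k)%N ->
       val_ge w n%:Z (s k - y)
}.

(* [E] is the completed tensor product of [Fp] and the discrete [Fq]-algebra
   [R'], i.e. the limit over [n] of [(Fp / z^n Ap) (x)_Fq R'], where
   [z^n Ap = val_ge w n]; the kernel of the projection of [E] to the [n]-th term
   is [U n].  The multiplication of [E] is continuous and extends that of the
   algebraic tensor product; [ctensor_univ] is the universal property of
   [(Fp / z^n Ap) (x)_Fq R'] for the quotient [E / U n].  The completed tensor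
   product of [Ap] and [R'] is the limit of [(Ap / z^n Ap) (x)_Fq R'], which is
   the subring [U 0] of [E]. *)
Record is_ctensor (Fq : finFieldType) (Fp : fieldType)
    (iFq : {rmorphism Fq -> Fp}) (w : Fp -> int)
    (R' : comNzRingType) (iR' : {rmorphism Fq -> R'})
    (E : comNzRingType) (i : {rmorphism Fp -> E}) (j : {rmorphism R' -> E})
    (U : nat -> set E) : Prop := IsCTensor {
  ctensor_compat : forall c, i (iFq c) = j (iR' c);
  ctensor0 : forall n, U n 0;
  ctensorB : forall n x y, U n x -> U n y -> U n (x - y);
  ctensorM : forall m n x y, U m x -> U n y -> U (m + n)%N (x * y);
  ctensorS : forall n, U n.+1 `<=` U n;
  ctensor_pure : forall (n : nat) a xi, val_ge w n%:Z a -> U n (i a * j xi);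
  ctensor_univ : forall (n : nat) (W : zmodType) (beta : Fp -> R' -> W),
    (forall a b xi, beta (a + b) xi = beta a xi + beta b xi) ->
    (forall a xi xi', beta a (xi + xi') = beta a xi + beta a xi') ->
    (forall c a xi, beta (a * iFq c) xi = beta a (iR' c * xi)) ->
    (forall a xi, val_ge w n%:Z a -> beta a xi = 0) ->
    exists! g : E -> W,
      [/\ forall x y, g (x + y) = g x + g y,
          forall x, U n x -> g x = 0 &
          forall a xi, g (i a * j xi) = beta a xi];
  ctensor_complete : forall s : nat -> E,
    (forall n, U n (s n.+1 - s n)) -> exists! x, forall n, U n (x - s n)
}.

(* The continuous extension of [a (x) xi |-> a (x) xi^q]. *)
Definition is_frobenius (q : nat) (Fp : fieldType) (R' E : comNzRingType)
    (i : {rmorphism Fp -> E}) (j : {rmorphism R' -> E}) (U : nat -> set E)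
    (sigma : {rmorphism E -> E}) : Prop :=
  (forall a xi, sigma (i a * j xi) = i a * j xi ^+ q) /\
  (forall n x, U n x -> U n (sigma x)).

(** * Twisted polynomials and Drinfeld modules *)

(* The ring [R[tau]] with [tau * xi = xi ^+ q * tau], where [q = #|Fq|]; the
   polynomial with coefficients [a_i] stands for [\sum_i a_i tau^i]. *)
Definition twpoly (Fq : finFieldType) (R : comNzRingType)
  (iR : {rmorphism Fq -> R}) : Type := {poly R}.

HB.instance Definition _ (Fq : finFieldType) (R : comNzRingType)
    (iR : {rmorphism Fq -> R}) :=
  GRing.Zmodule.copy (twpoly iR) {poly R}.

Section Twisted.
Variables (Fq : finFieldType) (R : comNzRingType) (iR : {rmorphism Fq -> R}).
Local Notation q := #|Fq|.


Lemma twfrobD n (x y : R) : (x + y) ^+ (q ^ n) = x ^+ (q ^ n) + y ^+ (q ^ n).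
Proof.
have [p pr_p pF] := finPcharP Fq.
have pR : p \in [pchar R] := rmorph_pchar iR pF.
apply: exprDn_pchar; rewrite (eq_pnat _ (pcharf_eq pR)) pnatX -cardsT.
by apply/orP; left; exact: abelem_pgroup (fin_ring_pchar_abelem pF).
Qed.

Lemma card_exp_gt0 n : (0 < q ^ n)%N.
Proof. by rewrite expn_gt0 (ltn_trans _ (finNzRing_gt1 Fq)). Qed.

Lemma twfrob0 n : (0 : R) ^+ (q ^ n) = 0.
Proof. by rewrite expr0n eqn0Ngt card_exp_gt0. Qed.

Lemma twfrob_sum n (I : Type) (s : seq I) (P : pred I) (G : I -> R) :
  (\sum_(i <- s | P i) G i) ^+ (q ^ n) = \sum_(i <- s | P i) G i ^+ (q ^ n).
Proof.
exact: (big_morph (fun x => x ^+ (q ^ n)) (twfrobD n) (twfrob0 n)).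
Qed.

Local Notation twpoly := (twpoly iR).

Definition twmul (f g : twpoly) : twpoly :=
  \poly_(k < size f + size g)
     \sum_(i < k.+1) f`_i * g`_(k - i) ^+ (q ^ i).

Lemma coef_twmul (f g : twpoly) k :
  (twmul f g)`_k = \sum_(i < k.+1) f`_i * g`_(k - i) ^+ (q ^ i).
Proof.
rewrite coef_poly; case: ltnP => // le_k; rewrite big1 // => i _.
have [lt_i|le_i] := ltnP i (size f); last by rewrite nth_default ?mul0r.
rewrite [g`__]nth_default ?twfrob0 ?mulr0 // leq_subRL ?leq_ord //.
by apply: leq_trans le_k; rewrite leq_add2r ltnW.
Qed.

Lemma coef_twmul_rev (f g : twpoly) k :
  (twmul f g)`_k = \sum_(i < k.+1) f`_(k - i) * g`_i ^+ (q ^ (k - i)).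
Proof.
rewrite coef_twmul (reindex_inj rev_ord_inj) /=.
by apply: eq_bigr => i _; rewrite subSS subKn // leq_ord.
Qed.

Lemma twmulA : associative twmul.
Proof.
move=> f g h; apply/polyP => k; rewrite coef_twmul coef_twmul_rev.
pose c3 j l := f`_j * (g`_(k - j - l) ^+ (q ^ j) * h`_l ^+ (q ^ (k - l))).
transitivity (\sum_(j < k.+1) \sum_(l < k.+1 | (l <= k - j)%N) c3 j l).
  apply: eq_bigr => /= j _; rewrite coef_twmul_rev twfrob_sum big_distrr /=.
  rewrite (big_ord_narrow_leq (leq_subr _ _)) /=.
  apply: eq_bigr => l _; rewrite /c3 exprMn -exprM -expnD /=; congr (_ * (_ * _ ^+ (_ ^ _))).
  have lj : (l <= k - j)%N by rewrite -ltnS.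
  have := leq_ord j; lia.
rewrite (exchange_big_dep predT) //=; apply: eq_bigr => l _.
transitivity (\sum_(j < k.+1 | (j <= k - l)%N) c3 j l).
  by apply: eq_bigl => j; have := leq_ord j; have := leq_ord l; lia.
rewrite (big_ord_narrow_leq (leq_subr _ _)) coef_twmul big_distrl /=.
by apply: eq_bigr => j _; rewrite /c3 -!subnDA addnC mulrA.
Qed.

Definition twconst (a : R) : twpoly := a%:P.
Definition twtau : twpoly := 'X.

Lemma twmul1l : left_id (twconst 1) twmul.
Proof.
move=> f; apply/polyP => k; rewrite coef_twmul big_ord_recl subn0 coefC /=.
rewrite expn0 expr1 mul1r big1 ?addr0 // => i _.
by rewrite coefC mul0r.
Qed.

Lemma twmul1r : right_id (twconst 1) twmul.
Proof.
move=> f; apply/polyP => k; rewrite coef_twmul_rev big_ord_recl subn0 coefC /=.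
rewrite expr1n mulr1 big1 ?addr0 // => i _.
by rewrite coefC /= twfrob0 mulr0.
Qed.

Lemma twmulDl : left_distributive twmul +%R.
Proof.
move=> f g h; apply/polyP => k; rewrite coefD !coef_twmul -big_split /=.
by apply: eq_bigr => i _; rewrite coefD mulrDl.
Qed.

Lemma twmulDr : right_distributive twmul +%R.
Proof.
move=> f g h; apply/polyP => k; rewrite coefD !coef_twmul -big_split /=.
by apply: eq_bigr => i _; rewrite coefD twfrobD mulrDr.
Qed.

Lemma twone_neq0 : twconst 1 != 0.
Proof. by rewrite polyC_eq0 oner_neq0. Qed.

HB.instance Definition _ := GRing.Zmodule_isNzRing.Build twpoly
  twmulA twmul1l twmul1r twmulDl twmulDr twone_neq0.

End Twisted.

Section Drinfeld.
Variables (Fq : finFieldType) (F : fieldType) (iF : {rmorphism Fq -> F}).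
Variable infty : F -> int.
Variables (R : idomainType) (iR : {rmorphism Fq -> R}).
Variables (r : nat) (phi : {rmorphism coord_ring infty -> twpoly iR}).

Record is_drinfeld : Prop := IsDrinfeld {
  drinfeld_const : forall c : Fq, phi (coord_const iF infty c) = twconst iR (iR c);
  drinfeld_degree : forall a, a != 0 ->
    size (phi a : {poly R}) = (r * degA iF a).+1;
  drinfeld_lead : forall a, a != 0 ->
    lead_coef (phi a : {poly R}) \is a GRing.unit
}.

Definition cstar (a : coord_ring infty) : R := (phi a : {poly R})`_0.

Definition ker_cstar : set (coord_ring infty) := [set a | cstar a = 0].

(* The [A (x) R]-module structure of the [A]-motive [M := R[tau]], given on pure
   tensors [a (x) xi]; [tau] acts by [twtau iR * m]. *)
Definition motive_act (s : coord_ring infty * R) (m : twpoly iR) : twpoly iR :=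
  twconst iR s.2 * m * phi s.1.

End Drinfeld.

(** * Base change and projective modules *)

Section BaseChange.
(* A module over a ring generated as an additive group by (the image of) a set
   [S] is given by an abelian group [M] with the action of the elements of [S];
   [f : S -> E] is the restriction to [S] of a ring homomorphism to [E]. *)
Variables (E : comNzRingType) (S : Type) (f : S -> E).
Variables (M : zmodType) (act : S -> M -> M).

Definition semilinear_map (N : lmodType E) (u : M -> N) : Prop :=
  (forall x y, u (x + y) = u x + u y) /\
  (forall s x, u (act s x) = f s *: u x).

(* [u : M -> N] exhibits [N] as the base change of [M] along [f]. *)
Definition is_base_change (N : lmodType E) (u : M -> N) : Prop :=
  semilinear_map u /\
  forall (W : lmodType E) (g : M -> W), semilinear_map g ->
    exists! h : N -> W, linear h /\ forall x, h (u x) = g x.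

End BaseChange.

Section Modules.
Variables (E : comNzRingType) (N : lmodType E).
Implicit Types (S : set E) (L P Q : set N).

(* In the next three definitions [S] is (the underlying set of) a subring. *)

Definition submodule S L : Prop :=
  L 0 /\ forall c x y, S c -> L x -> L y -> L (c *: x + y).

Definition span S (X : set N) : set N :=
  [set y | exists (n : nat) (c : 'I_n -> E) (x : 'I_n -> N),
     [/\ forall i, S (c i), forall i, X (x i) & y = \sum_i c i *: x i]].

(* [L] is a finitely generated projective [S]-module, i.e. a direct summand of
   some [S^n]: the [x i] define [S^n -> L] and the [s i] define a section. *)
Definition fg_projective S L : Prop :=
  submodule S L /\
  exists (n : nat) (x : 'I_n -> N) (s : 'I_n -> N -> E),
    [/\ forall i, L (x i),
        forall i y, L y -> S (s i y),
        forall i c y y', S c -> L y -> L y' ->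
          s i (c *: y + y') = c * s i y + s i y' &
        forall y, L y -> y = \sum_i s i y *: x i].

(* [N] has constant rank [m]: for every prime [P], the localization [N_P] is free
   of rank [m] over [E_P] (with a basis consisting of images of elements of
   [N]). *)
Definition has_rank (m : nat) : Prop :=
  forall P : set E, prime_ideal P ->
    exists x : 'I_m -> N,
      (forall y, exists (s : E) (c : 'I_m -> E),
         ~ P s /\ s *: y = \sum_i c i *: x i) /\
      (forall c : 'I_m -> E, \sum_i c i *: x i = 0 ->
         exists s : E, ~ P s /\ forall i, s * c i = 0).

End Modules.

(** * Isocrystals *)

Section Isocrystals.
Variables (E : comNzRingType) (sigma : {rmorphism E -> E}).

(* The linearization of [tau] is the linear map [l : sigma^*N -> N] with
   [l (1 (x) x) = tau x]. *)
Definition linearization_iso (N : lmodType E) (tau : N -> N) : Prop :=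
  exists (sN : lmodType E) (u : N -> sN) (l : sN -> N),
    [/\ is_base_change sigma (fun e (x : N) => e *: x) u,
        linear l, forall x, l (u x) = tau x & bijective l].

Definition is_isocrystal (N : lmodType E) (tau : N -> N) : Prop :=
  [/\ fg_projective setT [set: N],
      semilinear_map sigma (fun e (x : N) => e *: x) tau &
      linearization_iso tau].

(* [EA] is the subring of integral elements of [E], [zE m] the [m]-th power of
   the uniformizer in [E], [d] the degree of the residue field. *)
Variables (EA : set E) (zE : int -> E) (d : nat).

Definition is_lattice (N : lmodType E) (L : set N) : Prop :=
  fg_projective EA L /\ forall y, exists n : nat, L (zE n *: y).

Definition is_pure (N : lmodType E) (tau : N -> N) (alpha : rat) : Prop :=
  exists (n : nat) (m : int) (L : set N),
    [/\ (0 < n)%N, n%:R * alpha = m%:~R, is_lattice L &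
        span EA [set iter (n * d) tau x | x in L] = [set zE m *: x | x in L]].

(* [p : P -> X] exhibits [(X, tauX)] as the quotient of the submodule [P] of [N]
   by its submodule [Q]; values of [p] outside [P] are irrelevant. *)
Definition is_subquotient (N : lmodType E) (tau : N -> N) (P Q : set N)
    (X : lmodType E) (tauX : X -> X) (p : N -> X) : Prop :=
  [/\ forall e x y, P x -> P y -> p (e *: x + y) = e *: p x + p y,
      forall t, exists2 x, P x & p x = t,
      forall x, P x -> (p x = 0 <-> Q x) &
      forall x, P x -> p (tau x) = tauX (p x)].

Variables (N : lmodType E) (tau : N -> N).

Definition fil_lt (Fil : rat -> set N) (alpha : rat) : set N :=
  [set x | exists2 beta, beta < alpha & Fil beta x].

Record slope_filtration (Fil : rat -> set N) : Prop := SlopeFiltration {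
  sf_submodule : forall alpha, submodule setT (Fil alpha);
  sf_stable : forall alpha x, Fil alpha x -> Fil alpha (tau x);
  sf_isocrystal : forall alpha,
    exists (X : lmodType E) (tauX : X -> X) (p : N -> X),
      is_subquotient tau (Fil alpha) [set 0] tauX p /\ is_isocrystal tauX;
  sf_ascending : forall alpha beta, alpha <= beta -> Fil alpha `<=` Fil beta;
  sf_separated : forall x, (forall alpha, Fil alpha x) -> x = 0;
  sf_exhaustive : forall x, exists alpha, Fil alpha x;
  sf_right_continuous : forall alpha x,
    (forall beta, alpha < beta -> Fil beta x) -> Fil alpha x;
  sf_pure : forall alpha,
    exists (X : lmodType E) (tauX : X -> X) (p : N -> X),
      [/\ is_subquotient tau (Fil alpha) (fil_lt Fil alpha) tauX p,
          is_isocrystal tauX & is_pure tauX alpha]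
}.

Definition slope_multiplicity (Fil : rat -> set N) (alpha : rat) (m : nat) :
    Prop :=
  exists (X : lmodType E) (tauX : X -> X) (p : N -> X),
    is_subquotient tau (Fil alpha) (fil_lt Fil alpha) tauX p /\ has_rank X m.

End Isocrystals.

(* Main.v *)
(* Let [p] be a uniformizer of [A] at [wp] and [d] the degree of the residue field.
   Over [R[1/eps]] the lowest term of [phi p] is a unit times [tau ^ (h * d)].
   Division with remainder by [phi p] gives coordinates that make [N] a direct
   summand of a free module, together with a lattice.  The left ideals
   [tau ^ k R[tau]] induce a filtration of this lattice which [p] shifts by
   [h * d].  The intersection of the filtration spans the part of slope [0], where
   [tau] is bijective by Nakayama; the quotient is free of rank [h] over [E], and
   [tau ^ (h * d)] acts on it like [p], so that it has slope [1 / h].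

   For the ranks, the integral part of [E] has [d] components, which [sigma]
   permutes cyclically, so [N] has the same rank on each of them.  Modulo [p] these
   ranks add up to the dimension of the [wp]-primary part of [K[tau] / K[tau] phi p].
   As [p] acts nilpotently, and with kernel that primary part, on
   [K[tau] / K[tau] phi a_wp], which has dimension [r * (n_wp * d)] and is
   homogeneous over [A / wp ^ n_wp], this dimension is [r * d]. *)
Require Import Defs.
From HB Require Import structures.
From mathcomp Require Import all_boot all_order all_algebra all_field.
From mathcomp Require Import ring_quotient.
From mathcomp Require Import zify ring.
From mathcomp Require Import boolp classical_sets.
Set Implicit Arguments.
Unset Strict Implicit.
Unset Printing Implicit Defensive.
Import Order.TTheory GRing.Theory Num.Theory.
Local Open Scope classical_set_scope.
Local Open Scope ring_scope.

(** * Quotient rings, ranks and local bases *)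

(** The uniformizer [p] is taken in [A], so it generates [wp] only locally and may have other zeros.
    Division by [phi p] sees all of them: [R[tau] / R[tau] phi p] has dimension [r * degA p], which
    may exceed [r * d]. Before each division one therefore inserts an element [ep k] of [A] that is
    congruent to [1] modulo [wp ^ k] and turns valuation at [wp] into divisibility by [p]. It cuts
    out the part at [wp], and for this reason [N] is a direct summand and not the whole free module.
    [E] and [N] are known only by universal properties. Functionals on [E] come from forms on [A]
    that vanish on a power of [wp], and equalities in [E] are proved by separatedness. [N] is not
    known to be separated before a dual basis exists; there the inverse of [1 - C], with [C]
    divisible by [p], replaces a passage to the limit. The span of [tau R[tau]] misses the
    constants, but [f * phi p] has no constant term since [p] has characteristic value [0], and [p]
    is invertible in [E]. This makes the linearization of [tau] bijective. *)

Section Quotients.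

Section ZmodQuotient.
Variables (V : zmodType) (S : set V).
Hypotheses (S0 : S 0) (SB : forall x y, S x -> S y -> S (x - y)).

Definition sub_pred (_ : S 0) (_ : forall x y, S x -> S y -> S (x - y)) : {pred V} :=
  fun x => `[< S x >].

Lemma sub_pred_zmod : zmod_closed (sub_pred S0 SB).
Proof.
split; first exact/asboolP.
by move=> x y /asboolP Sx /asboolP Sy; apply/asboolP; exact: SB.
Qed.

HB.instance Definition _ :=
  GRing.isZmodClosed.Build V (sub_pred S0 SB) sub_pred_zmod.

End ZmodQuotient.

(** Turns membership in a subgroup into the vanishing of an additive map, the form in which the
    uniqueness clause of [ctensor_univ] can be applied. *)
Lemma zmod_quotient_exists (V : zmodType) (S : set V) :
  S 0 -> (forall x y, S x -> S y -> S (x - y)) ->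
  exists (W : zmodType) (g : V -> W),
    (forall x y, g (x + y) = g x + g y) /\ (forall x, g x = 0 <-> S x).
Proof.
move=> S0 SB; pose Q := Quotient.quot (sub_pred S0 SB).
exists Q, (\pi_Q%qT); split=> [x y|x].
  by rewrite raddfD.
have -> : S x <-> ((x - 0)%R \in sub_pred S0 SB).
  by rewrite subr0; split => [/asboolP|/asboolP].
rewrite Quotient.idealrBE; split => [h|/eqP h].
  by apply/eqP; rewrite h raddf0.
by rewrite h raddf0.
Qed.

Section PrimeQuotient.
Variables (T : comNzRingType) (P : set T) (P_prime : prime_ideal P).

Definition prime_pred (_ : prime_ideal P) : {pred T} := fun x => `[< P x >].

Lemma prime_pred_idealr : idealr_closed (prime_pred P_prime).
Proof.
have [[P0 PD PM] P1 _] := P_prime; split; first exact/asboolP.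
  by apply/negP => /asboolP.
move=> a x y /asboolP Px /asboolP Py; apply/asboolP.
by apply: PD => //; exact: PM.
Qed.

HB.instance Definition _ :=
  isIdealr.Build T (prime_pred P_prime) prime_pred_idealr.

Lemma prime_pred_prime : prime_idealr_closed (prime_pred P_prime).
Proof.
have [_ _ Pp] := P_prime; move=> x y /asboolP/Pp[] h; apply/orP; [left|right]; exact/asboolP.
Qed.

HB.instance Definition _ :=
  isPrimeIdealrClosed.Build T (prime_pred P_prime) prime_pred_prime.

Definition prime_quot := {ideal_quot prime_pred P_prime}.

HB.instance Definition _ := GRing.ComNzRing.on prime_quot.

(** An integral domain structure carries units and inverses; both are obtained classically here so
    that the fraction field of [T / P] can be formed. *)
Definition pq_unit : {pred prime_quot} := fun x => `[< exists y, y * x = 1 >].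

Definition pq_inv (x : prime_quot) : prime_quot :=
  if pselect (exists y, y * x = 1) is left h then projT1 (cid h) else x.

Lemma pq_mulVr : {in pq_unit, left_inverse 1 pq_inv *%R}.
Proof.
move=> x /asboolP ux; rewrite /pq_inv; case: pselect => // h.
exact: projT2 (cid h).
Qed.

Lemma pq_unitP (x y : prime_quot) : y * x = 1 -> pq_unit x.
Proof. by move=> yx; apply/asboolP; exists y. Qed.

Lemma pq_inv_out : {in [predC pq_unit], pq_inv =1 id}.
Proof.
move=> x; rewrite inE /= => /asboolP nu; rewrite /pq_inv.
by case: pselect.
Qed.

HB.instance Definition _ := GRing.ComNzRing_hasMulInverse.Build prime_quot
  pq_mulVr pq_unitP pq_inv_out.

Lemma pq_idomain : GRing.integral_domain_axiom prime_quot.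
Proof. exact: Quotient.rquot_IdomainAxiom. Qed.

HB.instance Definition _ :=
  GRing.ComUnitRing_isIntegral.Build prime_quot pq_idomain.

(** The field is the fraction field of [T / P]. The map [ev] need not be onto, but the ranks of
    matrices mapped by [ev] depend only on its kernel. *)
Lemma residue_field_exists :
  exists (k : fieldType) (ev : {rmorphism T -> k}), forall x, ev x = 0 <-> P x.
Proof.
pose pi0 : {rmorphism T -> prime_quot} := \pi_({ideal_quot prime_pred P_prime})%qT.
exists {fraction prime_quot}, (@FracField.tofrac prime_quot \o pi0) => x /=.
have -> : P x <-> (x - 0 \in prime_pred P_prime).
  by rewrite subr0; split => [/asboolP|/asboolP].
rewrite Quotient.idealrBE; split => [/eqP|/eqP h].
  by rewrite tofrac_eq0 => /eqP h; apply/eqP; rewrite [LHS]h -(rmorph0 pi0).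
by apply/eqP; rewrite tofrac_eq0 -(rmorph0 pi0); apply/eqP.
Qed.

End PrimeQuotient.
End Quotients.

(** * Ranks of matrices under homomorphisms to varying fields *)

Section Ranks.

Lemma row_free_selection (k : fieldType) m n r (A : 'M[k]_(m, n)) :
  \rank A = r -> exists f : 'I_r -> 'I_m, row_free (rowsub f A).
Proof. by move=> <-; exists (maxrankfun A); exact: maxrowsub_free. Qed.

(** A minor of maximal size that is nonzero in [k2] is nonzero in [k1] as well, because [e2] kills
    whatever [e1] kills. *)
Lemma rank_map_le (O : comNzRingType) (k1 k2 : fieldType)
    (e1 : {rmorphism O -> k1}) (e2 : {rmorphism O -> k2}) m n (A : 'M[O]_(m, n)) :
  (forall x, e1 x = 0 -> e2 x = 0) ->
  (\rank (map_mx e2 A) <= \rank (map_mx e1 A))%N.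
Proof.
move=> ker12; set r := \rank (map_mx e2 A).
have [f free_f] := row_free_selection (erefl r).
have rT : \rank (rowsub f (map_mx e2 A))^T = r.
  by rewrite mxrank_tr; apply/eqP.
have [g free_g] := row_free_selection rT.
pose B := (rowsub g (rowsub f A)^T).
have B2 : map_mx e2 B = rowsub g (rowsub f (map_mx e2 A))^T.
  by rewrite /B map_mxsub -map_trmx map_mxsub.
have detB : \det (map_mx e1 B) != 0.
  have : \det (map_mx e2 B) != 0.
    by rewrite B2 -unitfE -unitmxE -row_free_unit.
  by apply: contra_neq; rewrite !det_map_mx; exact: ker12.
have <- : \rank (map_mx e1 B) = r.
  by apply: mxrank_unit; rewrite unitmxE unitfE.
rewrite /B map_mxsub -map_trmx map_mxsub.
rewrite (leq_trans (mxrankS (rowsub_sub _ _))) // mxrank_tr.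
exact: mxrankS (rowsub_sub _ _).
Qed.

Lemma mxrank_idem_compl (k : fieldType) n (A : 'M[k]_n) :
  A *m A = A -> (\rank A + \rank (1%:M - A)%R = n)%N.
Proof.
move=> AA; have <- : (kermx A :=: 1%:M - A)%MS.
  apply/eqmxP/andP; split; last first.
    by apply/sub_kermxP; rewrite mulmxBl mul1mx AA subrr.
  have -> : kermx A = kermx A *m (1%:M - A).
    by rewrite mulmxBr mulmx1 mulmx_ker subr0.
  exact: submxMl.
by rewrite mxrank_ker subnKC // rank_leq_row.
Qed.

(** Semicontinuity holds for [A] and for [1 - A], and their ranks add up to [n] over each field, so
    neither rank can drop. This is the constancy of the rank of a projective module under
    specialization. *)
Lemma rank_map_idem (O : comNzRingType) (k1 k2 : fieldType)
    (e1 : {rmorphism O -> k1}) (e2 : {rmorphism O -> k2}) n (A : 'M[O]_n) :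
  A *m A = A -> (forall x, e1 x = 0 -> e2 x = 0) ->
  \rank (map_mx e2 A) = \rank (map_mx e1 A).
Proof.
move=> AA ker12; apply/eqP; rewrite eqn_leq rank_map_le //=.
have AA1 : map_mx e1 A *m map_mx e1 A = map_mx e1 A by rewrite -map_mxM AA.
have AA2 : map_mx e2 A *m map_mx e2 A = map_mx e2 A by rewrite -map_mxM AA.
have := rank_map_le (1%:M - A) ker12; rewrite !map_mxB !map_mx1.
move: (mxrank_idem_compl AA1) (mxrank_idem_compl AA2).
move: (\rank _) (\rank _) (\rank _) (\rank _) => a b c e; lia.
Qed.

Lemma mxrank_add_orth (k : fieldType) n (A B : 'M[k]_n) :
  A *m A = A -> B *m B = B -> A *m B = 0 -> B *m A = 0 ->
  \rank (A + B)%R = (\rank A + \rank B)%N.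
Proof.
move=> AA BB AB BA.
have -> : ((A + B)%R :=: addsmx A B)%MS.
  apply/eqmxP/andP; split; first by rewrite addmx_sub_adds.
  rewrite addsmx_sub; apply/andP; split.
    by rewrite -{1}[A]addr0 -{1}AA -AB -mulmxDr submxMl.
  by rewrite -{1}[B]add0r -{1}BB -BA -mulmxDr submxMl.
apply: mxrank_disjoint_sum; apply/eqP; rewrite -submx0.
set C := (A :&: B)%MS.
have /submxP[X CX] : (C <= A)%MS by exact: capmxSl.
have /submxP[Y CY] : (C <= B)%MS by exact: capmxSr.
have : C *m A = 0 by rewrite CY -mulmxA BA mulmx0.
by rewrite {1}CX -mulmxA AA -CX => ->; exact: sub0mx.
Qed.

Lemma mxrank_sum_orth (k : fieldType) n d (Q : 'I_d -> 'M[k]_n) :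
  (forall s, Q s *m Q s = Q s) -> (forall s t, s != t -> Q s *m Q t = 0) ->
  \rank (\sum_s Q s)%R = (\sum_s \rank (Q s))%N.
Proof.
move=> QQ Qst.
suff main : forall (r : seq 'I_d), uniq r ->
   [/\ \rank (\sum_(s <- r) Q s)%R = (\sum_(s <- r) \rank (Q s))%N,
    (\sum_(s <- r) Q s) *m (\sum_(s <- r) Q s) = \sum_(s <- r) Q s &
    forall t, t \notin r ->
      Q t *m (\sum_(s <- r) Q s) = 0 /\ (\sum_(s <- r) Q s) *m Q t = 0].
  by have [] := main _ (index_enum_uniq _).
elim=> [_|s r IH] /=.
  by rewrite !big_nil mxrank0 mul0mx; split=> // t; rewrite mulmx0 mul0mx.
case/andP => sr /IH[rk idem orth]; have [o1 o2] := orth _ sr.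
rewrite !big_cons; split.
- by rewrite mxrank_add_orth // rk.
- by rewrite mulmxDl !mulmxDr idem QQ o1 o2 addr0 add0r.
move=> t; rewrite inE negb_or => /andP[ts /orth[h1 h2]].
by rewrite mulmxDl mulmxDr h1 h2 !Qst ?addr0 // eq_sym.
Qed.

(** The kernel of [P] lies in the image of each [P ^+ i] with [i < N], so every further
    multiplication by [P] lowers the rank by exactly the dimension of the kernel: all Jordan blocks
    have size [N]. *)
Lemma nilpotent_dim (k : fieldType) n N (P : 'M[k]_n) :
  P ^+ N = 0 -> (kermx P <= P ^+ N.-1)%MS -> (n = N * \rank (kermx P))%N.
Proof.
move=> PN kerP.
have key i : (i <= N)%N -> (\rank (P ^+ i)%R + i * \rank (kermx P) = n)%N.
  elim: i => [_|i IH iN]; first by rewrite expr0 addn0 mxrank1.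
  rewrite -[RHS](IH (ltnW iN)) -(mxrank_mul_ker (P ^+ i) P) mulSn.
  rewrite addnA; congr (_ + _ + _)%N; first by rewrite exprSr.
  apply/eqP; rewrite eqn_leq [X in _ && X]mxrankS ?capmxSr ?andbT //.
  apply: mxrankS; rewrite sub_capmx submx_refl andbT.
  apply: submx_trans kerP _.
  have -> : N.-1 = (N.-1 - i + i)%N by rewrite subnK //; lia.
  by rewrite exprD; exact: submxMl.
by rewrite -[LHS](key N) // PN mxrank0.
Qed.

End Ranks.

(** * Projective modules given by dual bases *)

Section Presentations.
Variables (E : comNzRingType) (X : lmodType E).

(** A dual basis. The map [y |-> (s i y)_i] identifies [X] with the image of the idempotent matrix
    [pres_mx] acting on row vectors. *)
Definition presents n (x : 'I_n -> X) (s : 'I_n -> X -> E) : Prop :=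
  (forall i c y y', s i (c *: y + y') = c * s i y + s i y') /\
  (forall y, y = \sum_i s i y *: x i).

Definition pres_mx n (x : 'I_n -> X) (s : 'I_n -> X -> E) : 'M[E]_n :=
  \matrix_(i, j) s j (x i).

Lemma lin_sum (s : X -> E) (I : finType) (c : I -> E) (x : I -> X) :
  (forall c y y', s (c *: y + y') = c * s y + s y') ->
  s (\sum_i c i *: x i) = \sum_i c i * s (x i).
Proof.
move=> sL.
have s0 : s 0 = 0.
  by have := sL 1 0 0; rewrite scale1r mul1r addr0 => /eqP;
     rewrite -subr_eq subrr => /eqP.
by elim/big_rec2: _ => // i y1 y2 _ IH; rewrite sL IH.
Qed.

Lemma pres_mx_idem n (x : 'I_n -> X) s :
  presents x s -> pres_mx x s *m pres_mx x s = pres_mx x s.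
Proof.
move=> [sL sx]; apply/matrixP => i j; rewrite !mxE.
rewrite [in RHS](sx (x i)) lin_sum //.
by apply: eq_bigr => l _; rewrite !mxE.
Qed.

(** The base change matrices satisfy [Phi = A *m B] and [Phi' = B *m A], so idempotence gives
    [Phi = A *m Phi' *m B]. *)
Lemma pres_rank_le n n' x s x' s' (k : fieldType) (ev : {rmorphism E -> k}) :
  @presents n x s -> @presents n' x' s' ->
  (\rank (map_mx ev (pres_mx x s)) <= \rank (map_mx ev (pres_mx x' s')))%N.
Proof.
move=> P P'; have [sL sx] := P; have [sL' sx'] := P'.
pose A := \matrix_(i, j) s' j (x i); pose B := \matrix_(i, j) s j (x' i).
have AB : pres_mx x s = A *m B.
  apply/matrixP => i j; rewrite !mxE [in LHS](sx' (x i)) lin_sum //.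
  by apply: eq_bigr => l _; rewrite !mxE.
have BA : pres_mx x' s' = B *m A.
  apply/matrixP => i j; rewrite !mxE [in LHS](sx (x' i)) lin_sum //.
  by apply: eq_bigr => l _; rewrite !mxE.
have -> : pres_mx x s = A *m pres_mx x' s' *m B.
  by rewrite -[LHS](pres_mx_idem P) BA AB !mulmxA.
rewrite !map_mxM (leq_trans (mxrankM_maxl _ _)) //.
exact: mxrankM_maxr.
Qed.

Lemma pres_rank_eq n n' x s x' s' (k : fieldType) (ev : {rmorphism E -> k}) :
  @presents n x s -> @presents n' x' s' ->
  \rank (map_mx ev (pres_mx x s)) = \rank (map_mx ev (pres_mx x' s')).
Proof. by move=> P P'; apply/eqP; rewrite eqn_leq !pres_rank_le. Qed.

(** Rows of [Phi] and of [1 - Phi] that form bases of the two images over [k] are stacked into a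
    square matrix [Psi]. Its determinant lies outside [P], and the adjugate inverts it up to this
    determinant. *)
Lemma local_basis n (x : 'I_n -> X) s (P : set E) (k : fieldType)
    (ev : {rmorphism E -> k}) (m : nat) :
  presents x s -> (forall y, ev y = 0 <-> P y) ->
  \rank (map_mx ev (pres_mx x s)) = m ->
  exists x' : 'I_m -> X,
      (forall y, exists (s : E) (c : 'I_m -> E),
         ~ P s /\ s *: y = \sum_i c i *: x' i) /\
      (forall c : 'I_m -> E, \sum_i c i *: x' i = 0 ->
         exists s : E, ~ P s /\ forall i, s * c i = 0).
Proof.
move=> Pxs evP rk; set Phi := pres_mx x s.
have PhiPhi : Phi *m Phi = Phi by exact: pres_mx_idem.
have ePhi : map_mx ev Phi *m map_mx ev Phi = map_mx ev Phi.
  by rewrite -map_mxM PhiPhi.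
have := mxrank_idem_compl ePhi; rewrite rk; set b := \rank _ => mbn.
(* The complementary rank [b] is made a variable so that [n] can be replaced by [m + b], which makes
   [Psi] square. *)
move: (erefl b) => rkc; rewrite {2}/b in rkc; clearbody b.
move: x s Pxs @Phi PhiPhi ePhi rk rkc; case: n / mbn => x s Pxs Phi PhiPhi ePhi rk rkc.
have [sL sx] := Pxs.
have [f ff] := row_free_selection rk.
have [g fg] := row_free_selection (esym rkc).
pose Psi := col_mx (rowsub f Phi) (rowsub g (1%:M - Phi)).
have detPsi : ~ P (\det Psi).
  rewrite -evP -det_map_mx; apply/eqP; rewrite -unitfE -unitmxE -row_full_unit.
  rewrite /Psi map_col_mx !map_mxsub map_mxB map_mx1.
  set A := map_mx ev Phi; rewrite -sub1mx -addsmxE.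
  have {}rk : \rank A = m by [].
  have eA : (rowsub f A == A)%MS.
    by rewrite -(geq_leqif (mxrank_leqif_eq (rowsub_sub f A))) rk; move/eqP: ff => ->.
  have eB : (rowsub g (1%:M - A) == 1%:M - A)%MS.
    by rewrite -(geq_leqif (mxrank_leqif_eq (rowsub_sub g _))) -rkc; move/eqP: fg => ->.
  rewrite (adds_eqmx (eqmxP eA) (eqmxP eB)).
  by rewrite -[X in (X <= _)%MS](subrK A) addrC addmx_sub_adds.
exists (x \o f); split=> [y|c c0].
  pose S := \row_j s j y.
  have SPhi : S *m Phi = S.
    apply/rowP => j; rewrite !mxE [in RHS](sx y) lin_sum //.
    by apply: eq_bigr => l _; rewrite !mxE.
  pose c := lsubmx (S *m \adj Psi); pose c' := rsubmx (S *m \adj Psi).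
  exists (\det Psi), (fun i => c 0 i); split=> //.
  have e1 : \det Psi *: S = c *m rowsub f Phi + c' *m rowsub g (1%:M - Phi).
    by rewrite -mul_row_col hsubmxK -mulmxA mul_adj_mx mul_mx_scalar.
  have {}e1 : \det Psi *: S = c *m rowsub f Phi.
    rewrite -{1}SPhi scalemxAl e1 mulmxDl -!mulmxA !mul_rowsub_mx PhiPhi.
    rewrite mulmxBl mul1mx PhiPhi subrr.
    suff -> : rowsub g (0 : 'M[E]_(m + b)) = 0 by rewrite mulmx0 addr0.
    by apply/matrixP => i j; rewrite !mxE.
  rewrite [in LHS](sx y) scaler_sumr.
  transitivity (\sum_j (\det Psi *: S) 0 j *: x j).
    by apply: eq_bigr => j _; rewrite !mxE scalerA.
  rewrite e1.
  transitivity (\sum_j \sum_i (c 0 i * s j (x (f i))) *: x j).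
    apply: eq_bigr => j _; rewrite mxE scaler_suml.
    by apply: eq_bigr => i _; rewrite !mxE.
  rewrite exchange_big /=; apply: eq_bigr => i _.
  rewrite [in RHS](sx (x (f i))) scaler_sumr.
  by apply: eq_bigr => j _; rewrite scalerA.
exists (\det Psi); split=> // i.
(* A relation among the chosen generators, padded by zeros, is a row vector killed by [Psi];
   multiplying by the adjugate shows that the determinant kills it. *)
pose C : 'rV[E]_(m + b) := row_mx (\row_i c i) 0.
have CPsi : C *m Psi = 0.
  rewrite mul_row_col mul0mx addr0; apply/rowP => j; rewrite !mxE.
  have := congr1 (s j) c0; rewrite lin_sum //.
  have -> : s j 0 = 0.
    by have := sL j 1 0 0; rewrite scale1r mul1r addr0 => /eqP;
      rewrite -subr_eq subrr => /eqP.
  by move=> h0; rewrite -[RHS]h0; apply: eq_bigr => l _; rewrite !mxE.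
have := congr1 (fun M => (M *m \adj Psi) 0 (lshift b i)) CPsi.
rewrite mul0mx -mulmxA mul_mx_adj mul_mx_scalar !mxE.
by rewrite -[lshift b i]/(unsplit (inl i)) unsplitK mxE.
Qed.

End Presentations.

Section SubLmodule.
Variables (E : comNzRingType) (N : lmodType E) (S : set N).
Hypothesis S_sub : submodule setT S.

Definition sublmod_pred (_ : submodule setT S) : {pred N} := fun x => `[< S x >].

Lemma sublmod_closed : submod_closed (sublmod_pred S_sub).
Proof.
have [S0 SL] := S_sub; split; first exact/asboolP.
by move=> a x y /asboolP Sx /asboolP Sy; apply/asboolP; exact: SL.
Qed.

HB.instance Definition _ :=
  GRing.isSubmodClosed.Build E N (sublmod_pred S_sub) sublmod_closed.

Record sublmod := SubLmod {
  sublmod_val :> N; _ : sublmod_val \in sublmod_pred S_sub }.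

HB.instance Definition _ := [isSub for sublmod_val].
HB.instance Definition _ := [Choice of sublmod by <:].
HB.instance Definition _ := [SubChoice_isSubLmodule of sublmod by <:].

Lemma sublmodP (x : sublmod) : S (val x).
Proof. by have /asboolP := valP x. Qed.

Lemma to_sublmod_proof x : S x -> x \in sublmod_pred S_sub.
Proof. by move=> Sx; apply/asboolP. Qed.

End SubLmodule.

(** * The coordinate ring of a curve *)

Section Valuation.
Variables (F : fieldType) (v : F -> int).
Hypothesis vP : is_place v.

Lemma val_geW m n x : m <= n -> val_ge v n x -> val_ge v m x.
Proof. by move=> mn [->|h]; [left|right; exact: le_trans h]. Qed.

Lemma val_geN n x : val_ge v n x -> val_ge v n (- x).
Proof. by case=> [->|h]; [left; rewrite oppr0|right; rewrite (placeN _ vP)]. Qed.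

Lemma val_geB n x y : val_ge v n x -> val_ge v n y -> val_ge v n (x - y).
Proof. by move=> hx hy; apply: (placeD vP) => //; exact: val_geN. Qed.

Lemma val_geM m n x y : val_ge v m x -> val_ge v n y -> val_ge v (m + n) (x * y).
Proof.
case=> [->|hx]; first by rewrite mul0r; left.
case=> [->|hy]; first by rewrite mulr0; left.
have [->|x0] := eqVneq x 0; first by rewrite mul0r; left.
have [->|y0] := eqVneq y 0; first by rewrite mulr0; left.
by right; rewrite (placeM vP) // lerD.
Qed.

Lemma val_ge_sum (I : Type) (r : seq I) (P : pred I) (f : I -> F) n :
  (forall i, P i -> val_ge v n (f i)) -> val_ge v n (\sum_(i <- r | P i) f i).
Proof.
move=> h; apply: big_ind => //; first by left.
by move=> x y hx hy; apply: (placeD vP).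
Qed.

Lemma val_geX x n : val_ge v 1 x -> val_ge v n%:Z (x ^+ n).
Proof.
move=> h; elim: n => [|n IH]; first by right; rewrite expr0 (place1 vP).
by rewrite exprS intS; exact: val_geM.
Qed.

Lemma val_ge1 : val_ge v 0 1. Proof. by right; rewrite (place1 vP). Qed.

Lemma val_geX0 x n : val_ge v 0 x -> val_ge v 0 (x ^+ n).
Proof.
move=> h; elim: n => [|n IH]; first exact: val_ge1.
by rewrite exprS -[0]addr0; exact: val_geM.
Qed.

Lemma val_geE n x : x != 0 -> val_ge v n x <-> n <= v x.
Proof. by move=> /eqP x0; split=> [[]|]; [|by []|right]. Qed.

Lemma placeV x : x != 0 -> v x^-1 = - v x.
Proof.
move=> x0; have := placeM vP x0 (invr_neq0 x0).
by rewrite divff // (place1 vP) => /esym/eqP; rewrite addrC addr_eq0 => /eqP.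
Qed.

(** If [v g] were negative, every term on the right would have valuation at least [(n - 1) * v g],
    which exceeds [n * v g]. *)
Lemma integral_val_ge0 (n : nat) (a : 'I_n -> F) g :
  (forall i, val_ge v 0 (a i)) -> g ^+ n = \sum_i a i * g ^+ i -> val_ge v 0 g.
Proof.
move=> ha eq; have [->|g0] := eqVneq g 0; first by left.
apply/(val_geE _ g0); rewrite leNgt; apply/negP => vg.
case: n a ha eq => [|n] a ha eq.
  by move: eq; rewrite expr0 big_ord0 => /eqP; rewrite oner_eq0.
have : val_ge v (v g *+ n) (g ^+ n.+1).
  rewrite eq; apply: val_ge_sum => i _; rewrite -[_ *+ _]add0r; apply: val_geM => //.
  right; rewrite (placeX _ vP) //; have := leq_ord i; nia.
by move/(val_geE _ (expf_neq0 _ g0)); rewrite (placeX _ vP) // mulrS; lia.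
Qed.

End Valuation.

(** * The function field as fraction field of the coordinate ring *)

Section CoordFractions.
Variables (Fq : finFieldType) (F : fieldType) (iF : {rmorphism Fq -> F}).
Hypothesis F_curve : function_field iF.

Lemma const_val_ge0 v c : is_place v -> val_ge v 0 (iF c).
Proof.
move=> vP; have /asboolP h := coord_const_proof iF v c.
have [->|c0] := eqVneq (iF c) 0; first by left.
right; have [->|c0'] := eqVneq c 0; first by rewrite rmorph0 (place0 vP).
rewrite (@place_fin _ v (iF c) #|Fq|.-2 vP) //.
have q1 := finNzRing_gt1 Fq; rewrite -rmorphXn.
have -> : c ^+ #|Fq|.-2.+1 = 1.
  by apply: (mulfI c0'); rewrite -exprS mulr1; case: #|Fq| q1 (expf_card c) => [|[]].
by rewrite rmorph1.
Qed.

Lemma const_val v c : is_place v -> c != 0 -> v (iF c) = 0.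
Proof.
move=> vP c0; apply/eqP; rewrite eq_le.
have h1 := const_val_ge0 c vP; have h2 := const_val_ge0 c^-1 vP.
have i0 : iF c != 0 by rewrite fmorph_eq0.
have i1 : iF c^-1 != 0 by rewrite fmorph_eq0 invr_eq0.
move/(val_geE v 0 i0): h1 => ->; move/(val_geE v 0 i1): h2.
by rewrite fmorphV (placeV vP) // oppr_ge0 andbT.
Qed.

Section Transcendental.
Variables (v : F -> int) (t : F).
Hypotheses (vP : is_place v) (t0 : t != 0) (vt : 0 < v t).

Lemma horner_val_ge0 (p : {poly Fq}) : val_ge v 0 (map_poly iF p).[t].
Proof.
elim/poly_ind: p => [|p c IH]; first by rewrite rmorph0 horner0; left.
rewrite rmorphD rmorphM /= map_polyX map_polyC hornerMXaddC.
apply: (placeD vP); last exact: const_val_ge0.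
by rewrite -[0]addr0; apply: (val_geM vP) => //; right; exact: ltW.
Qed.

(** After factors of [t] are removed, the constant term is nonzero of valuation [0] while the other
    terms have positive valuation, so nothing can cancel it. Thus [t] is transcendental over
    [Fq]. *)
Lemma horner_place_neq0 (p : {poly Fq}) : p != 0 -> (map_poly iF p).[t] != 0.
Proof.
elim/poly_ind: p => [|p c IH]; first by rewrite eqxx.
rewrite rmorphD rmorphM /= map_polyX map_polyC hornerMXaddC.
have [->|c0] := eqVneq c 0.
  rewrite polyC0 addr0 mulf_eq0 polyX_eq0 orbF => /IH h.
  by rewrite raddf0 addr0 mulf_neq0.
move=> _; apply/eqP => /eqP; rewrite addr_eq0 => /eqP h.
have h1 : val_ge v 1 ((map_poly iF p).[t] * t).
  by rewrite -[1]add0r; apply: (val_geM vP); [exact: horner_val_ge0|right].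
move: h1; rewrite h => /(val_geN vP); rewrite opprK.
have i0 : iF c != 0 by rewrite fmorph_eq0.
by move/(val_geE v 1 i0); rewrite (const_val vP c0).
Qed.

End Transcendental.

Section Bounded.
Implicit Types (e : nat).

Definition mx_bounded e m n (M : 'M[{poly Fq}]_(m, n)) : Prop :=
  forall i j, (size (M i j) <= e.+1)%N.

Lemma mx_boundedM e1 e2 m n p (A : 'M_(m, n)) (B : 'M_(n, p)) :
  mx_bounded e1 A -> mx_bounded e2 B -> mx_bounded (e1 + e2) (A *m B).
Proof.
move=> hA hB i j; rewrite mxE; apply: leq_trans (size_sum _ _ _) _.
apply/bigmax_leqP => k _; apply: leq_trans (size_polyMleq _ _) _.
by have := hA i k; have := hB k j; case: (size _) => [|a]; case: (size _) => [|b] /=; lia.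
Qed.

Lemma mx_boundedX e m (A : 'M_m) n : mx_bounded e A -> mx_bounded (n * e) (A ^+ n).
Proof.
move=> hA; elim: n => [|n IH]; last by rewrite exprS mulSn; exact: mx_boundedM.
by move=> i j; rewrite expr0 mxE; case: (_ == _); rewrite ?size_poly1 ?size_poly0.
Qed.

Lemma mx_boundedZ e1 e2 m n (A : 'M_(m, n)) (p : {poly Fq}) :
  (size p <= e1.+1)%N -> mx_bounded e2 A -> mx_bounded (e1 + e2) (p *: A).
Proof.
move=> hp hA i j; rewrite mxE; apply: leq_trans (size_polyMleq _ _) _.
by have := hA i j; case: (size _) hp => [|a]; case: (size _) => [|b] /=; lia.
Qed.

Lemma mx_bounded_exists m n (A : 'M[{poly Fq}]_(m, n)) : exists e, mx_bounded e A.
Proof.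
exists (\max_i \max_j size (A i j))%N => i j; apply: leqW.
apply: leq_trans (leq_bigmax i); exact: (leq_bigmax j).
Qed.

Lemma size_boundedX e (p : {poly Fq}) n :
  (size p <= e.+1)%N -> (size (p ^+ n) <= (n * e).+1)%N.
Proof.
move=> hp; have := size_poly_exp_leq p n; move: (size p) (size (p ^+ n)) hp => k l hk.
have : (k.-1 <= e)%N by lia.
by move: k.-1 => l'; nia.
Qed.

End Bounded.

Section Algebraic.
Variables (t f : F).

Lemma mul_mx_exists (x : F) n (b : 'I_n -> F) :
  (forall p : {poly Fq}, p != 0 -> (map_poly iF p).[x] != 0) ->
  (forall f : F, exists (den : {poly Fq}) (num : 'I_n -> {poly Fq}),
        den != 0 /\
        (map_poly iF den).[x] * f = \sum_i (map_poly iF (num i)).[x] * b i) ->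
  forall m (y : 'I_m -> F),
  exists (den : {poly Fq}) (M : 'M[{poly Fq}]_(m, n)), den != 0 /\
    forall l, (map_poly iF den).[x] * y l = \sum_k (map_poly iF (M l k)).[x] * b k.
Proof.
move=> xtr bgen m y.
have [den h] := choice (fun l => bgen (y l)).
have [num {}h] := choice h.
exists (\prod_l den l), (\matrix_(l, k) ((\prod_(l' | l' != l) den l') * num l k)).
split=> [|l]; first by apply/prodf_neq0 => l _; have [] := h l.
rewrite (bigD1 l) //= rmorphM hornerM mulrAC (proj2 (h l)) mulr_suml.
by apply: eq_bigr => k _; rewrite mxE rmorphM hornerM; ring.
Qed.

Definition ev_poly2 n (c : {ffun 'I_n * 'I_n -> Fq}) : F :=
  \sum_(ij : 'I_n * 'I_n) iF (c ij) * (t ^+ ij.1 * f ^+ ij.2).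

(* Counting: after clearing denominators the [n ^ 2] monomials lie in a
   space whose dimension grows linearly in [n]. *)
Lemma algebraic_relation : exists n (c : {ffun 'I_n * 'I_n -> Fq}),
  (exists ij, c ij != 0) /\ ev_poly2 c = 0.
Proof.
have [x [xtr [N [b bgen]]]] := F_curve.
pose hx (p : {poly Fq}) := (map_poly iF p).[x].
have hxM p1 p2 : hx (p1 * p2) = hx p1 * hx p2 by rewrite /hx rmorphM hornerM.
have hxD p1 p2 : hx (p1 + p2) = hx p1 + hx p2 by rewrite /hx rmorphD hornerD.
have hx0 : hx 0 = 0 by rewrite /hx rmorph0 horner0.
have hx1 : hx 1 = 1 by rewrite /hx rmorph1 hornerC.
have hxX p k : hx (p ^+ k) = hx p ^+ k.
  by elim: k => [|k IH]; rewrite ?expr0 // !exprS hxM IH.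
have hxC c : hx c%:P = iF c by rewrite /hx map_polyC hornerC.
have hxS (I : finType) (G : I -> {poly Fq}) : hx (\sum_i G i) = \sum_i hx (G i).
  exact: (big_morph hx hxD hx0).
have mulE := mul_mx_exists xtr bgen.
have [Dt [Mt [Dt0 ht]]] := mulE _ (fun l => t * b l).
have [Df [Mf [Df0 hf]]] := mulE _ (fun l => f * b l).
have [D1 [o [D10 ho]]] := mulE 1%N (fun=> 1).
pose D := Dt * Df.
have D0 : D != 0 by rewrite mulf_neq0.
pose At := Df *: Mt; pose Af := Dt *: Mf.
pose comb (w : 'rV[{poly Fq}]_N) := \sum_k hx (w 0 k) * b k.
have combM (w : 'rV_N) (A : 'M_N) (g : F) :
   (forall l, hx D * (g * b l) = \sum_k hx (A l k) * b k) ->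
   comb (w *m A) = hx D * g * comb w.
  move=> hA; rewrite /comb mulr_sumr.
  transitivity (\sum_k \sum_l hx (w 0 l) * (hx (A l k) * b k)).
    apply: eq_bigr => k _; rewrite mxE hxS mulr_suml.
    by apply: eq_bigr => l _; rewrite hxM mulrA.
  rewrite exchange_big /=; apply: eq_bigr => l _.
  by rewrite -mulr_sumr -hA; ring.
have hAt l : hx D * (t * b l) = \sum_k hx (At l k) * b k.
  rewrite /D hxM mulrC mulrA mulrC [_ * hx Dt]mulrC -[in LHS]/(hx Dt) ht mulr_sumr.
  by apply: eq_bigr => k _; rewrite mxE hxM mulrA.
have hAf l : hx D * (f * b l) = \sum_k hx (Af l k) * b k.
  rewrite /D hxM -mulrA -[in LHS]/(hx Df) hf mulr_sumr.
  by apply: eq_bigr => k _; rewrite mxE hxM mulrA.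
have combX (w : 'rV_N) (A : 'M_N) (g : F) k :
   (forall l, hx D * (g * b l) = \sum_k hx (A l k) * b k) ->
   comb (w *m A ^+ k) = (hx D * g) ^+ k * comb w.
  move=> hA; elim: k => [|k IH]; first by rewrite !expr0 mulmx1 mul1r.
  by rewrite exprSr mulmxA (combM _ _ g) // IH exprS mulrA.
have comb1 : comb o = hx D1 by rewrite /comb -ho mulr1.
have [et bt] := mx_bounded_exists At; have [ef bf] := mx_bounded_exists Af.
have [eo bo] := mx_bounded_exists o.
(* [e] dominates all degrees involved, [B n] bounds the sizes of the cleared polynomials, and [n] is
   chosen so large that [n ^ 2 > N * B n]. *)
pose e := (et + ef + eo + size D)%N.
pose B n := ((n + n) * e + e).+1%N.
pose n := (N * (4 * e + 4)).+1%N.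
(* The powers of [D] are padded so that all monomials acquire the same factor
   [hx D1 * hx D ^+ (n + n)]. *)
pose w (ij : 'I_n * 'I_n) : 'rV[{poly Fq}]_N :=
  D ^+ (n - ij.1) *: (D ^+ (n - ij.2) *: (o *m At ^+ ij.1 *m Af ^+ ij.2)).
have wB ij : forall k, (size (w ij 0%R k) <= B n)%N.
  move=> k; have : mx_bounded ((n - ij.1) * e + ((n - ij.2) * e + (eo + ij.1 * et + ij.2 * ef))) (w ij).
    have De : (size D <= e.+1)%N by rewrite /e; lia.
    apply: mx_boundedZ; first exact: size_boundedX.
    apply: mx_boundedZ; first exact: size_boundedX.
    by apply: mx_boundedM; [apply: mx_boundedM => //|]; exact: mx_boundedX.
  move=> /(_ 0 k) /leq_trans; apply; rewrite /B ltnS.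
  by have := ltn_ord ij.1; have := ltn_ord ij.2; rewrite /e; nia.
have wE ij : comb (w ij) = hx D1 * hx D ^+ (n + n) * (t ^+ ij.1 * f ^+ ij.2).
  have combZ (p : {poly Fq}) w' : comb (p *: w') = hx p * comb w'.
    by rewrite /comb mulr_sumr; apply: eq_bigr => k _; rewrite mxE hxM mulrA.
  rewrite !combZ !hxX (combX _ _ f) // (combX _ _ t) // comb1 !exprMn.
  have i1 := ltnW (ltn_ord ij.1); have i2 := ltnW (ltn_ord ij.2).
  have e1 : hx D ^+ n = hx D ^+ (n - ij.1) * hx D ^+ ij.1 by rewrite -exprD subnK.
  have e2 : hx D ^+ n = hx D ^+ (n - ij.2) * hx D ^+ ij.2 by rewrite -exprD subnK.
  by rewrite exprD {1}e1 e2; ring.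
pose phi (c : {ffun 'I_n * 'I_n -> Fq}) : {ffun 'I_N * 'I_(B n) -> Fq} :=
  [ffun ke : 'I_N * 'I_(B n) => (\sum_ij (c ij)%:P * w ij 0 ke.1)`_ke.2].
have : ~ injective phi.
  move/leq_card; rewrite !card_ffun !card_prod !card_ord leq_exp2l ?finNzRing_gt1 //.
  by rewrite /B /n; nia.
move/existsNP => [c1 /existsNP[c2 /not_implyP[eqphi /eqP nc]]].
exists n, [ffun ij => c1 ij - c2 ij]; split.
  apply: contrapT => /forallNP h; move/eqP: nc; apply; apply/ffunP => ij.
  by have := h ij; rewrite ffunE subr_eq0 => /negP; rewrite negbK => /eqP.
have same k : \sum_ij (c1 ij)%:P * w ij 0 k = \sum_ij (c2 ij)%:P * w ij 0 k.
  apply/polyP => l; case: (ltnP l (B n)) => hl.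
    by have := congr1 (fun g : {ffun 'I_N * 'I_(B n) -> Fq} => g (k, Ordinal hl)) eqphi; rewrite !ffunE.
  have sz (c : {ffun 'I_n * 'I_n -> Fq}) : (\sum_ij (c ij)%:P * w ij 0 k)`_l = 0.
    rewrite nth_default // (leq_trans _ hl) //.
    apply: leq_trans (size_sum _ _ _) _; apply/bigmax_leqP => ij _.
    rewrite mul_polyC; apply: leq_trans (size_scale_leq _ _) _; exact: wB.
  by rewrite !sz.
have h1 : hx D1 * hx D ^+ (n + n) != 0.
  by rewrite mulf_neq0 ?expf_neq0 ?xtr.
apply: (mulfI h1); rewrite mulr0 /ev_poly2 mulr_sumr.
transitivity (\sum_ij iF (c1 ij - c2 ij) * comb (w ij)).
  by apply: eq_bigr => ij _; rewrite ffunE wE; ring.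
transitivity (\sum_k (hx (\sum_ij (c1 ij)%:P * w ij 0 k) -
                      hx (\sum_ij (c2 ij)%:P * w ij 0 k)) * b k).
  rewrite /comb; under eq_bigr => ij _ do rewrite mulr_sumr.
  rewrite exchange_big /=; apply: eq_bigr => k _.
  rewrite !hxS -sumrB mulr_suml; apply: eq_bigr => ij _.
  by rewrite !hxM !hxC rmorphB; ring.
by rewrite big1 // => k _; rewrite same subrr mul0r.
Qed.

End Algebraic.

Section Integral.
Variables (infty : F -> int) (v : F -> int) (t : coord_ring infty).
Hypotheses (vP : is_place v) (t0 : coord_val t != 0) (vt : 0 < v (coord_val t)).

Lemma coord_val_ge0 (a : coord_ring infty) v' :
  is_place v' -> v' <> infty -> val_ge v' 0 (coord_val a).
Proof. by move=> v'P v'i; right; have /asboolP := valP a; apply. Qed.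

Lemma coord_ringP (f : F) :
  (forall v', is_place v' -> v' <> infty -> val_ge v' 0 f) ->
  exists a : coord_ring infty, coord_val a = f.
Proof.
move=> h; have fA : f \in coord_pred infty.
  by apply/asboolP => v' v'P v'i; case: (h v' v'P v'i) => [->|//]; rewrite (place0 v'P).
by exists (CoordRing fA).
Qed.

(** [f] satisfies an algebraic equation with coefficients in [Fq[t]]. Multiplied by its leading
    coefficient, which is nonzero since [t] is transcendental, [f] becomes integral over [Fq[t]] and
    hence regular at every place other than [infty]. *)
Lemma coord_frac (f : F) : exists a b : coord_ring infty,
  coord_val b != 0 /\ f = coord_val a / coord_val b.
Proof.
have [n [c [[ij0 cij0] rel]]] := algebraic_relation (coord_val t) f.
set T := coord_val t in rel.
pose cc (i j : nat) : Fq := if insub i is Some i' then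
   (if insub j is Some j' then c (i', j') else 0) else 0.
have ccE (i j : 'I_n) : cc i j = c (i, j) by rewrite /cc !valK.
pose p (j : nat) : {poly Fq} := \poly_(i < n) cc i j.
have pE (j : 'I_n) : (map_poly iF (p j)).[T] = \sum_(i < n) iF (c (i, j)) * T ^+ i.
  rewrite (horner_coef_wide (n := n)); last first.
    by rewrite size_map_poly; exact: size_poly.
  by apply: eq_bigr => i _; rewrite coef_map coef_poly ltn_ord ccE.
pose C (j : nat) := (map_poly iF (p j)).[T].
have relp : \sum_(0 <= j < n) C j * f ^+ j = 0.
  rewrite -{}[RHS]rel /ev_poly2 big_mkord.
  rewrite (eq_bigr (fun ij => (fun i j => iF (c (i, j)) * (T ^+ i * f ^+ j)) ij.1 ij.2));
    last by case.
  rewrite -(pair_bigA _ (fun i j => iF (c (i, j)) * (T ^+ i * f ^+ j))) /=.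
  rewrite exchange_big /=; apply: eq_bigr => j _; rewrite /C pE mulr_suml.
  by apply: eq_bigr => i _; rewrite mulrA.
have p0 : exists j, (p j != 0) && (j < n)%N.
  exists ij0.2; rewrite ltn_ord andbT; apply/eqP => /polyP /(_ ij0.1).
  by rewrite coef_poly ltn_ord coef0 ccE -surjective_pairing; exact/eqP.
have p0b j : (p j != 0) && (j < n)%N -> (j <= n)%N by case/andP => _ /ltnW.
have [j0 /andP[pj0 j0n] jmax] := ex_maxnP p0 p0b.
have Cj0 : C j0 != 0 by exact: (horner_place_neq0 vP).
have CA j v' : is_place v' -> v' <> infty -> val_ge v' 0 (C j).
  move=> v'P v'i; rewrite /C horner_coef; apply: (val_ge_sum v'P) => i _.
  rewrite -[0]addr0; apply: (val_geM v'P); first by rewrite coef_map; exact: const_val_ge0.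
  by apply: (val_geX0 v'P); exact: coord_val_ge0.
have [b bE] : exists b : coord_ring infty, coord_val b = C j0.
  by apply: coord_ringP => v' v'P v'i; exact: CA.
have [a aE] : exists a : coord_ring infty, coord_val a = C j0 * f.
  apply: coord_ringP => v' v'P v'i.
  (* Coefficients of the monic equation for [C j0 * f], obtained by multiplying the relation with
     [C j0 ^+ j0.-1]. *)
  pose al (j : 'I_j0) := - (C j * C j0 ^+ (j0.-1 - j)).
  apply: (integral_val_ge0 v'P (a := al)) => [j|].
    apply: (val_geN v'P); rewrite -[0]addr0; apply: (val_geM v'P); first exact: CA.
    by apply: (val_geX0 v'P); exact: CA.
  have relj : \sum_(0 <= j < j0) C j * f ^+ j + C j0 * f ^+ j0 = 0.
    rewrite -big_nat_recr //= -[RHS]relp (@big_cat_nat _ _ _ j0.+1 0 n) //=.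
    rewrite [X in _ = _ + X]big1_seq ?addr0 //= => j; rewrite mem_index_iota => /andP[h1 h2].
    have [pj|pj] := eqVneq (p j) 0; first by rewrite /C pj rmorph0 horner0 mul0r.
    by have := jmax j; rewrite pj h2 => /(_ isT); rewrite leqNgt h1.
  case: j0 relj @al {pj0 j0n jmax bE} Cj0 => [|k] relj al Cj0.
    by move: relj; rewrite big_nil add0r expr0 mulr1 => /eqP; rewrite (negbTE Cj0).
  have : C k.+1 ^+ k * (\sum_(0 <= j < k.+1) C j * f ^+ j + C k.+1 * f ^+ k.+1) = 0.
    by rewrite relj mulr0.
  rewrite mulrDr => /eqP; rewrite addrC addr_eq0 => /eqP h.
  rewrite exprMn exprSr -mulrA h big_mkord mulr_sumr -sumrN; apply: eq_bigr => j _.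
  rewrite /al /= mulNr; congr (- _).
  have -> : C k.+1 ^+ k = C k.+1 ^+ (k - j) * C k.+1 ^+ j.
    by rewrite -exprD subnK // -ltnS ltn_ord.
  by rewrite exprMn; ring.
exists a, b; rewrite bE aE; split=> //.
by rewrite mulrAC divff ?mul1r.
Qed.

End Integral.

End CoordFractions.

(** * Local uniformizers *)

Section QuotientDim.
Variables (k : finFieldType) (T : nzRingType) (f : {rmorphism k -> T}).

(** Over a finite field a dimension is determined by the size of a transversal. Counting also
    compares a basis with systems of representatives of another shape, such as digit expansions. *)
Lemma card_transversal (T1 T2 : finType) (F1 : T1 -> T) (F2 : T2 -> T) (V W : set T) :
  (forall x y, W x -> W y -> W (x - y)) ->
  (forall c, V (F1 c)) -> (forall c, V (F2 c)) ->
  (forall x, V x -> exists! c, W (x - F1 c)) ->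
  (forall x, V x -> exists! c, W (x - F2 c)) -> #|T1| = #|T2|.
Proof.
have le (S1 S2 : finType) (G1 : S1 -> T) (G2 : S2 -> T) :
  (forall x y, W x -> W y -> W (x - y)) -> (forall c, V (G1 c)) ->
  (forall x, V x -> exists! c, W (x - G1 c)) ->
  (forall x, V x -> exists! c, W (x - G2 c)) -> (#|S1| <= #|S2|)%N.
  move=> WB V1 h1 h2.
  have [g hg] := choice (fun c => let: ex_intro y (conj hy _) := h2 _ (V1 c) in ex_intro _ y hy).
  apply: (leq_card g) => c c' gc.
  have [c0 [_ u0]] := h1 _ (V1 c).
  have W0 : W 0 by have := WB _ _ (hg c) (hg c); rewrite subrr.
  rewrite -(u0 c) ?subrr //; apply: u0.
  by have := WB _ _ (hg c) (hg c'); rewrite gc opprB addrA subrK.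
by move=> WB V1 V2 h1 h2; apply/eqP; rewrite eqn_leq (le _ _ F1 F2) // (le _ _ F2 F1).
Qed.

Lemma has_quotient_dim_uniq (V W : set T) d1 d2 :
  (forall x y, W x -> W y -> W (x - y)) ->
  (forall c x, V x -> V (f c * x)) -> (forall x y, V x -> V y -> V (x + y)) -> V 0 ->
  has_quotient_dim f V W d1 -> has_quotient_dim f V W d2 -> d1 = d2.
Proof.
move=> WB VM VD V0 [b1 Vb1 h1] [b2 Vb2 h2].
have Vs d (b : 'I_d -> T) (c : {ffun 'I_d -> k}) : (forall i, V (b i)) -> V (\sum_i f (c i) * b i).
  by move=> Vb; apply: big_ind => // i _; exact: VM.
have := card_transversal WB (fun c => Vs _ _ c Vb1) (fun c => Vs _ _ c Vb2) h1 h2.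
by rewrite !card_ffun !card_ord => /eqP; rewrite eqn_exp2l ?finNzRing_gt1 // => /eqP.
Qed.

Lemma quotient_dimE (V W : set T) d :
  (forall x y, W x -> W y -> W (x - y)) ->
  (forall c x, V x -> V (f c * x)) -> (forall x y, V x -> V y -> V (x + y)) -> V 0 ->
  has_quotient_dim f V W d -> quotient_dim f V W = d.
Proof.
move=> WB VM VD V0 hd; apply: (has_quotient_dim_uniq WB VM VD V0 _ hd).
by rewrite /quotient_dim; case: xgetP => // /(_ d).
Qed.

(** A positive value cannot be the default [0], so a basis of this size exists. *)
Lemma quotient_dimP (V W : set T) :
  (0 < quotient_dim f V W)%N -> has_quotient_dim f V W (quotient_dim f V W).
Proof. by rewrite /quotient_dim; case: xgetP. Qed.

End QuotientDim.

Section Uniformizer.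
Variables (Fq : finFieldType) (F : fieldType) (iF : {rmorphism Fq -> F}).
Hypothesis F_curve : function_field iF.
Variables (infty v : F -> int).
Local Notation A := (coord_ring infty).
Local Notation cv := (@coord_val F infty).
Hypotheses (vP : is_place v) (v_fin : v <> infty).
Variable wp : set A.
Hypotheses (wp_max : maximal_ideal wp)
  (wpE : forall a : A, wp a <-> val_ge v 1 (cv a)).
Variables (t : A) (n : nat).
Hypotheses (n_gt0 : (0 < n)%N) (t_gen : principal_ideal t = ideal_exp wp n)
  (t0 : t != 0).
Implicit Types (a b : A).

Lemma cvM a b : cv (a * b) = cv a * cv b. Proof. by []. Qed.
Lemma cvD a b : cv (a + b) = cv a + cv b. Proof. by []. Qed.
Lemma cvB a b : cv (a - b) = cv a - cv b. Proof. by []. Qed.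
Lemma cv1 : cv 1 = 1. Proof. by []. Qed.
Lemma cv0 : cv 0 = 0. Proof. by []. Qed.
Lemma cvX a k : cv (a ^+ k) = cv a ^+ k.
Proof. by elim: k => [|k IH]; rewrite ?expr0 // !exprS cvM IH. Qed.
Lemma cv_eq0 a : (cv a == 0) = (a == 0).
Proof. by rewrite -cv0 (inj_eq val_inj). Qed.

Lemma coord_mulIr c a b : c != 0 -> a * c = b * c -> a = b.
Proof.
move=> c0 /(congr1 cv); rewrite !cvM => h; apply: val_inj => /=.
by apply: mulIf h; rewrite cv_eq0.
Qed.

Lemma cv_ge0 a : val_ge v 0 (cv a).
Proof. exact: coord_val_ge0. Qed.

Let wpI : is_ideal wp. Proof. by case: wp_max. Qed.
Let wp0 : wp 0. Proof. by case: wpI. Qed.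
Let wpD a b : wp a -> wp b -> wp (a + b). Proof. by case: wpI => _ h _; exact: h. Qed.
Let wpMl a b : wp b -> wp (a * b). Proof. by case: wpI => _ _; apply. Qed.
Let wp1 : ~ wp 1. Proof. by case: wp_max. Qed.

Lemma wp_compl a : ~ wp a -> cv a != 0 /\ v (cv a) = 0.
Proof.
move=> na; have a0 : cv a != 0.
  by rewrite cv_eq0; apply/eqP => e; apply: na; rewrite e.
split=> //; have /(val_geE v) h := cv_ge0 a; have {h} := h a0.
by have : ~ 1 <= v (cv a) by [move=> h; apply: na; apply/wpE; right]; lia.
Qed.

Lemma wp_inv_mod a : ~ wp a -> exists b, wp (1 - a * b).
Proof.
move=> na; pose J : set A := [set x | exists b y, wp y /\ x = b * a + y].
have JI : is_ideal J.
  split=> [|x y [b1 [y1 [h1 ->]]] [b2 [y2 [h2 ->]]]|c x [b [y [h ->]]]].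
  - by exists 0, 0; split=> //; rewrite mul0r addr0.
  - by exists (b1 + b2), (y1 + y2); split; [exact: wpD|ring].
  - by exists (c * b), (c * y); split; [exact: wpMl|ring].
have sJ : wp `<=` J by move=> y hy; exists 0, y; split=> //; rewrite mul0r add0r.
have [_ _ mx] := wp_max; have [JE|JE] := mx J JI sJ.
  by exfalso; apply: na; rewrite -JE; exists 1, 0; split=> //; rewrite mul1r addr0.
have [b [y [hy e]]] : J 1 by rewrite JE.
by exists b; rewrite e; have -> : b * a + y - a * b = y by ring.
Qed.

(* [wp] is invertible because its power [wp ^ n] is principal. *)
Lemma wp_locally_principal :
  exists p s, [/\ wp p, ~ wp s & forall a, wp a -> exists a', s * a = p * a'].
Proof.
case: n n_gt0 t_gen => // n' _ tg.
have : ideal_exp wp n'.+1 t by rewrite -tg; exists 1; rewrite mul1r.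
move=> [m [f [g [wf wg tE]]]].
have mem x y : wp x -> ideal_exp wp n' y -> exists z, x * y = z * t.
  move=> hx hy; have : ideal_exp wp n'.+1 (x * y).
    by exists 1%N, (fun=> x), (fun=> y); rewrite big_ord1.
  by rewrite -tg.
have [s hs] := choice (fun i => mem _ _ (wf i) (wg i)).
have s1 : \sum_i s i = 1.
  apply: (@coord_mulIr t) => //; rewrite mul1r mulr_suml [RHS]tE.
  by apply: eq_bigr => i _; rewrite hs.
(* The quotients [s i = f i * g i / t] add up to [1], so one of them lies outside [wp]; for that
   index [f i] generates [wp] locally. *)
have [i nsi] : exists i, ~ wp (s i).
  apply: contrapT => /forallNP h; apply: wp1; rewrite -s1.
  by apply: big_ind => // i _; apply: contrapT; exact: h.
exists (f i), (s i); split=> // a /mem/(_ (wg i)) [z hz]; exists z.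
apply: (@coord_mulIr t) => //; rewrite mulrAC -hs -[RHS]mulrA -hz; ring.
Qed.

Lemma wp_t : wp t.
Proof.
case: n n_gt0 t_gen => // n' _ tg.
have : ideal_exp wp n'.+1 t by rewrite -tg; exists 1; rewrite mul1r.
move=> [m [f [g [wf wg ->]]]].
by apply: big_ind => // i _; rewrite mulrC; exact: wpMl.
Qed.

Lemma t_place : 0 < v (cv t) /\ cv t != 0.
Proof.
have ct0 : cv t != 0 by rewrite cv_eq0.
by split=> //; move: wp_t => /wpE /(val_geE v 1 ct0); lia.
Qed.

Lemma frac_coord (f : F) : exists a b, b != 0 /\ f = cv a / cv b.
Proof.
have [vt ct0] := t_place.
have [a [b [b0 ->]]] := coord_frac F_curve vP ct0 vt f.
by exists a, b; rewrite -cv_eq0.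
Qed.

(** Dividing repeatedly by the local generator [p] shows that every value of [v] on nonzero elements
    of [A] is a multiple of [v (cv p)]. Since [v] is normalized and [F] consists of fractions from
    [A], this value is [1]. *)
Lemma uniformizer_exists :
  exists p s, [/\ v (cv p) = 1, ~ wp s & forall a, wp a -> exists a', s * a = p * a'].
Proof.
have [p [s [wpp ns ps]]] := wp_locally_principal.
exists p, s; split=> //.
have [s0 vs] := wp_compl ns.
have p0 : cv p != 0.
  apply/eqP => p0; have [a' /(congr1 cv)] := ps t wp_t.
  rewrite !cvM p0 mul0r => /eqP; rewrite mulf_eq0 (negbTE s0) /=.
  by have [_ /negbTE ->] := t_place.
have vp : 1 <= v (cv p) by apply/(val_geE v 1 p0)/wpE.
have mult m a : cv a != 0 -> (absz (v (cv a)) <= m)%N ->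
    exists k : nat, v (cv a) = v (cv p) *+ k.
  elim: m a => [|m IH] a a0 am.
    exists 0%N; rewrite mulr0n; lia.
  have [wa|/wp_compl[_ ->]] := pselect (wp a); last by exists 0%N.
  have [a' e] := ps _ wa.
  have a'0 : cv a' != 0.
    apply/eqP => z; have /(congr1 cv) := e; rewrite !cvM z mulr0 => /eqP.
    by rewrite mulf_eq0 (negbTE s0) (negbTE a0).
  have va : v (cv a) = v (cv p) + v (cv a').
    have /(congr1 (fun x => v (cv x))) := e; rewrite !cvM !(placeM vP) // vs add0r.
    by [].
  have ca := proj1 (val_geE v 0 a'0) (cv_ge0 a').
  have [k hk] := IH a' a'0 ltac:(lia).
  by exists k.+1; rewrite va hk mulrS.
have [f vf] := place_norm vP.
have f0 : f != 0 by apply/eqP => z; move: vf; rewrite z (place0 vP).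
have [a [b [b0 fE]]] := frac_coord f.
have cb0 : cv b != 0 by rewrite cv_eq0.
have ca0 : cv a != 0 by apply: contra_neq f0 => z; rewrite fE z mul0r.
have [k hk] := mult _ a ca0 (leqnn _); have [l hl] := mult _ b cb0 (leqnn _).
move: vf; rewrite fE (placeM vP) ?invr_neq0 // (placeV vP) // hk hl.
move: (v (cv p)) vp => x x1 h; have : x * (k%:Z - l%:Z) = 1 by lia.
move: (k%:Z - l%:Z) => y {}h.
have y1 : 1 <= y by rewrite leNgt; apply/negP => y0; nia.
by apply/eqP; rewrite eq_le x1 andbT -h ler_peMr //; lia.
Qed.

(** * Approximate idempotents at [wp] and density of [A] *)

Section WithUniformizer.
Variables (p s e : A).
Hypotheses (vp : v (cv p) = 1) (ps : forall a, wp a -> exists a', s * a = p * a').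
Variable s' : A.
Hypotheses (eE : e = s * s') (e1 : wp (1 - e)).

Let p0 : cv p != 0.
Proof. by apply/eqP => z; move: vp; rewrite z (place0 vP). Qed.

Lemma wp_unif : wp p. Proof. by apply/wpE; right; rewrite vp. Qed.

Lemma val_ge_div_unif k a : val_ge v k%:Z (cv a) -> exists a', s ^+ k * a = p ^+ k * a'.
Proof.
elim: k a => [|k IH] a ha; first by exists a; rewrite !expr0.
have wa : wp a by apply/wpE; apply: (val_geW _ ha); lia.
have [a1 ha1] := ps wa.
have : val_ge v k%:Z (cv a1).
  have [->|a10] := eqVneq (cv a1) 0; first by left.
  right; have : val_ge v k.+1%:Z (cv (p * a1)).
    by rewrite -ha1 cvM -[_%:Z]add0r; apply: val_geM => //; exact: cv_ge0.
  rewrite cvM => /(val_geE v _ (mulf_neq0 p0 a10)).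
  by rewrite (placeM vP) // vp; lia.
move=> /IH[a2 ha2]; exists a2.
rewrite exprSr -mulrA ha1 mulrCA ha2 exprS; ring.
Qed.

(** Since [1 - e ^+ k] lies in [wp], its [k]-th power lies in [wp ^ k], so the element is close to
    [1] at [wp]. On the other hand it is a multiple of [e ^+ k], hence of [s ^+ k], and [s ^+ k]
    carries elements of valuation at least [k] into [p ^+ k * A]. *)
Definition approx_idem k : A := 1 - (1 - e ^+ k) ^+ k.

Let wpX a k : wp a -> val_ge v k%:Z (cv (a ^+ k)).
Proof. by move/wpE => h; rewrite cvX; exact: val_geX. Qed.

Lemma e_pow_wp k : wp (1 - e ^+ k).
Proof.
have -> : 1 - e ^+ k = (\sum_(i < k) e ^+ i) * (1 - e).
  by have := subrX1 e k => h; rewrite -opprB h -[in RHS]opprB mulrN mulrC.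
exact: wpMl.
Qed.

Lemma approx_idem_val k : val_ge v k%:Z (cv (1 - approx_idem k)).
Proof. by rewrite /approx_idem opprB addrC subrK; apply: wpX; exact: e_pow_wp. Qed.

Lemma approx_idem_div k m a : (m <= k)%N -> val_ge v m%:Z (cv a) ->
  exists a', approx_idem k * a = p ^+ m * a'.
Proof.
move=> mk /val_ge_div_unif[a' ha'].
have -> : approx_idem k = (\sum_(i < k) (1 - e ^+ k) ^+ i) * e ^+ k.
  have := subrX1 (1 - e ^+ k) k => h; rewrite /approx_idem -opprB h.
  by rewrite addrAC subrr add0r mulNr opprK mulrC.
set S := \sum_(i < k) _.
exists (S * s' ^+ k * s ^+ (k - m) * a').
have -> : e ^+ k = s' ^+ k * s ^+ (k - m) * s ^+ m.
  by rewrite -mulrA -exprD subnK // -exprMn mulrC eE.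
by rewrite -!mulrA ha'; ring.
Qed.

Lemma unif_pow_val k : v (cv (p ^+ k)) = k.
Proof. by rewrite cvX (placeX _ vP) // vp; lia. Qed.

Let expX a k : wp a -> ideal_exp wp k (a ^+ k).
Proof.
move=> wa; elim: k => [|k IH] //=; exists 1%N, (fun=> a), (fun=> a ^+ k).
by rewrite big_ord1 exprS.
Qed.

Let exp_val k a : ideal_exp wp k a -> val_ge v k%:Z (cv a).
Proof.
elim: k a => [|k IH] a; first by move=> _; exact: cv_ge0.
move=> [m [f [g [wf wg ->]]]].
have -> : cv (\sum_i f i * g i) = \sum_i cv (f i) * cv (g i).
  exact: (big_morph cv cvD cv0).
apply: (val_ge_sum vP) => i _; rewrite intS; apply: (val_geM vP); first exact/wpE.
exact: (IH _ (wg i)).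
Qed.

(** Split [a] by [approx_idem n]: the first part is a multiple of [p ^+ n], the second has the
    factor [1 - approx_idem n], and both factors lie in [wp ^ n], which [t] generates. *)
Lemma principal_val a : principal_ideal t a <-> val_ge v n%:Z (cv a).
Proof.
split=> [|ha]; first by rewrite t_gen; exact: exp_val.
have [a' ha'] := approx_idem_div (leqnn n) ha.
have [x hx] : principal_ideal t (p ^+ n) by rewrite t_gen; exact: expX wp_unif.
have [y hy] : principal_ideal t (1 - approx_idem n).
  by rewrite t_gen /approx_idem opprB addrC subrK; apply: expX; exact: e_pow_wp.
exists (x * a' + y * a).
transitivity (approx_idem n * a + (1 - approx_idem n) * a); first by ring.
by rewrite ha' hx hy; ring.
Qed.

(** Write [f] as a fraction and cancel powers of [p] until the denominator [b1] lies outside [wp].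
    With an inverse [b2] of [b1] modulo [wp], a truncated geometric series in [1 - b1 * b2]
    approximates the inverse of [b1]. *)
Lemma coord_dense (f : F) (k : nat) : val_ge v 0 f -> exists a, val_ge v k%:Z (f - cv a).
Proof.
move=> hf; have [->|f0] := eqVneq f 0; first by exists 0; left; rewrite cv0 subr0.
have [a [b [b0 fE]]] := frac_coord f.
have cb0 : cv b != 0 by rewrite cv_eq0.
have ca0 : cv a != 0 by apply: contra_neq f0 => z; rewrite fE z mul0r.
pose m := absz (v (cv b)).
have mE : v (cv b) = m%:Z by have := proj1 (val_geE v 0 cb0) (cv_ge0 b); lia.
have ma : val_ge v m%:Z (cv a).
  right; move/(val_geE v 0 f0): hf; rewrite fE (placeM vP) ?invr_neq0 // (placeV vP) //.
  lia.
have mb : val_ge v m%:Z (cv b) by right; rewrite mE.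
have [a1 ha1] := val_ge_div_unif ma; have [b1 hb1] := val_ge_div_unif mb.
have [sp0 vs0] : cv s != 0 /\ v (cv s) = 0.
  apply: wp_compl => ws; apply: wp1; have -> : 1 = (1 - e) + s' * s :> A by rewrite eE; ring.
  by apply: wpD => //; exact: wpMl.
have cb1 : cv b1 != 0.
  apply/eqP => z; have /(congr1 cv) := hb1; rewrite !cvM z mulr0 cvX => /eqP.
  by rewrite mulf_eq0 expf_eq0 (negbTE sp0) andbF (negbTE cb0).
have nb1 : ~ wp b1.
  move/wpE/(val_geE v _ cb1); have /(congr1 (fun x => v (cv x))) := hb1.
  rewrite !cvM !(placeM vP) ?cvX ?expf_neq0 // !(placeX _ vP) // vs0 vp mE; lia.
have fE1 : f * cv b1 = cv a1.
  apply: (mulfI (_ : cv p ^+ m != 0)); first by rewrite expf_neq0.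
  rewrite mulrCA -cvX -!cvM -hb1 -ha1 !cvM fE mulrCA; congr (_ * _).
  by rewrite divfK.
have [b2 hb2] := wp_inv_mod nb1.
pose y := 1 - b1 * b2; exists (a1 * b2 * \sum_(i < k) y ^+ i).
have -> : f - cv (a1 * b2 * \sum_(i < k) y ^+ i) = f * cv (y ^+ k).
  have h : 1 - y ^+ k = b1 * b2 * \sum_(i < k) y ^+ i.
    by have := subrX1 y k => h; rewrite -opprB h /y addrAC subrr add0r mulNr opprK.
  have -> : cv (a1 * b2 * \sum_(i < k) y ^+ i) = f * cv (b1 * b2 * \sum_(i < k) y ^+ i).
    by rewrite !cvM -fE1; ring.
  by rewrite -h cvB cv1; ring.
by rewrite -[k%:Z]add0r; apply: (val_geM vP) => //; exact: wpX.
Qed.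

(** * The residue field at [wp] and its degree *)

Section ResidueBasis.
Local Notation kA := (coord_const iF infty).

Definition lcomb d (b : 'I_d -> A) (c : {ffun 'I_d -> Fq}) : A := \sum_i kA (c i) * b i.

Lemma lcombB d (b : 'I_d -> A) c c' :
  lcomb b c - lcomb b c' = lcomb b [ffun i => c i - c' i].
Proof.
by rewrite /lcomb -sumrB; apply: eq_bigr => i _; rewrite ffunE rmorphB mulrBl.
Qed.

Hypothesis D_gt0 : (0 < degA iF t)%N.

Let DP : has_quotient_dim kA setT (principal_ideal t) (degA iF t).
Proof. exact: quotient_dimP. Qed.

Let tB x y : principal_ideal t x -> principal_ideal t y -> principal_ideal t (x - y).
Proof. by move=> [x' ->] [y' ->]; exists (x' - y'); ring. Qed.

Let wpB x y : wp x -> wp y -> wp (x - y).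
Proof. by move=> hx hy; rewrite -mulN1r; apply: wpD => //; exact: wpMl. Qed.

(** A maximal family that is independent modulo [wp] is a basis. Maximal families exist because
    distinct combinations stay distinct modulo the smaller ideal generated by [t], whose quotient is
    finite. *)
Lemma residue_basis : exists d, has_quotient_dim kA setT wp d.
Proof.
have [B _ hB] := DP; set D := degA iF t in B hB.
pose indep m := `[< exists b : 'I_m -> A, forall c, wp (lcomb b c) -> c = [ffun=> 0] >].
have i0 : exists m, indep m.
  by exists 0%N; apply/asboolP; exists (fun=> 0) => c _; apply/ffunP => -[].
have iD m : indep m -> (m <= D)%N.
  move=> /asboolP[b hb].
  have [g hg] := choice (fun c => let: ex_intro y (conj hy _) := hB (lcomb b c) I in ex_intro _ y hy).
  have : injective g.
    move=> c c' gc; have := tB (hg c) (hg c'); rewrite gc opprB addrA subrK lcombB.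
    move=> /principal_val /(val_geW (_ : 1 <= n%:Z)) h; have {h} := h ltac:(lia).
    move=> /wpE/hb/ffunP h; apply/ffunP => i; have := h i; rewrite !ffunE => /eqP.
    by rewrite subr_eq0 => /eqP.
  by move/leq_card; rewrite !card_ffun !card_ord leq_exp2l ?finNzRing_gt1.
have [d /asboolP[b hb] dmax] := ex_maxnP i0 iD.
exists d, b => // a _.
suff [c hc] : exists c, wp (a - lcomb b c).
  exists c; split=> // c' hc'; have := wpB hc' hc.
  rewrite opprB addrC addrA subrK lcombB => /hb/ffunP h; apply/ffunP => i.
  by have := h i; rewrite !ffunE => /eqP; rewrite subr_eq0 => /eqP.
apply: contrapT => /forallNP na.
suff : indep d.+1 by move/dmax; rewrite ltnn.
apply/asboolP; exists (fun i => oapp b a (unlift ord0 i)) => c.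
rewrite /lcomb big_ord_recl unlift_none /=.
under eq_bigr => i _ do rewrite liftK /=.
pose c1 : {ffun 'I_d -> Fq} := [ffun i => c (lift ord0 i)].
have -> : \sum_(i < d) kA (c (lift ord0 i)) * b i = lcomb b c1.
  by apply: eq_bigr => i _; rewrite ffunE.
have [c00|c00] := eqVneq (c ord0) 0.
  rewrite c00 rmorph0 mul0r add0r => /hb/ffunP h; apply/ffunP => i; rewrite [RHS]ffunE.
  by case: (unliftP ord0 i) => [j ->|-> //]; have := h j; rewrite !ffunE.
move=> /(wpMl (kA (c ord0)^-1)); rewrite mulrDr mulrA -rmorphM mulVf // rmorph1 mul1r.
move=> h; exfalso; apply: (na [ffun i => - ((c ord0)^-1 * c1 i)]).
suff -> : lcomb b [ffun i => - ((c ord0)^-1 * c1 i)] = - (kA (c ord0)^-1 * lcomb b c1) by rewrite opprK.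
rewrite /lcomb mulr_sumr -sumrN; apply: eq_bigr => i _.
by rewrite ffunE rmorphN rmorphM mulNr mulrA.
Qed.

Variables (d : nat) (b : 'I_d -> A).
Hypothesis hb : forall a, exists! c, wp (a - lcomb b c).

Lemma lcomb_wp_eq0 c : wp (lcomb b c) -> c = [ffun=> 0].
Proof.
move=> h; have [c0 [_ u]] := hb 0.
have l0 : lcomb b [ffun=> 0] = 0.
  by rewrite /lcomb big1 // => i _; rewrite ffunE rmorph0 mul0r.
rewrite -(u c) ?sub0r; last by rewrite -mulN1r; exact: wpMl.
by apply: u; rewrite l0 subr0.
Qed.

Let digit_sum k (c : 'I_k * 'I_d -> Fq) : A :=
  \sum_(j < k) p ^+ j * lcomb b [ffun i => c (j, i)].

Let digit_exists k a : exists c : nat -> {ffun 'I_d -> Fq},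
  val_ge v k%:Z (cv (a - \sum_(j < k) p ^+ j * lcomb b (c j))).
Proof.
elim: k => [|k [c hc]].
  by exists (fun=> [ffun=> 0]); rewrite big_ord0 subr0; exact: cv_ge0.
set r := a - _ in hc.
(* The remainder [r] itself need not be divisible by [p ^+ k] in [A]. Replacing it by
   [approx_idem k.+1 * r] costs an error of valuation at least [k.+1]. *)
have [r' hr'] := approx_idem_div (leqnSn k) hc.
have [ck [hck _]] := hb r'.
pose c' j := if (j < k)%N then c j else ck.
exists c'.
have -> : \sum_(j < k.+1) p ^+ j * lcomb b (c' j) =
    \sum_(j < k) p ^+ j * lcomb b (c j) + p ^+ k * lcomb b ck.
  rewrite big_ord_recr /= /c' ltnn; congr (_ + _).
  by apply: eq_bigr => j _; rewrite ltn_ord.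
have -> : a - (\sum_(j < k) p ^+ j * lcomb b (c j) + p ^+ k * lcomb b ck) =
    (1 - approx_idem k.+1) * r + p ^+ k * (r' - lcomb b ck).
  have -> : p ^+ k * (r' - lcomb b ck) = approx_idem k.+1 * r - p ^+ k * lcomb b ck by rewrite hr' mulrBr.
  by rewrite /r; ring.
rewrite cvD; apply: (placeD vP).
  rewrite cvM -[_%:Z]addr0; apply: (val_geM vP); first exact: approx_idem_val.
  by apply: val_geW hc; lia.
rewrite cvM (_ : k.+1%:Z = k%:Z + 1); last by lia.
apply: (val_geM vP); first by right; rewrite unif_pow_val.
exact/wpE.
Qed.

Let digit_uniq k (c : nat -> {ffun 'I_d -> Fq}) :
  val_ge v k%:Z (cv (\sum_(j < k) p ^+ j * lcomb b (c j))) ->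
  forall j, (j < k)%N -> c j = [ffun=> 0].
Proof.
move=> h j; elim/ltn_ind: j => j IH jk.
apply: lcomb_wp_eq0.
have h1 : val_ge v j.+1%:Z (cv (p ^+ j * lcomb b (c j))).
  set X := p ^+ j * _.
  pose Y := \sum_(i < k | (i != Ordinal jk) && ~~ (i < j)%N) p ^+ i * lcomb b (c i).
  have XY : \sum_(i < k) p ^+ i * lcomb b (c i) = X + Y.
    rewrite (bigD1 (Ordinal jk)) //= (bigID (fun i : 'I_k => (i < j)%N)) /=.
    rewrite [X in _ + (X + _)]big1 ?add0r // => i /andP[_ ij].
    rewrite IH // /lcomb big1 ?mulr0 // => l _.
    by rewrite ffunE rmorph0 mul0r.
  rewrite XY in h.
  have -> : X = (X + Y) - Y by ring.
  rewrite cvB; apply: (val_geB vP); first by apply: val_geW h; lia.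
  rewrite /Y (big_morph cv cvD cv0); apply: (val_ge_sum vP) => i /andP[ij]; rewrite -leqNgt => ji.
  rewrite cvM -[_%:Z]addr0; apply: (val_geM vP); last exact: cv_ge0.
  right; rewrite unif_pow_val.
  have : (i : nat) != j by apply: contra ij => /eqP e'; apply/eqP/val_inj.
  lia.
apply/wpE; have [->|l0] := eqVneq (cv (lcomb b (c j))) 0; first by left.
right; move: h1; rewrite cvM.
have pj0 : cv (p ^+ j) != 0 by rewrite cvX expf_neq0.
by move/(val_geE v _ (mulf_neq0 pj0 l0)); rewrite (placeM vP) // unif_pow_val; lia.
Qed.

(** The expansions to the base [p] with [n] digits in the residue basis form a transversal modulo
    [t] with [q ^ (n * d)] elements. *)
Lemma degA_factor : degA iF t = (n * d)%N.
Proof.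
have [B _ hB] := DP; set D := degA iF t in B hB *.
pose F2 (c : {ffun 'I_n * 'I_d -> Fq}) := digit_sum c.
have h2 a : setT a -> exists! c, principal_ideal t (a - F2 c).
  move=> _; have [c hc] := digit_exists n a.
  have cE : F2 [ffun ji : 'I_n * 'I_d => c ji.1 ji.2] = \sum_(j < n) p ^+ j * lcomb b (c j).
    by apply: eq_bigr => j _; congr (_ * lcomb b _); apply/ffunP => i; rewrite !ffunE.
  exists [ffun ji : 'I_n * 'I_d => c ji.1 ji.2]; split; first by apply/principal_val; rewrite cE.
  move=> c' hc'; apply/ffunP => -[j i]; rewrite ffunE /=.
  pose c2 (j : nat) : {ffun 'I_d -> Fq} :=
    if insub j is Some j' then [ffun i => c j i - c' (j', i)] else [ffun=> 0].
  have := @digit_uniq n c2; have -> : \sum_(j < n) p ^+ j * lcomb b (c2 j) =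
     (a - F2 c') - (a - \sum_(j < n) p ^+ j * lcomb b (c j)).
    rewrite opprB addrC addrA subrK -sumrB; apply: eq_bigr => l _.
    rewrite -mulrBr lcombB /c2 valK; congr (_ * lcomb b _).
    by apply/ffunP => l'; rewrite !ffunE.
  move=> h; have := h (val_geB vP (proj1 (principal_val _) hc') hc) j (ltn_ord j).
  by rewrite /c2 valK => /ffunP/(_ i); rewrite !ffunE => /eqP; rewrite subr_eq0 => /eqP.
have := @card_transversal _ _ _ (fun c => lcomb B c) F2 setT (principal_ideal t) tB (fun=> I) (fun=> I) hB h2.
rewrite !card_ffun card_prod !card_ord => /eqP; rewrite eqn_exp2l ?finNzRing_gt1 //.
by move/eqP.
Qed.

(** * Frobenius on the residue field inside [R] *)

Section Character.
Variables (R : idomainType) (chi : {rmorphism A -> R}).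
Hypothesis chiE : forall a, chi a = 0 <-> wp a.
Local Notation q := #|Fq|.

Let io (c : {ffun 'I_d -> Fq}) := chi (lcomb b c).

Let io_inj : injective io.
Proof.
move=> c c' /eqP; rewrite -subr_eq0 -rmorphB lcombB => /eqP/chiE/lcomb_wp_eq0/ffunP h.
by apply/ffunP => i; have := h i; rewrite !ffunE => /eqP; rewrite subr_eq0 => /eqP.
Qed.

Let io_surj a : exists c, io c = chi a.
Proof.
have [c [/chiE hc _]] := hb a; exists c; apply/esym/eqP.
by rewrite -subr_eq0 -rmorphB hc.
Qed.

(** Fermat's argument: multiplication by a nonzero [chi a] permutes the nonzero elements of the
    image of [chi], a ring with [q ^ d] elements, so it does not change their product. *)
Lemma residue_char_frob a : chi a ^+ (q ^ d) = chi a.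
Proof.
have [->|x0] := eqVneq (chi a) 0; first exact: (twfrob0 Fq).
have [m hm] := choice (fun c => io_surj (a * lcomb b c)).
have m_inj : injective m.
  move=> c c' e'; apply: io_inj; apply: (mulfI x0).
  by rewrite -!rmorphM -!hm e'.
have io0 : io [ffun=> 0] = 0.
  by rewrite /io /lcomb big1 ?rmorph0 // => i _; rewrite ffunE rmorph0 mul0r.
have io_eq0 c : (io c == 0) = (c == [ffun=> 0]).
  by rewrite -io0 (inj_eq io_inj).
have m0 c : (m c == [ffun=> 0]) = (c == [ffun=> 0]).
  by rewrite -!io_eq0 hm rmorphM mulf_eq0 (negbTE x0).
pose Pr := \prod_(c | c != [ffun=> 0]) io c.
have Pr0 : Pr != 0 by apply/prodf_neq0 => c; rewrite io_eq0.
have key : chi a ^+ (q ^ d).-1 * Pr = 1 * Pr.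
  rewrite mul1r {2}/Pr (reindex_inj m_inj) /=.
  under eq_bigl => c do rewrite m0.
  under eq_bigr => c _ do rewrite hm rmorphM.
  rewrite big_split /= -/Pr prodr_const; congr (_ ^+ _ * _).
  have := cardC1 ([ffun=> 0] : {ffun 'I_d -> Fq}); rewrite card_ffun card_ord => <-.
  by apply: eq_card => c; rewrite !inE.
have /(mulIf Pr0) {}key := key.
by rewrite -[RHS]mul1r -key -exprSr prednK // expn_gt0 (ltnW (finNzRing_gt1 _)).
Qed.

(** Otherwise all [q ^ d] elements of the image of [chi] would be roots of ['X^(q ^ m) - 'X] with
    [m = j - i < d]. *)
Lemma residue_char_distinct i j : (i < j)%N -> (j < d)%N ->
  exists a, chi a ^+ (q ^ i) != chi a ^+ (q ^ j).
Proof.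
move=> ij jd; apply: contrapT => /forallNP h.
pose m := (j - i)%N; have q1 := finNzRing_gt1 Fq.
pose P : {poly R} := 'X^(q ^ m) - 'X.
have m0 : (0 < m)%N by rewrite /m subn_gt0.
have qm : (1 < q ^ m)%N by rewrite -(expn0 q) ltn_exp2l.
have sP : size P = (q ^ m).+1.
  by rewrite size_polyDl size_polyXn // size_polyN size_polyX ltnS.
have := @max_poly_roots R P [seq io c | c <- enum {: {ffun 'I_d -> Fq}}].
rewrite -size_poly_eq0 sP => /(_ isT).
have -> : all (root P) [seq io c | c <- enum {: {ffun 'I_d -> Fq}}].
  apply/allP => _ /mapP[c _ ->]; rewrite rootE !hornerE.
  have /negP := h (lcomb b c); rewrite negbK => /eqP e'.
  have : (io c ^+ (q ^ m) - io c) ^+ (q ^ i) = 0.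
    have fD := twfrobD (chi \o kA) i (io c ^+ (q ^ m) - io c) (io c).
    rewrite subrK -exprM -expnD subnK ?(ltnW ij) // -e' -[LHS]add0r in fD.
    by move/addIr: fD.
  by move/eqP; rewrite expf_eq0 => /andP[].
rewrite map_inj_uniq // enum_uniq => /(_ isT isT).
rewrite size_map -cardE card_ffun card_ord ltnS leqNgt ltn_exp2l // /m.
by rewrite (leq_ltn_trans _ jd) // leq_subr.
Qed.

End Character.

End ResidueBasis.

End WithUniformizer.
End Uniformizer.

(** * Division of twisted polynomials *)

Section Twisted.
Variables (Fq : finFieldType) (R : idomainType) (iR : {rmorphism Fq -> R}).
Local Notation T := (twpoly iR).
Local Notation q := #|Fq|.
Local Notation cst := (twconst iR).
Local Notation tau := (twtau iR).
Implicit Types (f g h : T).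

Definition tcoef f k : R := (f : {poly R})`_k.

Lemma tcoefM f g k :
  tcoef (f * g) k = \sum_(i < k.+1) tcoef f i * tcoef g (k - i) ^+ (q ^ i).
Proof. exact: coef_twmul. Qed.

Lemma tcoefD f g k : tcoef (f + g) k = tcoef f k + tcoef g k.
Proof. exact: coefD. Qed.

Lemma tcoefN f k : tcoef (- f) k = - tcoef f k.
Proof. exact: coefN. Qed.

Lemma tcoef_sum (I : Type) (r : seq I) (P : pred I) (G : I -> T) k :
  tcoef (\sum_(i <- r | P i) G i) k = \sum_(i <- r | P i) tcoef (G i) k.
Proof.
by apply: (big_morph (fun f => tcoef f k)) => [f g|]; [exact: tcoefD|exact: coef0].
Qed.

Lemma twpolyP f g : (forall k, tcoef f k = tcoef g k) -> f = g.
Proof. by move=> h; apply/polyP. Qed.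

Lemma tcoef_cstM a f k : tcoef (cst a * f) k = a * tcoef f k.
Proof.
rewrite tcoefM big_ord_recl subn0 /= /tcoef coefC /= expn0 expr1 big1 ?addr0 //.
by move=> i _; rewrite coefC mul0r.
Qed.

Lemma cst0 : cst 0 = 0. Proof. exact: polyC0. Qed.

Lemma tcoef_tauX n k : tcoef (tau ^+ n) k = (k == n)%:R.
Proof.
elim: n k => [|n IH] k; first by rewrite expr0 /tcoef coefC; case: k.
rewrite exprS tcoefM; case: k => [|k].
  by rewrite big_ord1 /tcoef coefX mul0r.
rewrite big_ord_recl /tcoef coefX mul0r add0r big_ord_recl coefX mul1r big1 ?addr0.
  rewrite lift0 subSS subn0 -[_`__]/(tcoef _ _) IH eqSS.
  by case: eqP => _; rewrite ?expr1n ?twfrob0.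
by move=> i _; rewrite coefX mul0r.
Qed.

Lemma tcoef_tauXM n f k :
  tcoef (tau ^+ n * f) k = if (n <= k)%N then tcoef f (k - n) ^+ (q ^ n) else 0.
Proof.
rewrite tcoefM; case: leqP => nk; last first.
  rewrite big1 // => i _; rewrite tcoef_tauX; case: eqP => [e|]; last by rewrite mul0r.
  by have := ltn_ord i; rewrite e ltnS leqNgt nk.
rewrite (bigD1 (Ordinal (nk : (n < k.+1)%N))) //= tcoef_tauX eqxx mul1r big1 ?addr0 //.
move=> i; rewrite tcoef_tauX => /eqP ni; case: eqP => [e|]; last by rewrite mul0r.
by case: ni; apply: val_inj.
Qed.

Lemma twpoly_expand f n : (size (f : {poly R}) <= n)%N ->
  f = \sum_(i < n) cst (tcoef f i) * tau ^+ i.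
Proof.
move=> sf; apply: twpolyP => k; rewrite tcoef_sum.
under eq_bigr => i _ do rewrite tcoef_cstM tcoef_tauX.
have [kn|nk] := ltnP k n.
  rewrite (bigD1 (Ordinal kn)) //= eqxx mulr1 big1 ?addr0 // => i /eqP ni.
  by case: eqP => [e|]; [case: ni; apply: val_inj|rewrite mulr0].
rewrite [LHS]nth_default ?(leq_trans sf) // big1 // => i _.
by case: eqP => [e|]; [have := ltn_ord i; rewrite -e ltnNge nk|rewrite mulr0].
Qed.

Definition low_ge n f : Prop := forall k, (k < n)%N -> tcoef f k = 0.

Lemma low_geM a b f g : low_ge a f -> low_ge b g ->
  low_ge (a + b) (f * g) /\ tcoef (f * g) (a + b) = tcoef f a * tcoef g b ^+ (q ^ a).
Proof.
move=> fa gb; split=> [k kab|].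
  rewrite tcoefM big1 // => i _; have [ia|ai] := ltnP i a; first by rewrite fa ?mul0r.
  by rewrite gb ?twfrob0 ?mulr0 //; have := ltn_ord i; lia.
have h : (a < (a + b).+1)%N by lia.
rewrite tcoefM (bigD1 (Ordinal h)) //= addKn big1 ?addr0 // => i ni.
have [ia|ai] := ltnP i a; first by rewrite fa ?mul0r.
rewrite gb ?twfrob0 ?mulr0 //; have := ltn_ord i.
have : (i : nat) != a by apply: contra ni => /eqP e; apply/eqP/val_inj.
lia.
Qed.

Lemma low_ge0 f : low_ge 0 f. Proof. by []. Qed.

Lemma low_geD n f g : low_ge n f -> low_ge n g -> low_ge n (f + g).
Proof. by move=> hf hg k kn; rewrite tcoefD hf // hg // addr0. Qed.

Lemma low_ge_add_l a f g : low_ge a g -> low_ge a (f * g).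
Proof. by move=> h; have [] := low_geM (@low_ge0 f) h. Qed.

Lemma low_geX a f n : low_ge a f ->
  low_ge (n * a) (f ^+ n) /\
  tcoef (f ^+ n) (n * a) = \prod_(i < n) tcoef f a ^+ (q ^ (i * a)).
Proof.
move=> fa; elim: n => [|n [IH1 IH2]].
  by rewrite expr0 mul0n big_ord0; split=> //; rewrite /tcoef coefC.
by rewrite exprSr mulSnr big_ord_recr /= -IH2; exact: low_geM.
Qed.

Lemma size_twmul_le a b f g : (size (f : {poly R}) <= a.+1)%N -> (size (g : {poly R}) <= b.+1)%N ->
  (size ((f * g)%R : {poly R}) <= (a + b).+1)%N /\
  tcoef (f * g) (a + b) = tcoef f a * tcoef g b ^+ (q ^ a).
Proof.
move=> fa gb; split.
  apply/leq_sizeP => k kab; rewrite -[LHS]/(tcoef (f * g) k) tcoefM big1 // => i _.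
  have [ia|ai] := leqP i a; last by rewrite [tcoef f i]nth_default ?mul0r // (leq_trans fa).
  by rewrite [tcoef g _]nth_default ?twfrob0 ?mulr0 // (leq_trans gb) //; lia.
have h : (a < (a + b).+1)%N by lia.
rewrite tcoefM (bigD1 (Ordinal h)) //= addKn big1 ?addr0 // => i ni.
have [ai|ia] := ltnP a i; first by rewrite [tcoef f i]nth_default ?mul0r // (leq_trans fa).
rewrite [tcoef g _]nth_default ?twfrob0 ?mulr0 // (leq_trans gb) //.
have : (i : nat) != a by apply: contra ni => /eqP e; apply/eqP/val_inj.
lia.
Qed.

Section Division.
Variables (g : T) (m : nat).
Hypotheses (g_size : size (g : {poly R}) = m.+1)
  (g_lead : lead_coef (g : {poly R}) \is a GRing.unit).

Let g_m : tcoef g m \is a GRing.unit.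
Proof. by move: g_lead; rewrite lead_coefE g_size. Qed.

Lemma size_mul_divisor f : f != 0 ->
  size ((f * g)%R : {poly R}) = (size (f : {poly R}) + m)%N.
Proof.
move=> f0; have : (0 < size (f : {poly R}))%N by rewrite size_poly_gt0.
case E: (size (f : {poly R})) => [//|k] _; rewrite addSn.
have [h1 h2] := @size_twmul_le k m f g ltac:(by rewrite E) ltac:(by rewrite g_size).
apply/eqP; rewrite eqn_leq h1 ltnNge; apply/negP => /leq_sizeP/(_ _ (leqnn _)).
rewrite -[LHS]/(tcoef (f * g) _) h2 => /eqP; rewrite mulf_eq0 expf_eq0 card_exp_gt0 /=.
have -> : (tcoef g m == 0) = false by apply/negP => /eqP e; move: g_m; rewrite e unitr0.
by rewrite orbF /tcoef -[k]/(k.+1.-1) -E -lead_coefE lead_coef_eq0 (negbTE f0).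
Qed.

Lemma division_uniq (x r : T) : (size (r : {poly R}) <= m)%N -> x * g + r = 0 -> x = 0 /\ r = 0.
Proof.
move=> sr e; have x0 : x = 0.
  apply/eqP; apply/negP => /negP x0; have := size_mul_divisor x0.
  have -> : x * g = - r by apply/eqP; rewrite -addr_eq0 e.
  rewrite size_polyN => h; move: sr; rewrite h.
  by rewrite -size_poly_gt0 in x0; rewrite leqNgt -{1}[m]add0n ltn_add2r x0.
by split=> //; move: e; rewrite x0 mul0r add0r.
Qed.

Lemma division_exists f : exists xr : T * T,
  (size (xr.2 : {poly R}) <= m)%N /\ f = xr.1 * g + xr.2.
Proof.
have [n sn] := ubnP (size (f : {poly R})); elim: n f sn => // n IH f; rewrite ltnS => sf.
have [fm|mf] := leqP (size (f : {poly R})) m; first by exists (0, f); rewrite mul0r add0r.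
case: n IH sf => [|n] IH sf; first by move: (leq_trans mf sf).
have mn : (m <= n)%N by rewrite -ltnS (leq_trans mf).
(* Moving [g] past [tau ^+ (n - m)] raises its leading coefficient to the power [q ^ (n - m)], so
   this power is what has to be divided out. *)
pose y := cst (tcoef f n / tcoef g m ^+ (q ^ (n - m))) * tau ^+ (n - m).
have sy : (size (y : {poly R}) <= (n - m).+1)%N.
  apply/leq_sizeP => k kn; rewrite -[LHS]/(tcoef y k) tcoef_cstM tcoef_tauX.
  by rewrite (gtn_eqF kn) mulr0.
have [h1 h2] := @size_twmul_le (n - m) m y g sy ltac:(by rewrite g_size).
rewrite subnK // in h1 h2.
have [|[x r] [sr /= e]] := IH (f - y * g).
  rewrite ltnS; apply/leq_sizeP => k; rewrite leq_eqVlt => /predU1P[<-|nk].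
    rewrite -[LHS]/(tcoef (f - y * g) n) tcoefD tcoefN h2 /y tcoef_cstM tcoef_tauX eqxx mulr1.
    by rewrite divrK ?subrr // unitrX.
  rewrite -[LHS]/(tcoef (f - y * g) k) tcoefD tcoefN.
  by rewrite ![tcoef _ _]nth_default ?subrr // (leq_trans _ nk).
by exists (x + y, r); split=> //=; rewrite mulrDl addrAC -e subrK.
Qed.

Definition tquo f := (projT1 (cid (division_exists f))).1.
Definition trem f := (projT1 (cid (division_exists f))).2.

Lemma trem_size f : (size (trem f : {poly R}) <= m)%N.
Proof. by rewrite /trem; case: cid => -[x r] []. Qed.

Lemma division_eq f : f = tquo f * g + trem f.
Proof. by rewrite /trem /tquo; case: cid => -[x r] []. Qed.

Lemma division_eqP f x r : (size (r : {poly R}) <= m)%N -> f = x * g + r ->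
  tquo f = x /\ trem f = r.
Proof.
move=> sr e; have sz : (size ((trem f - r)%R : {poly R}) <= m)%N.
  apply: leq_trans (size_polyD _ _) _; rewrite size_polyN geq_max sr andbT.
  exact: trem_size.
have [|/subr0_eq-> /subr0_eq->] // := division_uniq (x := tquo f - x) sz.
by rewrite mulrBl addrACA -opprD -division_eq -e subrr.
Qed.

Lemma tquo_remD f f' : tquo (f + f') = tquo f + tquo f' /\ trem (f + f') = trem f + trem f'.
Proof.
apply: division_eqP.
  by apply: leq_trans (size_polyD _ _) _; rewrite geq_max !trem_size.
by rewrite {1}(division_eq f) {1}(division_eq f') mulrDl addrACA.
Qed.

Lemma tquo_remZ a f : tquo (cst a * f) = cst a * tquo f /\ trem (cst a * f) = cst a * trem f.
Proof.
apply: division_eqP; last by rewrite {1}(division_eq f) mulrDr mulrA.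
apply/leq_sizeP => k mk; rewrite -[LHS]/(tcoef (cst a * trem f) k) tcoef_cstM.
by rewrite [tcoef _ _]nth_default ?mulr0 // (leq_trans (trem_size f)).
Qed.

Lemma tquo_remM f : tquo (f * g) = f /\ trem (f * g) = 0.
Proof. by apply: division_eqP; rewrite ?size_poly0 ?addr0. Qed.

Lemma divisor_mulIr x y : x * g = y * g -> x = y.
Proof. by move=> e; have [<- _] := tquo_remM x; have [<- _] := tquo_remM y; rewrite e. Qed.

Lemma size_tquo f : (0 < m)%N -> (size (tquo f : {poly R}) <= (size (f : {poly R})).-1)%N.
Proof.
move=> m0; have [->|x0] := eqVneq (tquo f) 0; first by rewrite size_poly0.
suff h : (size ((tquo f * g)%R : {poly R}) <= maxn (size (f : {poly R})) m)%N.
  by move: h; rewrite size_mul_divisor //; rewrite -size_poly_gt0 in x0; lia.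
have -> : tquo f * g = f - trem f by rewrite {2}(division_eq f) addrK.
apply: leq_trans (size_polyD _ _) _; rewrite size_polyN geq_max leq_maxl /=.
exact: leq_trans (trem_size f) (leq_maxr _ _).
Qed.

(** The coefficient of [tau ^+ i * g ^+ n] in the expansion of [f] to the base [g], see
    [digit_expand]. It is linear over [R] on the left because [g] divides on the right. *)
Definition digit (n : nat) (i : 'I_m) (f : T) : R := tcoef (trem (iter n tquo f)) i.

Lemma digitD n i f f' : digit n i (f + f') = digit n i f + digit n i f'.
Proof.
rewrite /digit; elim: n f f' => [|n IH] f f'; last by rewrite !iterSr (proj1 (tquo_remD _ _)) IH.
by rewrite /= (proj2 (tquo_remD _ _)) tcoefD.
Qed.

Lemma digitZ n i a f : digit n i (cst a * f) = a * digit n i f.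
Proof.
rewrite /digit; elim: n f => [|n IH] f; last by rewrite !iterSr (proj1 (tquo_remZ _ _)) IH.
by rewrite /= (proj2 (tquo_remZ _ _)) tcoef_cstM.
Qed.

Lemma digit0 n i : digit n i 0 = 0.
Proof. by rewrite -(mulr0 (cst 0)) digitZ mul0r. Qed.

Lemma digit_sum n i (I : Type) (r : seq I) (P : pred I) (G : I -> T) :
  digit n i (\sum_(j <- r | P j) G j) = \sum_(j <- r | P j) digit n i (G j).
Proof. exact: (big_morph _ (digitD n i) (digit0 n i)). Qed.

Lemma digitS n i f : digit n.+1 i (f * g) = digit n i f.
Proof. by rewrite /digit iterSr (proj1 (tquo_remM f)). Qed.

Lemma digit_mul0 i f : digit 0 i (f * g) = 0.
Proof. by rewrite /digit /= (proj2 (tquo_remM f)) /tcoef coef0. Qed.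

Lemma digit_mulX n k i f : (n < k)%N -> digit n i (f * g ^+ k) = 0.
Proof.
elim: k n f => // k IH n f nk; rewrite exprSr mulrA; case: n nk => [|n] nk.
  exact: digit_mul0.
by rewrite digitS IH.
Qed.

Lemma digit_expand k f : f =
  \sum_(n < k) \sum_(i < m) cst (digit n i f) * tau ^+ i * g ^+ n + iter k tquo f * g ^+ k.
Proof.
elim: k => [|k IH]; first by rewrite big_ord0 add0r mulr1.
rewrite big_ord_recr /= {1}IH -addrA; congr (_ + _).
rewrite {1}(division_eq (iter k tquo f)) mulrDl -mulrA -exprS addrC.
congr (_ * _ + _); rewrite -mulr_suml; congr (_ * _).
by rewrite {1}(twpoly_expand (trem_size (iter k tquo f))).
Qed.

Lemma iter_tquo_eq0 f k : (0 < m)%N -> (size (f : {poly R}) <= k)%N -> iter k tquo f = 0.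
Proof.
move=> m0; elim: k f => [|k IH] f; first by rewrite leqn0 size_poly_eq0 => /eqP.
move=> sf; rewrite iterSr IH //; have := size_tquo f m0; lia.
Qed.

Lemma digit_tau i j : (j < m)%N -> digit 0 i (tau ^+ j) = (i == j :> nat)%:R.
Proof.
move=> jm; have sz : (size ((tau ^+ j)%R : {poly R}) <= m)%N.
  apply/leq_sizeP => k mk; rewrite -[LHS]/(tcoef (tau ^+ j) k) tcoef_tauX.
  by rewrite gtn_eqF // (leq_trans jm).
have [|_ e] := @division_eqP (tau ^+ j) 0 (tau ^+ j) sz; first by rewrite mul0r add0r.
by rewrite /digit /= e tcoef_tauX.
Qed.

Lemma digit_eq0_dvd k f : (forall n i, (n < k)%N -> digit n i f = 0) -> f = iter k tquo f * g ^+ k.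
Proof.
move=> h; rewrite {1}(digit_expand k f) big1 ?add0r // => n _.
by rewrite big1 // => i _; rewrite h // cst0 !mul0r.
Qed.

Lemma digit0_expand f : exists x, f = \sum_(i < m) cst (digit 0 i f) * tau ^+ i + x * g.
Proof.
exists (tquo f); have := digit_expand 1 f; rewrite big_ord1 /= expr1.
by under eq_bigr => i _ do rewrite mulr1.
Qed.

End Division.

End Twisted.

Section Fractions.
Variable R : idomainType.
Local Notation K := {fraction R}.
Local Notation fr := (@FracField.tofrac R).

Lemma frac_ratio (x : K) : exists a b, b != 0 /\ x * fr b = fr a.
Proof.
elim/quotW: x => r; exists (frac r).1, (frac r).2; split; first exact: denom_ratioP.
unlock FracField.tofrac; rewrite -[LHS]FracField.pi_mul.
apply/eqmodP; rewrite /= FracField.equivfE /FracField.mulf.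
by rewrite !numden_Ratio ?oner_neq0 ?mulr1 ?mulf_neq0 ?denom_ratioP // mulrC.
Qed.

Lemma frac_row_clear n (v : 'rV[K]_n) : exists b (w : 'rV[R]_n),
  b != 0 /\ fr b *: v = map_mx fr w.
Proof.
have [a h] := choice (fun i => frac_ratio (v 0 i)).
have [b {}h] := choice h.
exists (\prod_i b i), (\row_i ((\prod_(j | j != i) b j) * a i)); split.
  by apply/prodf_neq0 => i _; have [] := h i.
apply/rowP => i; rewrite !mxE (bigD1 i) //= !rmorphM /=.
by have [_ <-] := h i; ring.
Qed.

End Fractions.

(** * Dimension of the [wp]-primary part modulo [phi p] *)

Section RankCount.
Variables (Fq : finFieldType) (R : idomainType) (iR : {rmorphism Fq -> R}).
Local Notation T := (twpoly iR).
Local Notation cst := (twconst iR).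
Local Notation tau := (twtau iR).
Local Notation K := {fraction R}.
Local Notation fr := (@FracField.tofrac R).
Variables (A : comNzRingType) (phi : {rmorphism A -> T}).

Definition row_tw m (v : 'rV[R]_m) : T := \sum_(i < m) cst (v 0 i) * tau ^+ i.

Section MulMatrix.
Variables (c : A) (M : nat).
Hypotheses (cS : size (phi c : {poly R}) = M.+1)
  (cL : lead_coef (phi c : {poly R}) \is a GRing.unit).
Local Notation dg := (digit cS cL 0).

Lemma digit0_row_tw i (v : 'rV[R]_M) : dg i (row_tw v) = v 0 i.
Proof.
rewrite digit_sum (bigD1 i) //= digitZ digit_tau ?ltn_ord // eqxx mulr1 big1 ?addr0 //.
move=> j ji; rewrite digitZ digit_tau ?ltn_ord // (_ : (i == j :> nat) = false) ?mulr0 //.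
by apply/eqP => e; move/eqP: ji; apply; apply: val_inj.
Qed.

(** The matrix, acting on row vectors, of right multiplication by [phi b] from the span of the
    [tau ^+ i] with [i < m] to [R[tau] / R[tau] phi c]. *)
Definition dg_mx m (b : A) : 'M[R]_(m, M) := \matrix_(i, j) dg j (tau ^+ i * phi b).

Lemma dg_mxE m (b : A) (v : 'rV[R]_m) j : (v *m dg_mx m b) 0 j = dg j (row_tw v * phi b).
Proof.
rewrite mxE /row_tw mulr_suml digit_sum; apply: eq_bigr => i _.
by rewrite mxE -mulrA digitZ.
Qed.

Lemma row_dg (f : T) : exists x, f = row_tw (\row_j dg j f) + x * phi c.
Proof.
have [x {1}->] := digit0_expand cS cL f; exists x; congr (_ + _).
by apply: eq_bigr => i _; rewrite mxE.
Qed.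

Lemma dg_mx1 : dg_mx M 1 = 1%:M.
Proof.
apply/matrixP => i j; rewrite !mxE rmorph1 mulr1 digit_tau ?ltn_ord //.
by rewrite eq_sym.
Qed.

End MulMatrix.

Lemma row_dg_mx c M cS cL m b i :
  row i (@dg_mx c M cS cL m b) = \row_j digit cS cL 0 j (tau ^+ i * phi b).
Proof. by apply/rowP => j; rewrite !mxE. Qed.

(* Reduction modulo [phi c] followed by multiplication by [b'] and reduction
   modulo [phi c'] does not depend on the choice of representatives. *)
Lemma dg_mxM c M cS cL c' M' cS' cL' m b b' :
  (exists x, c * b' = x * c') ->
  @dg_mx c M cS cL m b *m @dg_mx c' M' cS' cL' M b' = @dg_mx c' M' cS' cL' m (b * b').
Proof.
move=> [x cb]; apply/row_matrixP => i; rewrite row_mul; apply/rowP => j.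
rewrite dg_mxE row_dg_mx !mxE.
have [y e] := row_dg cS cL (tau ^+ i * phi b).
rewrite rmorphM mulrA {2}e mulrDl digitD -[y * _ * _]mulrA -rmorphM cb rmorphM mulrA.
by rewrite digit_mul0 addr0.
Qed.

Variables (p t eps1 epsn : A) (m M n : nat).
Hypotheses (pS : size (phi p : {poly R}) = m.+1)
  (pL : lead_coef (phi p : {poly R}) \is a GRing.unit)
  (tS : size (phi t : {poly R}) = M.+1)
  (tL : lead_coef (phi t : {poly R}) \is a GRing.unit).
Hypotheses (n_gt0 : (0 < n)%N)
  (h1 : exists x, t * eps1 = x * p) (h2 : exists x y, 1 - eps1 = x * p + y * t)
  (h3 : exists x, p ^+ n = x * t)
  (h4 : exists x, epsn * t = p ^+ n * x) (h5 : exists x, 1 - epsn = x * t).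

(** [Q] is the action of [eps1] modulo [phi p], the projection onto the [wp]-primary part, and [P]
    the action of [p] modulo [phi t]. [be] is multiplication by [eps1] from the quotient by [phi t]
    to the quotient by [phi p], well defined by [h1]; [al] lifts representatives in the opposite
    direction. *)
Local Notation Q := (dg_mx pS pL m eps1).
Local Notation P := (dg_mx tS tL M p).
Local Notation al := (dg_mx tS tL m 1).
Local Notation be := (dg_mx pS pL M eps1).

Lemma dg_mx_pow k : dg_mx tS tL M (p ^+ k) = P ^+ k.
Proof.
elim: k => [|k IH]; first by rewrite expr0 dg_mx1 expr0.
rewrite exprSr [in RHS]exprSr -IH.
by rewrite -[RHS]/(_ *m _) dg_mxM //; exists p; rewrite mulrC.
Qed.

Lemma dg_mx_eq0 k b : (exists x, b = x * t) -> dg_mx tS tL k b = 0.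
Proof.
by move=> [x ->]; apply/matrixP => i j; rewrite !mxE rmorphM mulrA digit_mul0.
Qed.

Lemma digit_mul_row c M' cS cL b (f : T) j :
  digit cS cL 0 j (f * phi b) = ((\row_j digit cS cL 0 j f) *m @dg_mx c M' cS cL M' b) 0 j.
Proof.
rewrite dg_mxE; have [x e] := row_dg cS cL f.
rewrite {1}e mulrDl digitD -[x * _ * _]mulrA -rmorphM mulrC rmorphM mulrA.
by rewrite digit_mul0 addr0.
Qed.

(** Reduction modulo [phi p] changes [tau ^+ i * phi eps1] by a multiple of [phi p], and by [h2] the
    element [1 - eps1] is a multiple of [p] modulo [t]. *)
Lemma mulmx_dg_mx_compl : exists Y, be *m al = 1%:M - Y *m P.
Proof.
have [x [y e]] := h2.
pose f (i : 'I_M) : T := tau ^+ i * phi x + tquo pS pL (tau ^+ i * phi eps1).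
exists (\matrix_(i, j) digit tS tL 0 j (f i)).
apply/matrixP => i j; rewrite [RHS]mxE [X in _ = _ + X]mxE.
have -> : (\matrix_(i, j) digit tS tL 0 j (f i) *m P) i j = digit tS tL 0 j (f i * phi p).
  by rewrite digit_mul_row !mxE; apply: eq_bigr => l _; rewrite !mxE.
have -> : (be *m al) i j = (row i be *m al) 0 j by rewrite -row_mul [RHS]mxE.
rewrite dg_mxE row_dg_mx rmorph1 mulr1; apply/eqP; rewrite eq_sym subr_eq; apply/eqP.
rewrite -digitD; transitivity (digit tS tL 0 j (tau ^+ i)).
  by rewrite digit_tau ?ltn_ord // mxE eq_sym.
set w := row_tw _.
have ew : w + tquo pS pL (tau ^+ i * phi eps1) * phi p = tau ^+ i * phi eps1.
  have := digit_expand pS pL 1 (tau ^+ i * phi eps1); rewrite big_ord1 /= expr1 => {2}->.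
  by congr (_ + _); apply: eq_bigr => l _; rewrite mxE mulr1.
have -> : tau ^+ i = w + f i * phi p + tau ^+ i * phi y * phi t.
  rewrite /f mulrDl addrA addrAC ew -!mulrA -!rmorphM -!mulrDr -!rmorphD.
  by rewrite -addrA -e addrC subrK rmorph1 mulr1.
by rewrite digitD digit_mul0 addr0 digitD.
Qed.

(** [Q] factors as [al *m be]. From [P *m be = 0] and [be *m al = 1 - Y *m P] it follows that [be]
    has the same rank as [Q] and that its kernel is the image of [P]. *)
Lemma rank_wp_part_ker : \rank (map_mx fr Q) = \rank (kermx (map_mx fr P)).
Proof.
have Qab : Q = al *m be by rewrite dg_mxM // mul1r.
have Pbe : P *m be = 0.
  rewrite dg_mxM //; apply/matrixP => i j; rewrite !mxE mulrC rmorphM mulrA.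
  exact: digit_mul0.
have [Y ba] := mulmx_dg_mx_compl.
have bab : be *m al *m be = be.
  by rewrite ba mulmxBl mul1mx -mulmxA Pbe mulmx0 subr0.
have -> : \rank (map_mx fr Q) = \rank (map_mx fr be).
  apply/eqP; rewrite eqn_leq Qab map_mxM mxrankM_maxr /=.
  by rewrite -{1}bab -mulmxA !map_mxM mxrankM_maxr.
rewrite mxrank_ker.
suff eq : (kermx (map_mx fr be) :=: map_mx fr P)%MS.
  by have := mxrank_ker (map_mx fr be); rewrite eq => ->; rewrite subKn // rank_leq_row.
apply/eqmxP/andP; split; last by apply/sub_kermxP; rewrite -map_mxM Pbe map_mx0.
set k := kermx _.
have : k *m (map_mx fr be *m map_mx fr al) = 0 by rewrite mulmxA mulmx_ker mul0mx.
rewrite -map_mxM ba map_mxB map_mx1 map_mxM mulmxBr mulmx1 mulmxA => /subr0_eq ->.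
exact: submxMl.
Qed.

(** By [nilpotent_dim] it suffices that a vector killed by [P] lies in the image of the power
    [n.-1]. If [w * p = z * t], then multiplying by [epsn] gives [w * epsn * p = z * x4 * p ^+ n],
    and one factor [p] cancels; moreover [epsn] is [1] modulo [t]. *)
Lemma rank_wp_part d : M = (n * d)%N -> \rank (map_mx fr Q) = d.
Proof.
move=> Md; rewrite rank_wp_part_ker.
suff : (M = n * \rank (kermx (map_mx fr P)))%N.
  by rewrite {1}Md => /eqP; rewrite eqn_pmul2l // => /eqP.
have powE k : map_mx fr P ^+ k = map_mx fr (P ^+ k).
  by elim: k => [|k IH]; rewrite ?expr0 ?map_mx1 // !exprS IH -[LHS]/(_ *m _) -map_mxM.
apply: nilpotent_dim.
  by rewrite powE -dg_mx_pow dg_mx_eq0 ?map_mx0.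
apply/row_subP => i; set v := row i _.
have vP : v *m map_mx fr P = 0.
  by apply/sub_kermxP; exact: row_sub.
(* Denominators are cleared because the cancellation of [phi p] takes place in [R[tau]]. *)
have [b [w [b0 bw]]] := frac_row_clear v.
have fb0 : fr b != 0 by rewrite tofrac_eq0.
have wP : w *m P = 0.
  have e0 : map_mx fr (w *m P) = 0 by rewrite map_mxM -bw -scalemxAl vP scaler0.
  apply/matrixP => a c; apply/eqP; rewrite [X in _ == X]mxE -tofrac_eq0.
  by have /matrixP/(_ a c) := e0; rewrite !mxE => ->.
rewrite -(eqmx_scale _ fb0) bw powE -dg_mx_pow.
have [x5 e5] := h5; have [x4 e4] := h4.
have [z ez] := row_dg tS tL (row_tw w * phi p).
have {}ez : row_tw w * phi p = z * phi t.
  rewrite ez (_ : \row_j _ = 0); last by apply/rowP => j; rewrite mxE -dg_mxE wP mxE.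
  by rewrite /row_tw big1 ?add0r // => l _; rewrite mxE cst0 mul0r.
have ez2 : row_tw w * phi epsn = z * phi x4 * phi (p ^+ n.-1).
  apply: (divisor_mulIr pS pL).
  have -> : row_tw w * phi epsn * phi p = row_tw w * phi p * phi epsn.
    by rewrite -!mulrA -!rmorphM [epsn * p]mulrC.
  rewrite ez -!mulrA -!rmorphM; congr (_ * phi _).
  by rewrite [t * _]mulrC e4 -exprSr prednK // mulrC.
have -> : w = (\row_j digit tS tL 0 j (z * phi x4)) *m dg_mx tS tL M (p ^+ n.-1).
  apply/rowP => j; rewrite -digit_mul_row -ez2 -[LHS](digit0_row_tw tS tL).
  have {1}-> : row_tw w = row_tw w * phi epsn + row_tw w * phi x5 * phi t.
    by rewrite -mulrA -rmorphM -e5 -mulrDr -rmorphD addrC subrK rmorph1 mulr1.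
  by rewrite digitD digit_mul0 addr0.
rewrite map_mxM; exact: submxMl.
Qed.

End RankCount.

(** * The completed tensor product *)

Section CompletedTensor.
Variables (Fq : finFieldType) (Fp : fieldType) (iFq : {rmorphism Fq -> Fp}) (w : Fp -> int).
Variables (R : idomainType) (iR : {rmorphism Fq -> R}).
Variables (R' : comNzRingType) (iR' : {rmorphism Fq -> R'}) (rho : {rmorphism R -> R'}).
Variables (K : fieldType) (kap : {rmorphism R' -> K}).
Variables (A : comNzRingType) (kA : {rmorphism Fq -> A}) (ia : {rmorphism A -> Fp}) (p : A).
Variables (chi : {rmorphism A -> R}) (d : nat) (b : 'I_d -> A).
Local Notation q := #|Fq|.

(* [A] is the coordinate ring, [p] a local uniformizer at the zero [w] of the
   characteristic [chi], and [b] lifts an [Fq]-basis of the residue field. *)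
Record local_data : Prop := LocalData {
  ld_place : is_place w;
  ld_int : forall a, val_ge w 0 (ia a);
  ld_const : forall c, ia (kA c) = iFq c;
  ld_unif : w (ia p) = 1;
  ld_dense : forall y (k : nat), val_ge w 0 y -> exists a, val_ge w k%:Z (y - ia a);
  ld_rho : forall c, rho (iR c) = iR' c;
  ld_kap_inj : injective kap;
  ld_rho_inj : injective rho;
  ld_chi : forall a, chi a = 0 <-> val_ge w 1 (ia a);
  ld_chi_const : forall c, chi (kA c) = iR c;
  ld_basis : forall a, exists! c : {ffun 'I_d -> Fq},
    val_ge w 1 (ia (a - \sum_i kA (c i) * b i));
  ld_frob : forall a, chi a ^+ (q ^ d) = chi a;
  ld_distinct : forall i j, (i < j)%N -> (j < d)%N ->
    exists a, chi a ^+ (q ^ i) != chi a ^+ (q ^ j);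
  ld_inv : forall a, chi a != 0 -> exists a', chi a * chi a' = 1
}.

Hypothesis LD : local_data.
Let wP := ld_place LD.

(** * A linear retraction of the completed field onto its integers *)

Section Retraction.

Let lc (c : {ffun 'I_d -> Fq}) : A := \sum_i kA (c i) * b i.

Let lcD (c c' : {ffun 'I_d -> Fq}) : lc [ffun i => c i + c' i] = lc c + lc c'.
Proof. by rewrite /lc -big_split; apply: eq_bigr => i _; rewrite ffunE rmorphD mulrDl. Qed.

Let lcZ x (c : {ffun 'I_d -> Fq}) : lc [ffun i => x * c i] = kA x * lc c.
Proof. by rewrite /lc mulr_sumr; apply: eq_bigr => i _; rewrite ffunE rmorphM mulrA. Qed.

Let lc0 : lc [ffun=> 0] = 0.
Proof. by rewrite /lc big1 // => i _; rewrite ffunE rmorph0 mul0r. Qed.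

Let residue_lift y : val_ge w 0 y -> exists! c, val_ge w 1 (y - ia (lc c)).
Proof.
move=> hy; have [a ha] := ld_dense LD 1 hy; have [c [hc u]] := ld_basis LD a.
exists c; split=> [|c' hc'].
  have -> : y - ia (lc c) = (y - ia a) + ia (a - lc c) by rewrite rmorphB; ring.
  exact: (placeD wP).
apply: u; have -> : ia (a - lc c') = (y - ia (lc c')) - (y - ia a).
  by rewrite rmorphB; ring.
exact: (val_geB wP).
Qed.

Let co y : {ffun 'I_d -> Fq} :=
  xget [ffun=> 0] [set c | val_ge w 1 (y - ia (lc c))].

Let coP y : val_ge w 0 y -> val_ge w 1 (y - ia (lc (co y))).
Proof.
by move=> /residue_lift[c [hc _]]; rewrite /co; case: xgetP => // /(_ c).
Qed.

Let coE y c : val_ge w 0 y -> val_ge w 1 (y - ia (lc c)) -> co y = c.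
Proof.
move=> hy hc; have [c0 [_ u]] := residue_lift hy.
by rewrite -(u _ hc) (u _ (coP hy)).
Qed.

(** On integral elements this is an [Fq]-linear left inverse of multiplication by [ia p]: the lift
    of the residue class is removed before dividing. Its iterates undo multiplication by powers of
    [ia p]. *)
Let st y := (y - ia (lc (co y))) / ia p.

Let p_neq0 : ia p != 0.
Proof. by apply/eqP => e; have := ld_unif LD; rewrite e (place0 wP). Qed.

Let st_int y : val_ge w 0 y -> val_ge w 0 (st y).
Proof.
move/coP => h; rewrite -(subrr (1 : int)); apply: (val_geM wP) => //.
by right; rewrite (placeV wP) // (ld_unif LD).
Qed.

Let st_lin x y y' : val_ge w 0 y -> val_ge w 0 y' ->
  st (iFq x * y + y') = iFq x * st y + st y'.
Proof.
move=> hy hy'; rewrite /st (@coE (iFq x * y + y') [ffun i => [ffun i => x * co y i] i + co y' i]).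
- rewrite lcD lcZ rmorphD rmorphM (ld_const LD) mulrA -mulrDl mulrBr opprD addrACA.
  by [].
- apply: (placeD wP) => //; rewrite -[0]addr0; apply: (val_geM wP) => //.
  by rewrite -(ld_const LD); exact: ld_int.
- rewrite lcD lcZ rmorphD rmorphM (ld_const LD) opprD addrACA -mulrBr.
  apply: (placeD wP); last exact: coP.
  rewrite -[1]add0r; apply: (val_geM wP); last exact: coP.
  by rewrite -(ld_const LD); exact: ld_int.
Qed.

Let st_p y : val_ge w 0 y -> st (ia p * y) = y.
Proof.
move=> hy; have h1 : val_ge w 1 (ia p * y).
  by rewrite -[1]addr0; apply: (val_geM wP) => //; right; rewrite (ld_unif LD).
rewrite /st (@coE _ [ffun=> 0]); first by rewrite lc0 rmorph0 subr0 mulrC mulKf.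
  exact: val_geW h1.
by rewrite lc0 rmorph0 subr0.
Qed.

Let iter_int k y : val_ge w 0 y -> val_ge w 0 (iter k st y).
Proof. by move=> hy; elim: k => //= k IH; exact: st_int. Qed.

Let pw k y : val_ge w 0 y -> val_ge w 0 (ia p ^+ k * y).
Proof.
move=> hy; rewrite -[0]addr0; apply: (val_geM wP) => //.
by apply: (val_geX0 wP); exact: ld_int.
Qed.

Let iter_p k y : val_ge w 0 y -> iter k st (ia p ^+ k * y) = y.
Proof.
elim: k y => [|k IH] y hy; first by rewrite mul1r.
by rewrite iterSr exprS -mulrA st_p ?IH //; exact: pw.
Qed.

Let scale y := absz (w y).

Let scaleP y k : (scale y <= k)%N -> val_ge w 0 (ia p ^+ k * y).
Proof.
move=> h; have [->|y0] := eqVneq y 0; first by rewrite mulr0; left.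
right; rewrite (placeM wP) ?expf_neq0 // (placeX _ wP) // (ld_unif LD).
by move: h; rewrite /scale; lia.
Qed.

(* An [Fq]-linear retraction of [Fp] onto its valuation ring. *)
Definition int_part y := iter (scale y) st (ia p ^+ scale y * y).

Let int_partE y k : (scale y <= k)%N -> int_part y = iter k st (ia p ^+ k * y).
Proof.
move=> h; rewrite -(subnKC h) iterD exprD [ia p ^+ scale y * _]mulrC -mulrA iter_p //.
exact: scaleP.
Qed.

Lemma int_part_int y : val_ge w 0 (int_part y).
Proof. by apply: iter_int; exact: scaleP. Qed.

Lemma int_part_id y : val_ge w 0 y -> int_part y = y.
Proof. exact: iter_p. Qed.

Lemma int_part_lin x y y' : int_part (iFq x * y + y') = iFq x * int_part y + int_part y'.
Proof.
pose k := (scale y + scale y' + scale (iFq x * y + y'))%N.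
rewrite !(@int_partE _ k) /k ?leq_addl //; [|lia..].
rewrite -/k mulrDr mulrCA.
have : val_ge w 0 (ia p ^+ k * y') by apply: scaleP; rewrite /k; lia.
have : val_ge w 0 (ia p ^+ k * y) by apply: scaleP; rewrite /k; lia.
move: (_ * y) (_ * y'); elim: k => [|k IH] y1 y2 h1 h2 //.
by rewrite !iterSr st_lin // IH //; exact: st_int.
Qed.

End Retraction.

Variables (E : comNzRingType) (i : {rmorphism Fp -> E}) (j : {rmorphism R' -> E}).
Variable U : nat -> set E.
Hypothesis EC : is_ctensor iFq w iR' i j U.
Local Notation pe := (i (ia p)).
Local Notation iA := (i \o ia).

Let p_neq0 : ia p != 0.
Proof. by apply/eqP => e; have := ld_unif LD; rewrite e (place0 wP). Qed.

(** * The filtration [U] and divisibility by the uniformizer *)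

Lemma U_le m n y : (m <= n)%N -> U n y -> U m y.
Proof.
move=> mn; rewrite -(subnK mn); elim: (n - m)%N => // k IH; rewrite addSn => /(ctensorS EC).
exact: IH.
Qed.

Lemma UN n y : U n y -> U n (- y).
Proof. by move=> h; rewrite -sub0r; apply: (ctensorB EC) => //; exact: ctensor0 EC n. Qed.

Lemma UD n x y : U n x -> U n y -> U n (x + y).
Proof. by move=> hx hy; rewrite -[y]opprK; apply: (ctensorB EC) => //; exact: UN. Qed.

Lemma U_sum n (I : Type) (r : seq I) (P : pred I) (f : I -> E) :
  (forall k, P k -> U n (f k)) -> U n (\sum_(k <- r | P k) f k).
Proof.
move=> h; apply: big_ind => //; first exact: ctensor0 EC n.
by move=> x y; exact: UD.
Qed.

Lemma U_int y xi : val_ge w 0 y -> U 0 (i y * j xi).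
Proof. exact: (ctensor_pure EC (n := 0)). Qed.

Lemma U_i y : val_ge w 0 y -> U 0 (i y).
Proof. by move=> h; rewrite -[i y]mulr1 -(rmorph1 j); exact: U_int. Qed.

Lemma U_iA a : U 0 (iA a). Proof. by apply: U_i; exact: ld_int. Qed.

Lemma U_j xi : U 0 (j xi).
Proof. by rewrite -[j xi]mul1r -(rmorph1 i); apply: U_int; exact: val_ge1. Qed.

Lemma U_1 : U 0 1. Proof. by rewrite -(rmorph1 j); exact: U_j. Qed.

Lemma U_M n x y : U 0 x -> U n y -> U n (x * y).
Proof. exact: (ctensorM EC (m := 0)). Qed.

Lemma U_X n x : U 0 x -> U 0 (x ^+ n).
Proof. by move=> h; elim: n => [|n IH]; [exact: U_1|rewrite exprS; exact: U_M]. Qed.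

Lemma U_Xn n x : U 1 x -> U n (x ^+ n).
Proof.
by move=> h; elim: n => [|n IH]; [exact: U_1|rewrite exprS; exact: (ctensorM EC (m := 1%N))].
Qed.

Lemma U_pe n : U n (pe ^+ n).
Proof.
rewrite -rmorphXn -[i _]mulr1 -(rmorph1 j); apply: (ctensor_pure EC).
by apply: (val_geX wP); right; rewrite (ld_unif LD).
Qed.

Lemma pe_inj n x y : pe ^+ n * x = pe ^+ n * y -> x = y.
Proof.
move/(congr1 (fun x => i ((ia p)^-1) ^+ n * x)); rewrite !mulrA -!exprMn -!rmorphM.
by rewrite mulVf // rmorph1 expr1n !mul1r.
Qed.

Lemma U_sep x : (forall n, U n x) -> x = 0.
Proof.
move=> h; have [|y [_ u]] := ctensor_complete EC (s := fun=> 0).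
  by move=> n; rewrite subr0; exact: ctensor0 EC n.
rewrite -(u x) => [|n]; last by rewrite subr0.
by apply: u => n; rewrite subr0; exact: ctensor0 EC n.
Qed.

Lemma U_series (f : nat -> E) : (forall n, U n (f n)) ->
  exists x, forall n, U n (x - \sum_(l < n) f l).
Proof.
move=> h; have [|x [hx _]] := ctensor_complete EC (s := fun n => \sum_(l < n) f l).
  by move=> n; rewrite big_ord_recr /= addrAC subrr add0r.
by exists x.
Qed.

(** The projection to the quotient by [S] and the map that [ctensor_univ] provides at level [m]
    agree on pure tensors and both kill [U n]. Uniqueness at level [n] makes them equal, and the
    second one kills [U m]. *)
Lemma ctensor_kill (m n : nat) (S : set E) : (m <= n)%N ->
  S 0 -> (forall x y, S x -> S y -> S (x - y)) -> U n `<=` S ->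
  (forall a xi, val_ge w m%:Z a -> S (i a * j xi)) -> U m `<=` S.
Proof.
move=> mn S0 SB US SI; have [W [g [gD gS]]] := zmod_quotient_exists S0 SB.
pose beta a xi := g (i a * j xi).
have b1 x y xi : beta (x + y) xi = beta x xi + beta y xi.
  by rewrite /beta rmorphD mulrDl gD.
have b2 a x y : beta a (x + y) = beta a x + beta a y.
  by rewrite /beta rmorphD mulrDr gD.
have b3 c a xi : beta (a * iFq c) xi = beta a (iR' c * xi).
  by rewrite /beta !rmorphM mulrA (ctensor_compat EC).
have b4 a xi : val_ge w m%:Z a -> beta a xi = 0 by move=> ha; apply/gS; exact: SI.
have b5 a xi : val_ge w n%:Z a -> beta a xi = 0.
  by move=> ha; apply: b4; apply: val_geW ha; lia.
have [g0 [[g0D g0U g0E] _]] := ctensor_univ EC b1 b2 b3 b4.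
have [g1 [_ u]] := ctensor_univ EC b1 b2 b3 b5.
have e1 : g1 = g by apply: u; split=> // x hx; apply/gS; exact: US.
have e2 : g1 = g0 by apply: u; split=> // x hx; apply: g0U; exact: U_le hx.
by move=> x hx; apply/gS; rewrite -e1 e2 g0U.
Qed.

Definition iAj (s : seq (A * R')) : E := \sum_(x <- s) iA x.1 * j x.2.

Lemma U_iAj s : U 0 (iAj s).
Proof. by apply: U_sum => x _; apply: U_M; [exact: U_iA|exact: U_j]. Qed.

Lemma iAj_cat s s' : iAj (s ++ s') = iAj s + iAj s'.
Proof. by rewrite /iAj big_cat. Qed.

Lemma iAjN s : iAj [seq (x.1, - x.2) | x <- s] = - iAj s.
Proof.
by rewrite /iAj big_map -sumrN; apply: eq_bigr => x _; rewrite /= rmorphN mulrN.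
Qed.

Lemma U0_dense n y : U 0 y -> exists s, U n (y - iAj s).
Proof.
apply: (@ctensor_kill 0%N n [set y | exists s, U n (y - iAj s)]) => //.
- by exists [::]; rewrite /iAj big_nil subr0; exact: ctensor0 EC n.
- move=> x z [s hs] [s' hs']; exists (s ++ [seq (x.1, - x.2) | x <- s']).
  rewrite iAj_cat iAjN (_ : _ - _ = (x - iAj s) - (z - iAj s')); last by ring.
  exact: (ctensorB EC).
- by move=> x hx; exists [::]; rewrite /iAj big_nil subr0.
- move=> a xi /(ld_dense LD n)[a' ha']; exists [:: (a', xi)].
  by rewrite /iAj big_seq1 /= -mulrBl -rmorphB; exact: ctensor_pure EC _ _ _ ha'.
Qed.

(** The elements with this property form a subgroup that contains [U 0] and all pure tensors. An
    additive map that kills [U 0] and all pure tensors is zero by uniqueness in [ctensor_univ]. *)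
Lemma U_exhaust y : exists c, U 0 (pe ^+ c * y).
Proof.
pose S : set E := [set y | exists c, U 0 (pe ^+ c * y)].
have shift c c' x : U 0 (pe ^+ c * x) -> U 0 (pe ^+ (c' + c) * x).
  by move=> h; rewrite exprD -mulrA; apply: U_M => //; apply: U_X; exact: U_iA.
have S0 : S 0 by exists 0%N; rewrite mulr0; exact: ctensor0 EC 0%N.
have SB x z : S x -> S z -> S (x - z).
  move=> [c hc] [c' hc']; exists (c + c')%N; rewrite mulrBr; apply: (ctensorB EC).
    by rewrite addnC; exact: shift.
  exact: shift.
have SU : U 0%N `<=` S by move=> x hx; exists 0%N; rewrite mul1r.
have [W [g [gD gS]]] := zmod_quotient_exists S0 SB.
have SI a xi : S (i a * j xi).
  have [->|a0] := eqVneq a 0; first by rewrite rmorph0 mul0r.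
  exists (absz (w a)); rewrite -rmorphXn mulrA -rmorphM; apply: U_int; right.
  by rewrite (placeM wP) ?expf_neq0 // (placeX _ wP) // (ld_unif LD); lia.
have [g1 [_ u]] := @ctensor_univ _ _ _ _ _ _ _ _ _ _ EC 0%N W (fun _ _ => 0)
  ltac:(by move=> *; rewrite addr0) ltac:(by move=> *; rewrite addr0) ltac:(by []) ltac:(by []).
have e1 : g1 = g.
  by apply: u; split=> // [x hx|a xi]; apply/gS; [exact: SU|exact: SI].
have e2 : g1 = fun=> 0 by apply: u; split=> // *; rewrite addr0.
by have /gS : g y = 0 by rewrite -e1 e2.
Qed.

Lemma U_div_approx n N y : (n <= N)%N -> U n y ->
  exists y0, U 0 y0 /\ U N (y - pe ^+ n * y0).
Proof.
move=> nN; apply: (@ctensor_kill n N [set y | exists y0, U 0 y0 /\ U N (y - pe ^+ n * y0)]) => //.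
- by exists 0; rewrite mulr0 subr0; split; exact: ctensor0 EC _.
- move=> x z [x0 [hx hx']] [z0 [hz hz']]; exists (x0 - z0); split; first exact: (ctensorB EC).
  rewrite (_ : _ - _ = (x - pe ^+ n * x0) - (z - pe ^+ n * z0)); last by ring.
  exact: (ctensorB EC).
- by move=> x hx; exists 0; rewrite mulr0 subr0; split=> //; exact: ctensor0 EC _.
- move=> a xi ha; exists (i (a / ia p ^+ n) * j xi); split.
    apply: U_int; rewrite -(subrr n%:Z).
    apply: (val_geM wP) => //; right.
    by rewrite (placeV wP) ?expf_neq0 // (placeX _ wP) // (ld_unif LD); lia.
  rewrite mulrA -rmorphXn -rmorphM mulrCA divff ?expf_neq0 // mulr1 subrr.
  exact: ctensor0 EC _.
Qed.

(** Pure tensors control [U n] only modulo a deeper level, so the quotient is obtained as a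
    convergent series of approximate quotients. *)
Lemma U_div n y : U n y -> exists y0, U 0 y0 /\ y = pe ^+ n * y0.
Proof.
move=> hy.
have step k x : U (n + k)%N x -> exists y0, U 0 y0 /\ U (n + k.+1)%N (x - pe ^+ (n + k) * y0).
  by move=> hx; apply: U_div_approx => //; lia.
have step' (kx : nat * E) : exists y0, U (n + kx.1)%N kx.2 ->
    U 0 y0 /\ U (n + kx.1.+1)%N (kx.2 - pe ^+ (n + kx.1) * y0).
  by have [/step[y0 h]|nh] := pselect (U (n + kx.1)%N kx.2); [exists y0|exists 0].
have [g hg] := choice step'.
pose r := fix r k := if k is k'.+1 then r k' - pe ^+ (n + k') * g (k', r k') else y.
have rU k : U (n + k)%N (r k).
  elim: k => [|k IH]; first by rewrite addn0.
  by have [] := hg (k, r k) IH.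
pose f k := pe ^+ k * g (k, r k).
have fU k : U k (f k).
  rewrite /f -[k in U k]addn0; apply: (ctensorM EC); first exact: U_pe.
  by have [] := hg (k, r k) (rU k).
have [y0 hy0] := U_series fU; exists y0; split.
  by have := hy0 0%N; rewrite big_ord0 subr0.
have rE k : r k = y - pe ^+ n * \sum_(l < k) f l.
  elim: k => [|k IH]; first by rewrite big_ord0 mulr0 subr0.
  by rewrite big_ord_recr mulrDr opprD addrA /= -IH /f exprD mulrA.
apply/eqP; rewrite -subr_eq0; apply/eqP; apply: U_sep => k.
have -> : y - pe ^+ n * y0 = r k - pe ^+ n * (y0 - \sum_(l < k) f l).
  by rewrite rE mulrBr opprB addrA addrNK.
apply: (ctensorB EC); first by apply: U_le (rU k); exact: leq_addl.
by apply: U_M => //; apply: U_le (U_pe n).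
Qed.

Lemma U_peM n m x : U (n + m)%N (pe ^+ n * x) <-> U m x.
Proof.
split=> [/U_div[y0 [h0]]|h]; last exact: (ctensorM EC (U_pe n)).
rewrite exprD -mulrA => /pe_inj ->; rewrite -[m in U m]addn0.
exact: (ctensorM EC (U_pe m)).
Qed.

(** By density, [A] modulo [val_ge w n] is the ring of integers of [Fp] modulo its elements of
    valuation at least [n]. [ctensor_univ] asks for a form on all of [Fp]; composing with [int_part]
    supplies one. *)
Lemma extend_functional (n : nat) (lam : A -> R) :
  (forall c a a', lam (kA c * a + a') = iR c * lam a + lam a') ->
  (forall a, val_ge w n%:Z (ia a) -> lam a = 0) ->
  exists L : E -> R',
    [/\ forall x y, L (x + y) = L x + L y, forall x, U n x -> L x = 0 &
        forall a xi, L (iA a * j xi) = rho (lam a) * xi].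
Proof.
move=> lin ker.
have lamB a a' : lam (a - a') = lam a - lam a'.
  by have := lin (- 1) a' a; rewrite !rmorphN !rmorph1 !mulN1r addrC => ->; rewrite addrC.
have [ap hap] := choice (fun y => ld_dense LD n (int_part_int y)).
have lam_eq a a' : val_ge w n%:Z (ia a - ia a') -> lam a = lam a'.
  by rewrite -rmorphB => /ker; rewrite lamB => /eqP; rewrite subr_eq0 => /eqP.
have ge0 x : x - x = 0 :> Fp by rewrite subrr.
have aplin c y y' : lam (ap (iFq c * y + y')) = iR c * lam (ap y) + lam (ap y').
  rewrite -lin; apply: lam_eq; rewrite rmorphD rmorphM (ld_const LD).
  have -> : ia (ap (iFq c * y + y')) - (iFq c * ia (ap y) + ia (ap y')) =
    (iFq c * (int_part y - ia (ap y)) + (int_part y' - ia (ap y'))) -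
    (int_part (iFq c * y + y') - ia (ap (iFq c * y + y'))).
    by rewrite int_part_lin; ring.
  apply: (val_geB wP) => //; apply: (placeD wP) => //.
  rewrite -[n%:Z]add0r; apply: (val_geM wP) => //.
  by rewrite -(ld_const LD); exact: ld_int.
have apD y y' : lam (ap (y + y')) = lam (ap y) + lam (ap y').
  by have := aplin 1 y y'; rewrite !rmorph1 !mul1r.
have ap0 : lam (ap 0) = 0.
  by have := apD 0 0; rewrite addr0 => /eqP; rewrite -subr_eq subrr eq_sym => /eqP.
have apA a : lam (ap (ia a)) = lam a.
  apply: lam_eq; rewrite -[X in val_ge _ _ X]opprB; apply: (val_geN wP).
  by rewrite -{1}(int_part_id (ld_int LD a)).
pose beta y xi : R' := rho (lam (ap y)) * xi.
have b1 x y xi : beta (x + y) xi = beta x xi + beta y xi.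
  by rewrite /beta apD rmorphD mulrDl.
have b2 a x y : beta a (x + y) = beta a x + beta a y by rewrite /beta mulrDr.
have b3 c a xi : beta (a * iFq c) xi = beta a (iR' c * xi).
  have := aplin c a 0; rewrite !addr0 ap0 addr0 /beta [a * _]mulrC => ->.
  by rewrite rmorphM (ld_rho LD) mulrCA mulrA.
have b4 a xi : val_ge w n%:Z a -> beta a xi = 0.
  move=> ha; have h0 : val_ge w 0 a by apply: val_geW ha; lia.
  rewrite /beta ker ?rmorph0 ?mul0r //.
  have -> : ia (ap a) = a - (int_part a - ia (ap a)) by rewrite int_part_id //; ring.
  exact: (val_geB wP).
have [L [[LD' LU LE] _]] := ctensor_univ EC b1 b2 b3 b4.
exists L; split=> // a xi; by rewrite LE /beta apA.
Qed.

(** * Characters and idempotents of the integral part of [E] *)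

Section Characters.
Variable X : nat -> E -> R'.
Hypotheses (XD : forall s x y, X s (x + y) = X s x + X s y)
  (XU : forall s x, U 1 x -> X s x = 0)
  (XE : forall s a xi, X s (iA a * j xi) = rho (chi a) ^+ (q ^ s) * xi).

Lemma X_0 s : X s 0 = 0.
Proof. by apply: XU; exact: ctensor0 EC 1%N. Qed.

Lemma X_N s x : X s (- x) = - X s x.
Proof. by apply/eqP; rewrite -addr_eq0 -XD addNr X_0. Qed.

Lemma X_B s x y : X s (x - y) = X s x - X s y.
Proof. by rewrite XD X_N. Qed.

Lemma X_sum s (I : Type) (r : seq I) (P : pred I) (f : I -> E) :
  X s (\sum_(k <- r | P k) f k) = \sum_(k <- r | P k) X s (f k).
Proof. exact: (big_morph (X s) (XD s) (X_0 s)). Qed.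

Lemma X_iAj s l : X s (iAj l) = \sum_(x <- l) rho (chi x.1) ^+ (q ^ s) * x.2.
Proof. by rewrite X_sum; apply: eq_bigr => x _; rewrite XE. Qed.

Lemma X_approx y : U 0 y -> exists2 l, U 1 (y - iAj l) & forall s, X s y = X s (iAj l).
Proof.
move=> /(U0_dense 1)[l hl]; exists l => // s; apply/eqP.
by rewrite -subr_eq0 -X_B XU.
Qed.

Lemma X_M s x y : U 0 x -> U 0 y -> X s (x * y) = X s x * X s y.
Proof.
move=> hx hy; have [l hl ->] := X_approx hx; have [m hm ->] := X_approx hy.
have -> : X s (x * y) = X s (iAj l * iAj m).
  apply/eqP; rewrite -subr_eq0 -X_B.
  have -> : x * y - iAj l * iAj m = (x - iAj l) * y + iAj l * (y - iAj m) by ring.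
  rewrite XU //; apply: UD; last by apply: U_M => //; exact: U_iAj.
  by rewrite mulrC; exact: U_M.
rewrite {1}/iAj mulr_suml X_sum X_iAj mulr_suml; apply: eq_bigr => u _.
rewrite /iAj mulr_sumr !X_sum mulr_sumr; apply: eq_bigr => v _.
have -> : iA u.1 * j u.2 * (iA v.1 * j v.2) = iA (u.1 * v.1) * j (u.2 * v.2).
  by rewrite !rmorphM /=; ring.
by rewrite !XE [chi _]rmorphM rmorphM exprMn; ring.
Qed.

Lemma X_j s xi : X s (j xi) = xi.
Proof. by rewrite -[j xi]mul1r -(rmorph1 iA) XE !rmorph1 expr1n mul1r. Qed.

Lemma X_1 s : X s 1 = 1.
Proof. by rewrite -(rmorph1 j) X_j. Qed.

Lemma X_iA s a : X s (iA a) = rho (chi a) ^+ (q ^ s).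
Proof. by rewrite -[iA a]mulr1 -(rmorph1 j) XE mulr1. Qed.

Lemma X_X s n x : U 0 x -> X s (x ^+ n) = X s x ^+ n.
Proof.
move=> hx; elim: n => [|n IH]; first by rewrite X_1.
by rewrite !exprS X_M // ?IH //; exact: U_X.
Qed.

Lemma X_period s y : U 0 y -> X (s + d) y = X s y.
Proof.
move=> /X_approx[l _ h]; rewrite !h !X_iAj; apply: eq_bigr => x _.
by rewrite addnC expnD exprM -rmorphXn (ld_frob LD).
Qed.

Lemma X_mod s y : U 0 y -> X (s %% d) y = X s y.
Proof.
move=> hy; rewrite {2}(divn_eq s d); elim: (s %/ d)%N => [|k IH]; first by rewrite mul0n.
by rewrite mulSn -addnA addnC X_period.
Qed.

Let x_ m : K := kap (rho (chi (b m))).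

Let kapR : injective (kap \o rho).
Proof. by apply: inj_comp; [exact: ld_kap_inj|exact: ld_rho_inj]. Qed.

(** A Moore determinant. A relation between its rows would give a nonzero polynomial of degree at
    most [q ^ (d - 1)] that vanishes on the [q ^ d] combinations of the basis [x_]. *)
Lemma moore_det : \det (\matrix_(s < d, m < d) x_ m ^+ (q ^ s)) != 0.
Proof.
apply/negP => /det0P[v v0 hv].
pose P : {poly K} := \sum_(s < d) v 0 s *: 'X^(q ^ s).
have q1 := finNzRing_gt1 Fq.
have PE x : P.[x] = \sum_(s < d) v 0 s * x ^+ (q ^ s).
  by rewrite /P horner_sum; apply: eq_bigr => s _; rewrite !hornerE.
pose io (c : {ffun 'I_d -> Fq}) := kap (rho (chi (\sum_i kA (c i) * b i))).
have ioE c : io c = \sum_m kap (rho (iR (c m))) * x_ m.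
  by rewrite /io !rmorph_sum; apply: eq_bigr => m _; rewrite !rmorphM (ld_chi_const LD).
have frob (c : Fq) s : c ^+ (q ^ s) = c.
  by elim: s => [|s IH]; rewrite ?expr1 // expnSr exprM IH expf_card.
have rootP c : P.[io c] = 0.
  rewrite PE ioE.
  transitivity (\sum_m \sum_(s < d) kap (rho (iR (c m))) * (v 0 s * x_ m ^+ (q ^ s))).
    rewrite exchange_big /=; apply: eq_bigr => s _.
    rewrite (twfrob_sum (kap \o (rho \o iR))) mulr_sumr; apply: eq_bigr => m _.
    by rewrite exprMn -!rmorphXn frob; ring.
  rewrite big1 // => m _; rewrite -mulr_sumr.
  have /rowP/(_ m) := hv; rewrite !mxE => h.
  rewrite [X in _ * X](_ : _ = 0) ?mulr0 // -[RHS]h.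
  by apply: eq_bigr => s _; rewrite !mxE.
have io_inj : injective io.
  move=> c c' /(@kapR (chi _) (chi _))/eqP; rewrite -subr_eq0 -rmorphB.
  have [c0 [_ u]] := ld_basis LD (\sum_i kA (c i) * b i).
  move=> /eqP /(ld_chi LD) h; rewrite -(u c' h); apply/esym/u.
  by rewrite subrr rmorph0; left.
have [k vk] : exists k, v 0 k != 0.
  apply: contrapT => /forallNP h; move/eqP: v0; apply; apply/rowP => k.
  by rewrite mxE; apply/eqP; have /negP := h k; rewrite negbK.
have P0 : P != 0.
  apply/eqP => /polyP/(_ (q ^ k)%N); rewrite coef0 coef_sum (bigD1 k) //=.
  rewrite coefZ coefXn eqxx mulr1 big1 ?addr0; first exact/eqP.
  move=> s sk; rewrite coefZ coefXn eqn_exp2l // eq_sym.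
  by rewrite (_ : (s == k :> nat) = false) ?mulr0 //; apply/negbTE; move: sk; apply: contra => /eqP e; apply/eqP/val_inj.
have := max_poly_roots P0 (rs := [seq io c | c <- enum {: {ffun 'I_d -> Fq}}]).
have -> : all (root P) [seq io c | c <- enum {: {ffun 'I_d -> Fq}}].
  by apply/allP => _ /mapP[c _ ->]; rewrite rootE rootP.
rewrite map_inj_uniq // enum_uniq => /(_ isT isT).
rewrite size_map -cardE card_ffun card_ord ltnNge => /negP; apply.
apply: leq_trans (size_sum _ _ _) _; apply/bigmax_leqP => s _.
apply: leq_trans (size_scale_leq _ _) _; rewrite size_polyXn ltn_exp2l //.
Qed.

(** Modulo [U 1] the element is a sum of [b m] tensored with some [eta m]. The values of the
    characters form a linear system for the [eta m] whose matrix has the Moore determinant. *)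
Lemma X_kernel y : U 0 y -> (forall s, (s < d)%N -> X s y = 0) -> U 1 y.
Proof.
move=> hy hX; have [l hl hXl] := X_approx hy.
suff h : U 1 (iAj l) by rewrite -[y](subrK (iAj l)); exact: UD.
have [c hc] := choice (fun a => let: ex_intro c (conj hc _) := ld_basis LD a in ex_intro _ c hc).
pose eta m : R' := \sum_(x <- l) iR' (c x.1 m) * x.2.
have e1 : U 1 (iAj l - \sum_m iA (b m) * j (eta m)).
  have -> : \sum_m iA (b m) * j (eta m) =
      \sum_(x <- l) iA (\sum_m kA (c x.1 m) * b m) * j x.2.
    rewrite /eta; under eq_bigr => m _ do rewrite rmorph_sum mulr_sumr.
    rewrite exchange_big /=; apply: eq_bigr => x _.
    rewrite !rmorph_sum mulr_suml; apply: eq_bigr => m _.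
    by rewrite /= !rmorphM (ld_const LD) (ctensor_compat EC); ring.
  rewrite /iAj -sumrB; apply: U_sum => x _.
  by rewrite -mulrBl -rmorphB; apply: (ctensor_pure EC (n := 1)); exact: hc.
suff eta0 m : eta m = 0.
  move: e1; rewrite big1 ?subr0 // => m _; by rewrite eta0 rmorph0 mulr0.
have Xe s : (s < d)%N -> \sum_m kap (eta m) * x_ m ^+ (q ^ s) = 0.
  move=> sd; have := XU s e1; rewrite X_B -hXl hX // sub0r => /eqP.
  rewrite oppr_eq0 X_sum => /eqP/(congr1 kap); rewrite rmorph0 rmorph_sum => h.
  rewrite -[RHS]h; apply: eq_bigr => m' _.
  by rewrite XE rmorphM rmorphXn mulrC.
apply: (ld_kap_inj LD); rewrite rmorph0.
have e2 : (\matrix_(s < d, m < d) x_ m ^+ (q ^ s)) *m (\col_m kap (eta m)) = 0.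
  apply/colP => s; rewrite !mxE -[RHS](Xe s) ?ltn_ord //.
  by apply: eq_bigr => m' _; rewrite !mxE mulrC.
have u : (\matrix_(s < d, m < d) x_ m ^+ (q ^ s)) \in unitmx.
  by rewrite unitmxE unitfE moore_det.
have := congr1 (mulmx (invmx (\matrix_(s < d, m < d) x_ m ^+ (q ^ s)))) e2.
by rewrite mulmx0 mulKmx // => /colP/(_ m); rewrite !mxE.
Qed.

Let frobB n x y : (x - y) ^+ (q ^ n) = x ^+ (q ^ n) - y ^+ (q ^ n) :> E.
Proof.
have := twfrobD (j \o iR') n (x - y) y; rewrite subrK => ->.
by rewrite addrK.
Qed.

(** The difference lies in [U 1]. For idempotents it equals its own powers of exponent [q ^ n],
    since Frobenius is additive, so it lies in every [U n]. *)
Lemma idem_eq x y : U 0 x -> U 0 y -> x * x = x -> y * y = y ->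
  (forall s, (s < d)%N -> X s x = X s y) -> x = y.
Proof.
move=> hx hy xx yy h; have u : U 1 (x - y).
  apply: X_kernel; first exact: (ctensorB EC).
  by move=> s sd; rewrite X_B h // subrr.
have powE z n : z * z = z -> z ^+ n.+1 = z.
  by move=> zz; elim: n => [|n IH]; rewrite ?expr1 // exprS IH.
apply/eqP; rewrite -subr_eq0; apply/eqP; apply: U_sep => n.
have <- : (x - y) ^+ (q ^ n) = x - y.
  have := card_exp_gt0 Fq n; rewrite frobB.
  by case: (q ^ n)%N => // k _; rewrite !powE.
apply: (@U_le n (q ^ n)); last exact: U_Xn.
by apply: ltnW; apply: ltn_expl; exact: finNzRing_gt1.
Qed.

(** Lagrange interpolation: for each [t] other than [s] a factor built from an [a] on which the two
    characters differ. It is normalized by an inverse from the image of [chi], which is a field. *)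
Lemma approx_idempotent (s : 'I_d) :
  exists2 x, U 0 x & forall t : 'I_d, X t x = (t == s)%:R.
Proof.
have ex (t : 'I_d) : t != s -> exists2 x, U 0 x & X s x = 1 /\ X t x = 0.
  move=> ts.
  have [a ha] : exists a, chi a ^+ (q ^ s) != chi a ^+ (q ^ t).
    have [lt|lt|/val_inj e] := ltngtP s t; last by rewrite e eqxx in ts.
      exact: (ld_distinct LD).
    by have [a ha] := ld_distinct LD lt (ltn_ord s); exists a; rewrite eq_sym.
  have [a' ha'] : exists a', chi (a ^+ (q ^ s) - a ^+ (q ^ t)) * chi a' = 1.
    by apply: (ld_inv LD); rewrite rmorphB !rmorphXn subr_eq0.
  pose x := (iA a - j (rho (chi a ^+ (q ^ t)))) * j (rho (chi a')).
  have h1 : U 0 (iA a - j (rho (chi a ^+ (q ^ t)))).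
    by apply: (ctensorB EC); [exact: U_iA|exact: U_j].
  exists x; first by apply: U_M => //; exact: U_j.
  rewrite !X_M ?X_B ?X_iA ?X_j //; try exact: U_j.
  split; last by rewrite rmorphXn subrr mul0r.
  by rewrite -(rmorph1 rho) -ha' !rmorphM !rmorphB !rmorphXn.
have ex' (t : 'I_d) : exists x, U 0 x /\ (t != s -> X s x = 1 /\ X t x = 0).
  by case: (boolP (t == s)) => [_|/ex[x h1 h2]]; [exists 1|exists x]; split=> //; exact: U_1.
have [f hf] := choice ex'.
exists (\prod_(t | t != s) f t).
  by apply: big_ind => //; [exact: U_1|move=> *; exact: U_M|move=> t _; have [] := hf t].
have XP t : X t (\prod_(u | u != s) f u) = \prod_(u | u != s) X t (f u).
  suff [] : U 0 (\prod_(u | u != s) f u) /\ X t (\prod_(u | u != s) f u) = \prod_(u | u != s) X t (f u) by [].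
  elim/big_rec2: _ => [|u y1 y2 _ [h1 h2]]; first by rewrite X_1; split=> //; exact: U_1.
  have [h3 _] := hf u; split; first exact: U_M.
  by rewrite X_M // h2.
move=> t; rewrite XP; have [->|ts] := eqVneq t s.
  by rewrite big1 // => u us; have [_ /(_ us)[]] := hf u.
by rewrite (bigD1 t) //=; have [_ /(_ ts)[_ ->]] := hf t; rewrite mul0r.
Qed.

(** The powers [x ^+ (q ^ n)] of an approximate idempotent converge: consecutive differences are
    powers of exponent [q ^ n] of [x ^+ q - x], which lies in [U 1]. *)
Lemma idempotent_exists (s : 'I_d) :
  exists e, [/\ U 0 e, e * e = e & forall t : 'I_d, X t e = (t == s)%:R].
Proof.
have [x hx Xx] := approx_idempotent s.
have q1 := finNzRing_gt1 Fq.
have u : U 1 (x ^+ q - x).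
  apply: X_kernel; first by apply: (ctensorB EC) => //; exact: U_X.
  move=> t td; rewrite X_B X_X // -[t]/(nat_of_ord (Ordinal td)) Xx.
  by case: (_ == _); rewrite ?expr1n ?subrr // expr0n eqn0Ngt (ltnW q1) subrr.
have u2 : U 1 (x * x - x).
  apply: X_kernel; first by apply: (ctensorB EC) => //; exact: U_M.
  move=> t td; rewrite X_B X_M // -[t]/(nat_of_ord (Ordinal td)) Xx.
  by case: (_ == _); rewrite ?mulr1 ?mulr0 subrr.
have big n y : U 1 y -> U n (y ^+ (q ^ n)).
  move=> hy; apply: (@U_le n (q ^ n)); last exact: U_Xn.
  by apply: ltnW; apply: ltn_expl.
have [|e [he _]] := ctensor_complete EC (s := fun n => x ^+ (q ^ n)).
  by move=> n; rewrite expnS exprM -frobB; exact: big.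
have e0 : U 0 e by rewrite -[e](subrK (x ^+ (q ^ 0))); apply: UD => //; exact: U_X.
exists e; split=> //.
  apply/eqP; rewrite -subr_eq0; apply/eqP; apply: U_sep => n.
  set y := x ^+ (q ^ n).
  have -> : e * e - e = (e - y) * (e + y - 1) + (y * y - y) by ring.
  apply: UD.
    rewrite mulrC; apply: U_M => //; apply: (ctensorB EC); last exact: U_1.
    by apply: UD => //; exact: U_X.
  by rewrite /y -exprMn -frobB; exact: big.
move=> t; have := XU t (he 1%N); rewrite X_B => /eqP; rewrite subr_eq0 => /eqP ->.
rewrite X_X // Xx expn1; case: (_ == _); rewrite ?expr1n //.
by rewrite expr0n eqn0Ngt (ltnW q1).
Qed.

End Characters.

Variable sigma : {rmorphism E -> E}.

(* The product decomposition of the integral part of [E]: [X s] is reduction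
   modulo [p] of the [s]-th component and [e s] the [s]-th idempotent, with
   [s] read modulo [d]. *)
Record comp_data (X : nat -> E -> R') (e : nat -> E) : Prop := CompData {
  cdXD : forall s x y, X s (x + y) = X s x + X s y;
  cdXU : forall s x, U 1 x -> X s x = 0;
  cdXE : forall s a xi, X s (iA a * j xi) = rho (chi a) ^+ (q ^ s) * xi;
  cdXM : forall s x y, U 0 x -> U 0 y -> X s (x * y) = X s x * X s y;
  cdX_period : forall s y, U 0 y -> X (s %% d)%N y = X s y;
  cdX_ker : forall y, U 0 y -> (forall s, (s < d)%N -> X s y = 0) -> U 1 y;
  cdXj : forall s xi, X s (j xi) = xi;
  cde_int : forall s, U 0 (e s);
  cde_idem : forall s, e s * e s = e s;
  cdXe : forall s t, X t (e s) = (t == s %[mod d])%:R;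
  cde_orth : forall s t, s != t %[mod d] -> e s * e t = 0;
  cde_sum : \sum_(s < d) e s = 1;
  cde_sigma : forall s, sigma (e s) = e s.+1;
  cd_d : (0 < d)%N
}.

Lemma comp_data_exists : is_frobenius q i j U sigma -> exists X e, comp_data X e.
Proof.
move=> [sigE sigU].
(* For [d = 0] the basis would be empty and [1] would have positive valuation. *)
have d0 : (0 < d)%N.
  rewrite lt0n; apply/eqP => d0; have [c [hc _]] := ld_basis LD 1; move: hc.
  rewrite big1 => [|k _]; last by have := ltn_ord k; rewrite {2}d0.
  rewrite subr0 rmorph1.
  by move/(val_geE w 1 (oner_neq0 _)); rewrite (place1 wP).
have iRq (c : Fq) s : iR c ^+ (q ^ s) = iR c.
  rewrite -rmorphXn; congr (iR _).
  by elim: s => [|s IH]; rewrite ?expr1 // expnSr exprM IH expf_card.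
have lin s c a a' : chi (kA c * a + a') ^+ (q ^ s) =
    iR c * chi a ^+ (q ^ s) + chi a' ^+ (q ^ s).
  by rewrite rmorphD rmorphM (twfrobD iR) exprMn (ld_chi_const LD) iRq.
have ker s a : val_ge w 1%N%:Z (ia a) -> chi a ^+ (q ^ s) = 0.
  by move=> /(ld_chi LD) ->; rewrite (twfrob0 Fq).
have [X hX] := choice (fun s => extend_functional (lin s) (ker s)).
have XD s x y : X s (x + y) = X s x + X s y by have [] := hX s.
have XU s x : U 1 x -> X s x = 0 by have [_ h _] := hX s; exact: h.
have XE s a xi : X s (iA a * j xi) = rho (chi a) ^+ (q ^ s) * xi.
  by have [_ _ ->] := hX s; rewrite rmorphXn.
have [f hf] := choice (fun s : 'I_d => @idempotent_exists X XD XU XE s).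
pose e k := f (Ordinal (ltn_pmod k d0)).
have eU s : U 0 (e s) by have [] := hf (Ordinal (ltn_pmod s d0)).
have ee s : e s * e s = e s by have [] := hf (Ordinal (ltn_pmod s d0)).
have XM := X_M XD XU XE; have Xper := X_mod XD XU XE; have Xker := X_kernel XD XU XE.
have ieq := idem_eq XD XU XE.
have Xe s t : X t (e s) = (t == s %[mod d])%:R.
  rewrite -Xper // -[(t %% d)%N]/(nat_of_ord (Ordinal (ltn_pmod t d0))).
  by have [_ _ ->] := hf (Ordinal (ltn_pmod s d0)).
have X1 s : X s 1 = 1 by exact: X_1 XE s.
have orth s t : s != t %[mod d] -> e s * e t = 0.
  move=> st; apply: ieq; [exact: U_M|exact: ctensor0 EC 0%N| |by rewrite mul0r|].
    by rewrite mulrACA !ee.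
  move=> k kd; rewrite XM // !Xe X_0 //.
  have [ks|] := eqVneq (k %% d)%N (s %% d)%N; last by rewrite mul0r.
  by rewrite ks (negbTE st) mulr0.
have sumU : U 0 (\sum_(s < d) e s) by apply: U_sum.
exists X, e; split=> //.
- exact: X_j XE.
- apply: ieq => //; [exact: U_1| |exact: mulr1|].
    rewrite mulr_suml; apply: eq_bigr => s _; rewrite mulr_sumr (bigD1 s) //= ee big1 ?addr0 //.
    by move=> t ts; apply: orth; rewrite !modn_small // eq_sym.
  move=> k kd; rewrite X_sum // X1 (bigD1 (Ordinal kd)) //= Xe eqxx big1 ?addr0 //.
  move=> t tk; rewrite Xe !modn_small // (_ : (k == t) = false) //.
  by apply/negbTE; move: tk; apply: contra => /eqP h; apply/eqP/val_inj.
- move=> s; apply: ieq => //.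
  + exact: sigU.
  + by rewrite -rmorphM ee.
  (* [sigma] raises only the second tensor factor to the power [q], which turns the character [X k]
     into [X k.+1] up to a [q]-th power; on the values [0] and [1] this power has no effect. *)
  have Xsig k y : U 0 y -> X k.+1 (sigma y) = X k y ^+ q.
    move=> hy; have [l hl Xl] := X_approx XD XU hy.
    have -> : X k.+1 (sigma y) = X k.+1 (sigma (iAj l)).
      apply/eqP; rewrite -subr_eq0 -X_B // -rmorphB XU //; exact: sigU.
    rewrite Xl X_iAj // (_ : q = q ^ 1)%N ?expn1 //.
    rewrite -[in RHS](expn1 q) (twfrob_sum (rho \o iR)) /iAj rmorph_sum X_sum //.
    apply: eq_bigr => x _; rewrite [sigma _](sigE _ _) -rmorphXn -[i (ia x.1)]/(iA x.1) XE exprMn.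
    by rewrite expnSr exprM.
  move=> k kd; rewrite Xe.
  have [k' kE] : exists k', k'.+1 == k %[mod d].
    case: k {kd} => [|k]; last by exists k.
    by exists d.-1; rewrite prednK // modnn mod0n.
  have se : U 0 (sigma (e s)) by exact: sigU.
  have -> : X k (sigma (e s)) = X k'.+1 (sigma (e s)).
    by rewrite -(Xper _ _ se) -(eqP kE) (Xper _ _ se).
  rewrite Xsig // Xe -(eqP kE).
  rewrite -[k'.+1]addn1 -[s.+1]addn1 eqn_modDr.
  by case: (_ == _); rewrite ?expr1n // expr0n eqn0Ngt (ltnW (finNzRing_gt1 _)).
Qed.

(** * Power series expansions in a single component *)

Section Components.
Variables (X : nat -> E -> R') (e : nat -> E).
Hypothesis CD : comp_data X e.

Let XB s x y : X s (x - y) = X s x - X s y.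
Proof. exact: X_B (cdXD CD) (cdXU CD) _ _ _. Qed.

Let X0 s : X s 0 = 0. Proof. exact: X_0 (cdXU CD) s. Qed.

Let UM := U_M.

Lemma R'_domain (x y : R') : x * y = 0 -> x = 0 \/ y = 0.
Proof.
move/(congr1 kap); rewrite rmorphM rmorph0 => /eqP; rewrite mulf_eq0 => /orP[]/eqP h; [left|right];
  by apply: (ld_kap_inj LD); rewrite h rmorph0.
Qed.

Lemma X_e s : X s (e s) = 1. Proof. by rewrite (cdXe CD) eqxx. Qed.

(** Modulo the uniformizer the component [s] is [R'] itself, embedded by [j]. This makes it behave
    like the power series in [pe] over [R']. *)
Lemma comp_residue s y : U 0 y -> U 1 (e s * (y - j (X s y))).
Proof.
move=> hy; have h0 : U 0 (y - j (X s y)) by apply: (ctensorB EC) => //; exact: U_j.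
apply: (cdX_ker CD); first exact: UM (cde_int CD s) h0.
move=> t _; rewrite (cdXM CD) ?XB ?(cdXj CD) //; last exact: (cde_int CD).
rewrite (cdXe CD); have [ts|] := eqVneq (t %% d)%N (s %% d)%N; last by rewrite mul0r.
by rewrite -(cdX_period CD t) // ts (cdX_period CD) // subrr mulr0.
Qed.

Lemma comp_digits s y k : U 0 y ->
  exists f : nat -> R', U k (e s * (y - \sum_(l < k) pe ^+ l * j (f l))).
Proof.
move=> hy; elim: k => [|k [f hf]].
  by exists (fun=> 0); rewrite big_ord0 subr0; exact: UM (cde_int CD s) hy.
have [y1 [h1 e1]] := U_div hf.
pose f' l := if (l < k)%N then f l else X s y1; exists f'.
have -> : \sum_(l < k.+1) pe ^+ l * j (f' l) = \sum_(l < k) pe ^+ l * j (f l) + pe ^+ k * j (X s y1).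
  rewrite big_ord_recr /= /f' ltnn; congr (_ + _).
  by apply: eq_bigr => l _; rewrite ltn_ord.
have -> : e s * (y - (\sum_(l < k) pe ^+ l * j (f l) + pe ^+ k * j (X s y1))) =
    pe ^+ k * (e s * (y1 - j (X s y1))).
  rewrite opprD addrA mulrDr -{1}(cde_idem CD) -[e s * e s * _]mulrA e1; ring.
rewrite -addn1; apply: (ctensorM EC (U_pe k)); exact: comp_residue.
Qed.

Lemma ser_exists (f : nat -> R') :
  exists x, forall n, U n (x - \sum_(l < n) pe ^+ l * j (f l)).
Proof.
apply: (U_series (f := fun l => pe ^+ l * j (f l))) => n.
by rewrite mulrC; apply: UM; [exact: U_j|exact: U_pe].
Qed.

Definition ser f := projT1 (cid (ser_exists f)).

Lemma ser_approx f n : U n (ser f - \sum_(l < n) pe ^+ l * j (f l)).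
Proof. by rewrite /ser; case: cid. Qed.

Lemma ser_eq (f : nat -> R') y : (forall n, U n (y - \sum_(l < n) pe ^+ l * j (f l))) -> y = ser f.
Proof.
move=> h; apply/eqP; rewrite -subr_eq0; apply/eqP; apply: U_sep => n.
have -> : y - ser f = (y - \sum_(l < n) pe ^+ l * j (f l)) - (ser f - \sum_(l < n) pe ^+ l * j (f l)) by ring.
by apply: (ctensorB EC) => //; exact: ser_approx.
Qed.

Lemma ser_int f : U 0 (ser f).
Proof. by have := ser_approx f 0; rewrite big_ord0 subr0. Qed.

Lemma serD (f g : nat -> R') : ser (fun n => f n + g n) = ser f + ser g.
Proof.
apply/esym/ser_eq => n.
have -> : \sum_(l < n) pe ^+ l * j (f l + g l) = \sum_(l < n) pe ^+ l * j (f l) + \sum_(l < n) pe ^+ l * j (g l).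
  by rewrite -big_split; apply: eq_bigr => l _; rewrite rmorphD mulrDr.
rewrite opprD addrACA; apply: UD; exact: ser_approx.
Qed.

Lemma serZ xi (f : nat -> R') : ser (fun n => xi * f n) = j xi * ser f.
Proof.
apply/esym/ser_eq => n.
have -> : \sum_(l < n) pe ^+ l * j (xi * f l) = j xi * \sum_(l < n) pe ^+ l * j (f l).
  by rewrite mulr_sumr; apply: eq_bigr => l _; rewrite rmorphM; ring.
by rewrite -mulrBr; apply: UM; [exact: U_j|exact: ser_approx].
Qed.

Lemma ser_shift (f g : nat -> R') : f 0%N = 0 -> (forall n, f n.+1 = g n) -> ser f = pe * ser g.
Proof.
move=> f0 fS; apply/esym/ser_eq => -[|n].
  by rewrite big_ord0 subr0; apply: UM; [exact: U_iA|exact: ser_int].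
rewrite big_ord_recl f0 rmorph0 mulr0 add0r.
have -> : \sum_(l < n) pe ^+ lift ord0 l * j (f (lift ord0 l)) = pe * \sum_(l < n) pe ^+ l * j (g l).
  by rewrite mulr_sumr; apply: eq_bigr => l _; rewrite lift0 fS exprS mulrA.
rewrite -mulrBr -[n.+1]add1n; apply: (ctensorM EC); first by have := U_pe 1.
exact: ser_approx.
Qed.

Lemma ser_congr n (f g : nat -> R') : (forall l, (l < n)%N -> f l = g l) -> U n (ser f - ser g).
Proof.
move=> fg.
have -> : ser f - ser g = (ser f - \sum_(l < n) pe ^+ l * j (f l)) - (ser g - \sum_(l < n) pe ^+ l * j (g l)).
  by rewrite (eq_bigr (fun l : 'I_n => pe ^+ l * j (g l))) => [|l _]; [ring|rewrite fg ?ltn_ord].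
by apply: (ctensorB EC); exact: ser_approx.
Qed.

Lemma ser_comp_eq0 s f n : U n (e s * ser f) -> forall l, (l < n)%N -> f l = 0.
Proof.
move=> h l; elim/ltn_ind: l => l IH ln.
have e1 : \sum_(l' < l.+1) pe ^+ l' * j (f l') = pe ^+ l * j (f l).
  rewrite big_ord_recr big1 /= ?add0r // => l' _.
  by rewrite IH ?rmorph0 ?mulr0 // (ltn_trans (ltn_ord l')).
have h1 : U l.+1 (pe ^+ l * (e s * j (f l))).
  have -> : pe ^+ l * (e s * j (f l)) = e s * ser f - e s * (ser f - \sum_(l' < l.+1) pe ^+ l' * j (f l')).
    by rewrite e1; ring.
  apply: (ctensorB EC); first exact: U_le h.
  by apply: UM; [exact: cde_int CD s|exact: ser_approx].
move: h1; rewrite -addn1 => /U_peM h1.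
have := cdXU CD s h1; rewrite (cdXM CD) ?X_e ?(cdXj CD) ?mul1r //; first exact: cde_int CD s.
exact: U_j.
Qed.

Lemma U_order y : y <> 0 -> U 0 y -> exists n, U n y /\ ~ U n.+1 y.
Proof.
move=> y0 hy; apply: contrapT => /forallNP h; apply: y0; apply: U_sep.
by elim=> [//|n IH]; have /not_andP[//|/contrapT] := h n.
Qed.

(** Power of [pe] times an element with nonzero residue; the exponent [c] first moves [y] into the
    integral part. *)
Lemma comp_normal s y : e s * y <> 0 ->
  exists c n y', [/\ U 0 y', pe ^+ c * (e s * y) = pe ^+ n * y' & X s y' <> 0].
Proof.
move=> ey; have [c hc] := U_exhaust y.
pose z := e s * (pe ^+ c * y).
have zE : z = pe ^+ c * (e s * y) by rewrite /z; ring.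
have z0 : z <> 0.
  by rewrite zE -(mulr0 (pe ^+ c)) => /pe_inj.
have [n [h1 h2]] := U_order z0 (UM (cde_int CD s) hc).
have [y' [hy' e']] := U_div h1.
have ey' : e s * y' = y'.
  by apply: (@pe_inj n); rewrite mulrCA -e' [LHS]mulrA (cde_idem CD).
exists c, n, y'; split=> //; first by rewrite -zE.
move=> X0'; apply: h2; rewrite e' -addn1; apply/U_peM; apply: (cdX_ker CD) => // t _.
rewrite -ey' (cdXM CD) ?(cdXe CD) //; last exact: cde_int CD s.
have [ts|] := eqVneq (t %% d)%N (s %% d)%N; last by rewrite mul0r.
by rewrite -(cdX_period CD t) // ts (cdX_period CD) // X0' mulr0.
Qed.

(** Leading coefficients multiply, and [R'] is a domain because it embeds into [K]. *)
Lemma comp_prime s : prime_ideal [set y | e s * y = 0].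
Proof.
split.
- split=> /=; first by rewrite mulr0.
    by move=> x y ex ey; rewrite mulrDr ex ey addr0.
  by move=> a x ex; rewrite mulrCA ex mulr0.
- move=> /=; rewrite mulr1 => e0; have := X_e s; rewrite e0 X0 => /eqP.
  by rewrite eq_sym oner_eq0.
move=> x y /= exy; apply: contrapT => /not_orP[ex ey].
have [c [n [x' [hx e1 X1]]]] := comp_normal ex.
have [c' [n' [y' [hy e2 X2]]]] := comp_normal ey.
have : pe ^+ n * x' * (pe ^+ n' * y') = 0.
  rewrite -e1 -e2; transitivity (pe ^+ c * pe ^+ c' * (e s * e s * (x * y))); first by ring.
  by rewrite (cde_idem CD) exy mulr0.
rewrite mulrACA -exprD -[RHS](mulr0 (pe ^+ (n + n'))) => /pe_inj e3.
by have := X0 s; rewrite -e3 (cdXM CD) // => /R'_domain[].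
Qed.

(** The entries of [C ^+ m] lie in [U m], so the geometric series converges. This serves as the
    substitute for Nakayama's lemma over the integral part. *)
Lemma geometric_inverse n (C : 'M[E]_n) : (forall k l, U 1 (C k l)) ->
  exists V : 'M[E]_n, V *m (1%:M - C) = 1%:M /\ forall k l, U 0 (V k l).
Proof.
move=> hC; have CX m : forall k l, U m ((C ^+ m) k l).
  elim: m => [|m IH] k l.
    by rewrite expr0 mxE; case: (_ == _); [exact: U_1|exact: ctensor0 EC 0%N].
  rewrite exprS mxE; apply: U_sum => a _; rewrite -add1n.
  exact: (ctensorM EC).
have [V hV] := choice (fun kl : 'I_n * 'I_n => U_series (f := fun m => (C ^+ m) kl.1 kl.2) (fun m => CX m kl.1 kl.2)).
pose VM : 'M[E]_n := \matrix_(k, l) V (k, l); exists VM.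
have V0 k l : U 0 (VM k l) by have := hV (k, l) 0%N; rewrite big_ord0 subr0 mxE.
split=> //; apply/matrixP => k l; apply/eqP; rewrite -subr_eq0; apply/eqP; apply: U_sep => m.
pose S := \sum_(a < m) C ^+ a.
have SE : S *m (1%:M - C) = 1%:M - C ^+ m.
  have h := subrX1 C m.
  have -> : 1%:M - C ^+ m = - (C ^+ m - 1) by rewrite opprB.
  rewrite h -mulNr opprB /S -[RHS]/((1%:M - C) *m _) mulmx_suml mulmx_sumr; apply: eq_bigr => a _.
  rewrite mulmxBl mulmxBr mulmx1 mul1mx; congr (_ - _).
  by rewrite -[LHS]/(_ * _) -exprSr exprS.
have VS a b' : U m ((VM - S) a b').
  have := hV (a, b') m; rewrite !mxE /S summxE; exact.
have -> : (VM *m (1%:M - C)) k l - (1%:M : 'M[E]_n) k l =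
    ((VM - S) *m (1%:M - C)) k l - (C ^+ m) k l.
  by rewrite mulmxBl SE !mxE; ring.
apply: (ctensorB EC); last exact: CX.
rewrite mxE; apply: U_sum => a _; rewrite mulrC; apply: UM => //.
rewrite !mxE; apply: (ctensorB EC); last exact: U_le (hC _ _).
by case: (_ == _); [exact: U_1|exact: ctensor0 EC 0%N].
Qed.

End Components.

End CompletedTensor.

(** * Isocrystals *)

Section Linearization.
Variables (E : comNzRingType) (sigma : {rmorphism E -> E}).
Local Notation semilinear := (semilinear_map sigma (fun e x => e *: x)).

Definition spanned_by_image (X : lmodType E) (tX : X -> X) : Prop :=
  forall y, exists s : seq (E * X), y = \sum_(x <- s) x.1 *: tX x.2.

Lemma linear_sum_seq (X W : lmodType E) (f : X -> W) (I : Type) (s : seq I)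
    (c : I -> E) (x : I -> X) :
  linear f -> f (\sum_(k <- s) c k *: x k) = \sum_(k <- s) c k *: f (x k).
Proof.
move=> fL; have f0 : f 0 = 0.
  by have := fL 1 0 0; rewrite !scale1r addr0 => /eqP; rewrite -subr_eq subrr eq_sym => /eqP.
elim: s => [|k s IH]; first by rewrite !big_nil.
by rewrite !big_cons fL IH.
Qed.

(** [X] itself, with the map [tX], is taken as the pullback [sigma^*X], so that the linearization is
    the identity. Existence in the universal property is the last hypothesis, and uniqueness follows
    from spanning. *)
Lemma linearization_isoI (X : lmodType E) (tX : X -> X) :
  semilinear tX -> spanned_by_image tX ->
  (forall (W : lmodType E) (g : X -> W), semilinear g ->
     exists H : X -> W, linear H /\ forall x, H (tX x) = g x) ->
  linearization_iso sigma tX.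
Proof.
move=> tXs sp ex; exists X, tX, id; split=> //; last by exists id.
split=> // W g gs; have [H [HL Hg]] := ex W g gs; exists H; split=> // H' [HL' Hg'].
apply/funext => y; have [s ->] := sp y; rewrite !linear_sum_seq //.
by apply: eq_bigr => x _; rewrite Hg Hg'.
Qed.

Lemma span_seq (X : lmodType E) S (Y : set X) (I : eqType) (s : seq I)
    (c : I -> E) (x : I -> X) :
  (forall k, k \in s -> S (c k) /\ Y (x k)) -> Defs.span S Y (\sum_(k <- s) c k *: x k).
Proof.
move=> hs; exists (size s), (fun k => c (tnth (in_tuple s) k)), (fun k => x (tnth (in_tuple s) k)).
split=> [k|k|]; last by rewrite big_tnth.
  by have [] := hs _ (mem_tnth k (in_tuple s)).
by have [] := hs _ (mem_tnth k (in_tuple s)).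
Qed.

Lemma presents_fg (X : lmodType E) n (x : 'I_n -> X) s :
  presents x s -> fg_projective setT [set: X].
Proof.
move=> [sL sx]; split; first by split.
by exists n, x, s; split=> // k c y y' _ _ _; exact: sL.
Qed.

End Linearization.

(** * The zero isocrystal, for slopes at which the filtration does not jump *)

Section ZeroModule.
Variables (E : comNzRingType) (sigma : {rmorphism E -> E}).
Local Notation Z := 'rV[E]_0.

Lemma rV0_eq (x y : Z) : x = y.
Proof. by apply/rowP => -[]. Qed.

Lemma rV0_isocrystal : is_isocrystal sigma (id : Z -> Z).
Proof.
split.
- apply: (@presents_fg _ _ 0 (fun=> 0) (fun _ _ => 0)).
  by split=> [[]//|y]; exact: rV0_eq.
- by split=> *; exact: rV0_eq.
apply: linearization_isoI.
- by split=> *; exact: rV0_eq.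
- by move=> y; exists [::]; exact: rV0_eq.
move=> W g [gD gZ]; exists (fun=> 0).
split=> [c x y|x]; first by rewrite scaler0 addr0.
have := gD 0 0; rewrite addr0 (rV0_eq x 0) => /eqP.
by rewrite -subr_eq subrr => /eqP.
Qed.

Lemma rV0_pure (EA : set E) (zE : int -> E) d alpha :
  EA 0 -> is_pure EA zE d (id : Z -> Z) alpha.
Proof.
move=> EA0; exists `|denq alpha|%N, (numq alpha), setT; split.
- by rewrite absz_gt0 denq_neq0.
- by rewrite numqE mulrC -[in RHS]absz_denq pmulrn.
- split; last by move=> y; exists 0%N.
  split; first by split.
  exists 0%N, (fun=> 0), (fun _ _ => 0); split=> // [[] //|y _].
  exact: rV0_eq.
apply/seteqP; split=> y _; first by exists 0 => //; exact: rV0_eq.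
by exists 0%N, (fun=> 0), (fun=> 0); split=> [[]|[]|] //; exact: rV0_eq.
Qed.

Lemma rV0_rank : has_rank Z 0.
Proof.
move=> P [_ P1 _]; exists (fun=> 0); split=> [y|c _].
  by exists 1, (fun=> 0); split=> //; exact: rV0_eq.
by exists 1; split=> // -[].
Qed.

End ZeroModule.

Section SubringRank.
Variables (T : comNzRingType) (S : set T).

Definition subr_pred (_ : S 1) (_ : forall x y, S x -> S y -> S (x - y))
  (_ : forall x y, S x -> S y -> S (x * y)) : {pred T} := fun x => `[< S x >].

Hypotheses (S1 : S 1) (SB : forall x y, S x -> S y -> S (x - y))
  (SM : forall x y, S x -> S y -> S (x * y)).

Lemma subr_closed : subring_closed (subr_pred S1 SB SM).
Proof.
split=> [|x y /asboolP hx /asboolP hy|x y /asboolP hx /asboolP hy]; apply/asboolP.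
- exact: S1.
- exact: SB.
- exact: SM.
Qed.

HB.instance Definition _ := GRing.isSubringClosed.Build T (subr_pred S1 SB SM) subr_closed.

Record subr := SubR { subr_val :> T; _ : subr_val \in subr_pred S1 SB SM }.

HB.instance Definition _ := [isSub for subr_val].
HB.instance Definition _ := [Choice of subr by <:].
HB.instance Definition _ := [SubChoice_isSubComNzRing of subr by <:].

Lemma subrP (x : subr) : S (val x).
Proof. by have /asboolP := valP x. Qed.

Lemma to_subr_proof x : S x -> x \in subr_pred S1 SB SM.
Proof. by move=> Sx; apply/asboolP. Qed.

Variables (k1 k2 : fieldType) (ev : {rmorphism T -> k1}) (f : T -> k2).
Hypotheses (f1 : f 1 = 1) (fB : forall x y, S x -> S y -> f (x - y) = f x - f y)
  (fM : forall x y, S x -> S y -> f (x * y) = f x * f y).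

Definition subr_map (x : subr) : k2 := f (val x).

Lemma subr_map_zmod : zmod_morphism subr_map.
Proof. by move=> x y; apply: fB; exact: subrP. Qed.

Lemma subr_map_monoid : monoid_morphism subr_map.
Proof. by split=> [|x y]; [exact: f1|apply: fM; exact: subrP]. Qed.

HB.instance Definition _ := GRing.isZmodMorphism.Build subr k2 subr_map subr_map_zmod.
HB.instance Definition _ := GRing.isMonoidMorphism.Build subr k2 subr_map subr_map_monoid.

(** Needed for the characters, which are multiplicative only on the integral part: the rank
    comparison takes place over the subring [S] that contains the entries of [M]. *)
Lemma rank_map_idem_on n (M : 'M[T]_n) : M *m M = M -> (forall k l, S (M k l)) ->
  (forall x, S x -> ev x = 0 -> f x = 0) ->
  \rank (map_mx f M) = \rank (map_mx ev M).
Proof.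
move=> MM hM ker12.
pose M' : 'M[subr]_n := \matrix_(k, l) SubR (to_subr_proof (hM k l)).
have MM' : M' *m M' = M'.
  apply/matrixP => k l; apply: val_inj; rewrite [LHS](_ : _ = (M *m M) k l).
    by rewrite MM !mxE.
  rewrite !mxE (big_morph (val : subr -> T) (fun _ _ => erefl) erefl).
  by apply: eq_bigr => a _; rewrite !mxE.
have -> : map_mx f M = map_mx subr_map M'.
  by apply/matrixP => k l; rewrite !mxE.
have -> : map_mx ev M = map_mx (ev \o (val : subr -> T)) M'.
  by apply/matrixP => k l; rewrite !mxE.
apply: rank_map_idem => // x /= h0; apply: ker12 => //; exact: subrP.
Qed.

End SubringRank.

Lemma mem_tail (T : eqType) (x : T) (s : seq T) z : z \in s -> z \in x :: s.
Proof. by rewrite inE orbC => ->. Qed.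

(** * The isocrystal of a motive *)

Section Motive.
Variables (Fq : finFieldType) (Fp : fieldType) (iFq : {rmorphism Fq -> Fp}) (w : Fp -> int).
Variables (R : idomainType) (iR : {rmorphism Fq -> R}).
Variables (R' : comNzRingType) (iR' : {rmorphism Fq -> R'}) (rho : {rmorphism R -> R'}).
Variables (K : fieldType) (kap : {rmorphism R' -> K}).
Variables (A : comNzRingType) (kA : {rmorphism Fq -> A}) (ia : {rmorphism A -> Fp}) (p : A).
Variables (chi : {rmorphism A -> R}) (d : nat) (b : 'I_d -> A).
Local Notation q := #|Fq|.
Hypothesis LD : local_data iFq w iR iR' rho kap kA ia p chi b.
Let wP := ld_place LD.
Variables (E : comNzRingType) (i : {rmorphism Fp -> E}) (j : {rmorphism R' -> E}).
Variable U : nat -> set E.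
Hypothesis EC : is_ctensor iFq w iR' i j U.
Variables (sigma : {rmorphism E -> E}) (X : nat -> E -> R') (e : nat -> E).
Hypothesis sigma_frob : is_frobenius q i j U sigma.
Hypothesis CD : comp_data Fq rho ia chi d i j U sigma X e.
Local Notation pe := (i (ia p)).
Local Notation iA := (i \o ia).
Local Notation T := (twpoly iR).
Local Notation cst := (twconst iR).
Local Notation ttau := (twtau iR).
Variables (phi : {rmorphism A -> T}) (m h : nat) (ep : nat -> A).
Variables (N : lmodType E) (u : T -> N) (tau : N -> N).

(** The motive seen from [p] instead of [a_wp]. The elements [ep k] suppress the zeros of [p] other
    than [wp], [md_low] and [md_low_unit] express the height through [phi p], and [md_denom] says
    that elements of [R'] have denominators in [R]. *)
Record motive_data : Prop := MotiveData {
  md_const : forall c, phi (kA c) = cst (iR c);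
  md_chi : forall a, tcoef (phi a) 0 = chi a;
  md_size : size (phi p : {poly R}) = m.+1;
  md_lead : lead_coef (phi p : {poly R}) \is a GRing.unit;
  md_ep_val : forall k, val_ge w k%:Z (ia (1 - ep k));
  md_ep_div : forall n k a, (n <= k)%N -> val_ge w n%:Z (ia a) ->
    exists a', ep k * a = p ^+ n * a';
  md_h : (0 < h)%N;
  md_low : low_ge (h * d) (phi p);
  md_low_unit : exists xi, rho (tcoef (phi p) (h * d)) * xi = 1;
  md_denom : forall xi, exists x y, x != 0 /\ rho x * xi = rho y;
  md_base : is_base_change (fun s : A * R => iA s.1 * j (rho s.2))
    (fun s m => cst s.2 * m * phi s.1) u;
  md_tau : semilinear_map sigma (fun e (x : N) => e *: x) tau;
  md_tau_u : forall m, tau (u m) = u (ttau * m)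
}.

Hypothesis MD : motive_data.

Local Notation dig := (digit (md_size MD) (md_lead MD)).

Let UM := U_M EC.
Let Ui a : U 0 (iA a). Proof. exact (U_iA LD EC a). Qed.
Let Uj xi : U 0 (j xi). Proof. exact: (U_j LD EC xi). Qed.
Let U1 : U 0 1. Proof. exact: (U_1 LD EC). Qed.
Let U00 n : U n 0. Proof. exact: (ctensor0 EC n). Qed.
Let UB n x y : U n x -> U n y -> U n (x - y). Proof. exact: (ctensorB EC). Qed.
Let UDD n x y : U n x -> U n y -> U n (x + y). Proof. exact: (UD EC). Qed.
Let Usum := U_sum EC.
Let Ule := U_le EC.
Let UMM := ctensorM EC.
Let Upe n : U n (pe ^+ n). Proof. exact: (U_pe LD EC n). Qed.
Let Upe1 : U 1 pe. Proof. by have := Upe 1; rewrite expr1. Qed.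
Let Ue s : U 0 (e s). Proof. exact: (cde_int CD s). Qed.

Lemma ep_diff n k k' : (n <= k)%N -> (n <= k')%N -> exists c, ep k - ep k' = p ^+ n * c.
Proof.
move=> nk nk'.
have hv l : (n <= l)%N -> val_ge w n%:Z (ia (1 - ep l)).
  by move=> nl; apply: val_geW (md_ep_val MD l); lia.
have [c hc] := md_ep_div MD nk (hv _ nk').
have [c' hc'] := md_ep_div MD nk' (hv _ nk).
by exists (c - c'); rewrite mulrBr -hc -hc'; ring.
Qed.

Lemma cst_central c f : f * cst (iR c) = cst (iR c) * f.
Proof.
apply: twpolyP => k; rewrite tcoef_cstM tcoefM (bigD1 ord_max) //= subnn.
rewrite [tcoef _ 0]coefC /= -rmorphXn.
have -> : c ^+ (q ^ k) = c.
  by elim: k => [|k IH]; rewrite ?expr1 // expnSr exprM IH expf_card.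
rewrite big1 ?addr0 1?mulrC // => l lk.
rewrite [tcoef (cst _) _]coefC subn_eq0 leqNgt.
have -> : (l < k)%N by have := ltn_ord l; rewrite ltnS leq_eqVlt => /predU1P[e'|//]; case/eqP: lk; apply: val_inj.
by rewrite /= (twfrob0 Fq) mulr0.
Qed.

Lemma low_ge_divr n (f g : T) : low_ge n (f * g) -> tcoef g 0 != 0 -> low_ge n f.
Proof.
move=> hfg g0 k; elim/ltn_ind: k => k IH kn.
have fk : low_ge k f by move=> l lk; apply: IH => //; exact: ltn_trans kn.
have gl : low_ge 0 g by [].
have [_] := low_geM fk gl; rewrite addn0 hfg // => /esym/eqP.
by rewrite mulf_eq0 => /orP[/eqP //|]; rewrite expf_eq0 (negbTE g0) andbF.
Qed.

Lemma ep_chi k : (0 < k)%N -> chi (ep k) = 1.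
Proof.
move=> k0; have /(ld_chi LD) : val_ge w 1 (ia (1 - ep k)).
  by apply: val_geW (md_ep_val MD k); lia.
by rewrite rmorphB rmorph1 => /eqP; rewrite subr_eq0 eq_sym => /eqP.
Qed.

(** Multiplication by [ep k.+1] makes [a] divisible by [p ^+ k.+1] and does not change the order in
    [tau], because the constant coefficient of [phi (ep k.+1)] is [1]. *)
Lemma low_ge_phi a k : val_ge w k%:Z (ia a) -> low_ge (k * (h * d)) (phi a).
Proof.
case: k => [|k] ha //; have [a' ha'] := md_ep_div MD (leqnn _) ha.
apply: (@low_ge_divr _ _ (phi (ep k.+1))); last by rewrite (md_chi MD) ep_chi ?oner_neq0.
rewrite -rmorphM mulrC ha' mulrC rmorphM rmorphXn; apply: low_ge_add_l.
by have [] := low_geX k.+1 (md_low MD).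
Qed.

(** Sums of tensors from [A] and [R'] are dense in [U 0], so identities between functionals need to
    be checked only on such tensors. *)
Lemma dens_eq (W : zmodType) n (L1 L2 : E -> W) :
  (forall x y, L1 (x + y) = L1 x + L1 y) -> (forall x y, L2 (x + y) = L2 x + L2 y) ->
  (forall x, U n x -> L1 x = 0) -> (forall x, U n x -> L2 x = 0) ->
  (forall a xi, L1 (iA a * j xi) = L2 (iA a * j xi)) ->
  forall y, U 0 y -> L1 y = L2 y.
Proof.
move=> D1 D2 K1 K2 eqL y /(U0_dense LD EC n)[l hl].
have e1 := D1 (iAj ia i j l) (y - iAj ia i j l).
have e2 := D2 (iAj ia i j l) (y - iAj ia i j l).
rewrite addrC subrK (K1 _ hl) addr0 in e1; rewrite addrC subrK (K2 _ hl) addr0 in e2.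
rewrite e1 e2 /iAj.
have L10 : L1 0 = 0 by exact: K1.
have L20 : L2 0 = 0 by exact: K2.
rewrite (big_morph L1 D1 L10) (big_morph L2 D2 L20).
by apply: eq_bigr => x _.
Qed.

(** * Coordinates by division with remainder *)

Section Functional.
Variables (n : nat) (k : 'I_m) (f : T).

(** Without the factor [ep n.+1] the digit would be known to vanish only on multiples of
    [p ^+ n.+1]. With it the form vanishes on every [a] of valuation at least [n.+1], so that it
    extends to [E]. *)
Definition lam (a : A) : R := dig n k (f * phi (ep n.+1 * a)).

Lemma lam_lin c a a' : lam (kA c * a + a') = iR c * lam a + lam a'.
Proof.
rewrite /lam mulrDr rmorphD mulrDr digitD; congr (_ + _).
by rewrite -digitZ mulrCA [phi (kA c * _)]rmorphM (md_const MD) !mulrA cst_central.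
Qed.

Lemma lam_ker a : val_ge w n.+1%:Z (ia a) -> lam a = 0.
Proof.
move=> /(md_ep_div MD (leqnn _))[a' ha']; rewrite /lam ha' mulrC rmorphM mulrA rmorphXn.
by rewrite digit_mulX.
Qed.

Definition G : E -> R' := projT1 (cid (extend_functional LD EC lam_lin lam_ker)).

Lemma GP : [/\ forall x y, G (x + y) = G x + G y, forall x, U n.+1 x -> G x = 0 &
  forall a xi, G (iA a * j xi) = rho (lam a) * xi].
Proof. by rewrite /G; case: cid. Qed.

End Functional.

Lemma GD n k f x y : G n k f (x + y) = G n k f x + G n k f y.
Proof. by have [] := GP n k f. Qed.
Lemma GU n k f x : U n.+1 x -> G n k f x = 0.
Proof. by have [_ + _] := GP n k f; apply. Qed.
Lemma GE n k f a xi : G n k f (iA a * j xi) = rho (lam n k f a) * xi.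
Proof. by have [] := GP n k f. Qed.

Lemma G0 n k f : G n k f 0 = 0. Proof. exact: GU. Qed.

Lemma G_iAj n k f l : G n k f (iAj ia i j l) = \sum_(x <- l) rho (lam n k f x.1) * x.2.
Proof.
rewrite /iAj (big_morph _ (GD n k f) (G0 n k f)).
by apply: eq_bigr => x _; rewrite GE.
Qed.

Lemma G_cst n k r f y : U 0 y -> G n k (cst r * f) y = rho r * G n k f y.
Proof.
apply: (@dens_eq _ n.+1 _ (fun y => rho r * G n k f y)).
- exact: GD.
- by move=> x z; rewrite GD mulrDr.
- exact: GU.
- by move=> x hx; rewrite GU ?mulr0.
- by move=> a xi; rewrite !GE /lam -[cst r * f * _]mulrA digitZ [rho (r * _)]rmorphM mulrA.
Qed.

Lemma G_add n k f g y : U 0 y -> G n k (f + g) y = G n k f y + G n k g y.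
Proof.
apply: (@dens_eq _ n.+1 _ (fun y => G n k f y + G n k g y)).
- exact: GD.
- by move=> x z; rewrite !GD addrACA.
- exact: GU.
- by move=> x hx; rewrite !GU ?addr0.
- by move=> a xi; rewrite !GE /lam mulrDl digitD rmorphD mulrDl.
Qed.

Lemma G_phi n k f a y : U 0 y -> G n k (f * phi a) y = G n k f (iA a * y).
Proof.
apply: (@dens_eq _ n.+1 _ (fun y => G n k f (iA a * y))).
- exact: GD.
- by move=> x z; rewrite mulrDr GD.
- exact: GU.
- by move=> x hx; rewrite GU //; exact: UM.
- move=> a' xi; have -> : iA a * (iA a' * j xi) = iA (a * a') * j xi.
    by rewrite /= !rmorphM mulrA.
  by rewrite !GE /lam -mulrA -rmorphM mulrCA.
Qed.

Lemma G_j n k f xi y : U 0 y -> G n k f (j xi * y) = xi * G n k f y.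
Proof.
apply: (@dens_eq _ n.+1 (fun y => G n k f (j xi * y)) (fun y => xi * G n k f y)).
- by move=> x z; rewrite mulrDr GD.
- by move=> x z; rewrite GD mulrDr.
- by move=> x hx; rewrite GU //; exact: UM.
- by move=> x hx; rewrite GU ?mulr0.
- move=> a xi'; have -> : j xi * (iA a * j xi') = iA a * j (xi * xi').
    by rewrite rmorphM mulrCA.
  by rewrite !GE mulrCA.
Qed.

(** Two sufficiently late elements [ep] differ by a multiple of [p ^+ n.+1], which the digit of
    index [n] does not see. *)
Lemma lam_ep n k f a k' : (n < k')%N -> lam n k f a = dig n k (f * phi (ep k' * a)).
Proof.
move=> nk'; have [c hc] := ep_diff (leqnn n.+1) nk'.
rewrite /lam -[ep n.+1](subrK (ep k')) hc mulrDl rmorphD mulrDr digitD.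
have -> : p ^+ n.+1 * c * a = (c * a) * p ^+ n.+1 by ring.
by rewrite rmorphM rmorphXn mulrA digit_mulX // add0r.
Qed.

Lemma G_pS n k f y : U 0 y -> G n.+1 k f (pe * y) = G n k f y.
Proof.
apply: (@dens_eq _ n.+1 (fun y => G n.+1 k f (pe * y))).
- by move=> x z; rewrite mulrDr GD.
- exact: GD.
- by move=> x hx; rewrite GU // -[n.+2]add1n; exact: (UMM Upe1 hx).
- exact: GU.
- move=> a xi; have -> : pe * (iA a * j xi) = iA (p * a) * j xi.
    by rewrite /= rmorphM rmorphM mulrA.
  rewrite !GE; congr (rho _ * _); rewrite (lam_ep _ _ _ (leqnSn n.+1)) /lam.
  have -> : ep n.+2 * (p * a) = ep n.+2 * a * p by ring.
  by rewrite [phi (_ * p)]rmorphM mulrA digitS.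
Qed.

Lemma G_p0 k f y : U 0 y -> G 0 k f (pe * y) = 0.
Proof. by move=> hy; rewrite GU // -[1%N]addn0; exact: UMM. Qed.

Local Notation SER := (ser LD EC).

(** The component [s] of the [k]-th coordinate of [y *: u f]: there an element is a power series in
    [pe] over [R'], and its coefficients are the digits [G n]. *)
Definition compH (s : nat) (k : 'I_m) f y := e s * SER (fun n => G n k f (e s * y)).

Lemma compH_int s k f y : U 0 (compH s k f y).
Proof. by apply: UM => //; exact: ser_int. Qed.

Lemma compHD s k f x y : compH s k f (x + y) = compH s k f x + compH s k f y.
Proof.
rewrite /compH -mulrDr -serD; congr (_ * SER _); apply/funext => n.
by rewrite mulrDr GD.
Qed.

Lemma compH0 s k f : compH s k f 0 = 0.
Proof. by have := compHD s k f 0 0; rewrite addr0 => /eqP; rewrite -subr_eq subrr eq_sym => /eqP. Qed.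

Lemma ser0 : SER (fun=> 0) = 0.
Proof. by apply/esym/ser_eq => n; rewrite big1 ?subr0 // => l _; rewrite rmorph0 mulr0. Qed.

Lemma compHU s k f n y : U n y -> U n (compH s k f y).
Proof.
move=> hy; apply: UM => //; rewrite -[SER _]subr0 -ser0; apply: ser_congr => l ln.
by apply: GU; apply: UM => //; exact: Ule hy.
Qed.

Lemma compH_p s k f y : U 0 y -> compH s k f (pe * y) = pe * compH s k f y.
Proof.
move=> hy; rewrite /compH [RHS]mulrCA; congr (_ * _); apply: ser_shift => [|n].
  by rewrite mulrCA G_p0 //; exact: UM.
by rewrite mulrCA G_pS //; exact: UM.
Qed.

Lemma compH_j s k f xi y : U 0 y -> compH s k f (j xi * y) = j xi * compH s k f y.
Proof.
move=> hy; rewrite /compH [RHS]mulrCA -serZ; congr (_ * SER _); apply/funext => n.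
by rewrite mulrCA G_j //; exact: UM.
Qed.

Lemma compHe s k f y : compH s k f (e s * y) = compH s k f y.
Proof.
by rewrite /compH; congr (_ * SER _); apply/funext => n; rewrite mulrA (cde_idem CD).
Qed.

(** Compatibility with [j] and with [pe] gives linearity for truncated power series in [pe]. These
    approximate [y] in the component, and [compH] is continuous. *)
Lemma compH_lin s k f y : U 0 y -> compH s k f y = y * compH s k f 1.
Proof.
move=> hy; apply/eqP; rewrite -subr_eq0; apply/eqP; apply: (U_sep EC) => n.
have [dl hdl] := comp_digits LD EC CD s n hy.
set S := \sum_(l < n) _ in hdl.
have HS : compH s k f S = S * compH s k f 1.
  have D := compHD s k f; rewrite /S (big_morph _ D (compH0 s k f)) mulr_suml.
  apply: eq_bigr => l _; move: (dl l) => xi; elim: (l : nat) => [|l' IH].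
    by rewrite mul1r -[j xi in LHS]mulr1 compH_j.
  have hu : U 0 (pe ^+ l' * j xi) by apply: UM => //; exact: (Ule (leq0n l') (Upe l')).
  by rewrite exprS -[pe * _ * j _]mulrA compH_p // IH mulrA.
have -> : compH s k f y - y * compH s k f 1 =
   compH s k f (e s * (y - S)) - (e s * (y - S)) * compH s k f 1.
  have e1 : compH s k f y = compH s k f (y - S) + compH s k f S.
    by rewrite -compHD subrK.
  rewrite compHe e1 HS.
  have ec : e s * compH s k f 1 = compH s k f 1 by rewrite /compH mulrA (cde_idem CD).
  have -> : e s * (y - S) * compH s k f 1 = (y - S) * (e s * compH s k f 1) by ring.
  by rewrite ec; ring.
apply: UB; first exact: compHU.
by rewrite mulrC; apply: UM => //; exact: compH_int.
Qed.

Definition coordH (k : 'I_m) f y := \sum_(s < d) compH s k f y.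
Definition coord k f := coordH k f 1.

Lemma coordH_lin k f y : U 0 y -> coordH k f y = y * coord k f.
Proof.
by move=> hy; rewrite /coord /coordH mulr_sumr; apply: eq_bigr => s _; exact: compH_lin.
Qed.

Lemma coord_int k f : U 0 (coord k f).
Proof. by apply: Usum => s _; exact: compH_int. Qed.

Lemma coordD k f g : coord k (f + g) = coord k f + coord k g.
Proof.
rewrite /coord /coordH -big_split /=; apply: eq_bigr => s _.
rewrite /compH -mulrDr -serD; congr (_ * SER _); apply/funext => n.
by rewrite G_add //; exact: UM.
Qed.

Lemma coord_act k a r f : coord k (cst r * f * phi a) = iA a * j (rho r) * coord k f.
Proof.
rewrite mulrAC -coordH_lin // /coord /coordH mulr_suml; apply: eq_bigr => s _.
have -> : compH s k f (iA a) * j (rho r) = e s * (j (rho r) * SER (fun n => G n k f (e s * iA a))).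
  by rewrite /compH; ring.
rewrite -serZ /compH; congr (_ * SER _); apply/funext => n.
by rewrite mulr1 G_phi // G_cst ?[iA a * _]mulrC //; exact: UM.
Qed.

(** * The lattice spanned by the powers of [tau] *)

Let uD f g : u (f + g) = u f + u g. Proof. by have [[]] := md_base MD. Qed.
Let u_act a r f : u (cst r * f * phi a) = (iA a * j (rho r)) *: u f.
Proof. by have [[_ hu] _] := md_base MD; have := hu (a, r) f. Qed.
Let u0 : u 0 = 0.
Proof. by have := uD 0 0; rewrite addr0 => /eqP; rewrite -subr_eq subrr eq_sym => /eqP. Qed.
Let u_sum (I : Type) (r : seq I) (P : pred I) (F : I -> T) :
  u (\sum_(x <- r | P x) F x) = \sum_(x <- r | P x) u (F x).
Proof. exact: (big_morph u uD u0). Qed.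
Let u_phi a f : u (f * phi a) = iA a *: u f.
Proof.
have <- : cst 1 * f = f by exact: mul1r.
by rewrite u_act !rmorph1 mulr1 [cst 1 * f]mul1r.
Qed.
Let u_cst r f : u (cst r * f) = j (rho r) *: u f.
Proof. by rewrite -[cst r * f]mulr1 -(rmorph1 phi) u_act rmorph1 mul1r. Qed.

Definition Lat (n : nat) : set N :=
  [set y | exists c : 'I_m -> E, (forall k, U n (c k)) /\ y = \sum_k c k *: u (ttau ^+ k)].

Lemma LatD n x y : Lat n x -> Lat n y -> Lat n (x + y).
Proof.
move=> [c [hc ->]] [c' [hc' ->]]; exists (fun k => c k + c' k); split=> [k|].
  exact: UDD.
by rewrite -big_split /=; apply: eq_bigr => k _; rewrite scalerDl.
Qed.

Lemma LatZ n n' a y : U n a -> Lat n' y -> Lat (n + n') (a *: y).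
Proof.
move=> ha [c [hc ->]]; exists (fun k => a * c k); split=> [k|]; first exact: UMM.
by rewrite scaler_sumr; apply: eq_bigr => k _; rewrite scalerA.
Qed.

Lemma LatN n y : Lat n y -> Lat n (- y).
Proof.
by move=> hy; rewrite -scaleN1r -[n]add0n; apply: LatZ => //; rewrite -sub0r; exact: UB.
Qed.

Lemma LatB n x y : Lat n x -> Lat n y -> Lat n (x - y).
Proof. by move=> hx hy; apply: LatD => //; exact: LatN. Qed.

Lemma Lat0 n : Lat n 0.
Proof. by exists (fun=> 0); split=> //; rewrite big1 // => k _; rewrite scale0r. Qed.

Lemma Lat_sum n (I : Type) (r : seq I) (P : pred I) (F : I -> N) :
  (forall x, P x -> Lat n (F x)) -> Lat n (\sum_(x <- r | P x) F x).
Proof. by move=> hF; apply: big_ind => //; [exact: Lat0|move=> *; exact: LatD]. Qed.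

Lemma Lat_tau (k : 'I_m) : Lat 0 (u (ttau ^+ k)).
Proof.
exists (fun l => (l == k)%:R); split=> [l|]; first by case: (_ == _).
rewrite (bigD1 k) //= eqxx scale1r big1 ?addr0 // => l /negbTE ->.
by rewrite scale0r.
Qed.

Lemma m_gt0 : (0 < m)%N.
Proof.
have hd0 : (0 < h * d)%N by rewrite muln_gt0 (md_h MD) (cd_d CD).
have [xi hxi] := md_low_unit MD; rewrite lt0n; apply/eqP => m0.
move: hxi; rewrite [tcoef _ _]nth_default; last by rewrite (md_size MD) m0.
by rewrite rmorph0 mul0r => /esym/eqP; rewrite oner_eq0.
Qed.

Lemma u_expand n f : u f =
  \sum_(k < m) (\sum_(l < n) pe ^+ l * j (rho (dig l k f))) *: u (ttau ^+ k) +
  pe ^+ n *: u (iter n (tquo (md_size MD) (md_lead MD)) f).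
Proof.
rewrite {1}(digit_expand (md_size MD) (md_lead MD) n f) uD -!rmorphXn u_phi; congr (_ + _).
rewrite u_sum; under [RHS]eq_bigr => k _ do rewrite scaler_suml.
rewrite [RHS]exchange_big /=; apply: eq_bigr => l _; rewrite u_sum; apply: eq_bigr => k _.
by rewrite -(rmorphXn phi) u_act /= !rmorphXn.
Qed.

Lemma Lat_u f : Lat 0 (u f).
Proof.
rewrite (u_expand (size (f : {poly R})) f).
rewrite (iter_tquo_eq0 (md_size MD) (md_lead MD)) ?m_gt0 // u0 scaler0 addr0.
apply: Lat_sum => k _; rewrite -[X in Lat X _]addn0; apply: LatZ; last exact: Lat_tau.
by apply: Usum => l _; apply: (@Ule 0%N l) => //; rewrite -[X in U X]addn0; apply: UMM.
Qed.

Lemma U_1ep n : U n (1 - iA (ep n)).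
Proof.
rewrite -(rmorph1 iA) -rmorphB -[X in U n X]mulr1 -(rmorph1 j).
by apply: (ctensor_pure EC); exact: md_ep_val.
Qed.

(** Replacing [a] by [ep n * a] changes the element by a member of [Lat n]; after that the expansion
    to the base [phi p] has the digits [lam] up to [n]. *)
Lemma pure_approx n f a xi : Lat n ((iA a * j xi) *: u f -
  \sum_k (\sum_(l < n) pe ^+ l * j (rho (lam l k f a) * xi)) *: u (ttau ^+ k)).
Proof.
set g := f * phi (ep n * a).
set r := iter n (tquo (md_size MD) (md_lead MD)) g.
have eg : j xi *: u g = \sum_k (\sum_(l < n) pe ^+ l * j (rho (lam l k f a) * xi)) *: u (ttau ^+ k)
    + j xi *: (pe ^+ n *: u r).
  rewrite {1}(u_expand n g) scalerDr; congr (_ + _).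
  rewrite scaler_sumr; apply: eq_bigr => k _; rewrite scalerA mulr_sumr; congr (_ *: _).
  apply: eq_bigr => l _; rewrite (@lam_ep _ _ _ _ n) // -/g rmorphM; ring.
have -> : (iA a * j xi) *: u f = ((1 - iA (ep n)) * (iA a * j xi)) *: u f + j xi *: u g.
  rewrite /g u_phi scalerA -scalerDl; congr (_ *: _); rewrite /= !rmorphM; ring.
rewrite eg addrA addrAC addrK; apply: LatD.
  rewrite -[X in Lat X _]addn0; apply: LatZ; last exact: Lat_u.
  by rewrite mulrC; apply: UM; [exact: UM|exact: U_1ep].
rewrite -[X in Lat X _]add0n; apply: LatZ => //; rewrite -[X in Lat X _]addn0; apply: LatZ => //; exact: Lat_u.
Qed.

(** A congruence for every [n] is not yet an equality, since [N] is not known to be separated at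
    this point. *)
Lemma coord_approx n f : Lat n (u f - \sum_k coord k f *: u (ttau ^+ k)).
Proof.
have -> : u f - \sum_k coord k f *: u (ttau ^+ k) =
    \sum_(s < d) e s *: (e s *: u f - \sum_k SER (fun n => G n k f (e s)) *: u (ttau ^+ k)).
  under [RHS]eq_bigr => s _ do rewrite scalerBr scalerA (cde_idem CD).
  rewrite sumrB -scaler_suml (cde_sum CD) scale1r; congr (_ - _).
  under [RHS]eq_bigr => s _ do rewrite scaler_sumr.
  rewrite exchange_big /=; apply: eq_bigr => k _.
  rewrite /coord /coordH scaler_suml; apply: eq_bigr => s _.
  by rewrite scalerA /compH mulr1.
apply: Lat_sum => s _; rewrite -[X in Lat X _]add0n; apply: LatZ => //.
have [l hl] := U0_dense LD EC n (Ue s).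
pose S k := \sum_(a < n) pe ^+ a * j (G a k f (e s)).
have -> : e s *: u f - \sum_k SER (fun n => G n k f (e s)) *: u (ttau ^+ k) =
    (e s - iAj ia i j l) *: u f + (iAj ia i j l *: u f - \sum_k S k *: u (ttau ^+ k)) -
    \sum_k (SER (fun n => G n k f (e s)) - S k) *: u (ttau ^+ k).
  under [X in _ = _ - X]eq_bigr => k _ do rewrite scalerBl.
  by rewrite sumrB scalerBl addrA subrK opprB addrA subrK.
apply: LatB; last first.
  apply: Lat_sum => k _; rewrite -[X in Lat X _]addn0; apply: LatZ; last exact: Lat_tau.
  exact: ser_approx.
apply: LatD.
  by rewrite -[X in Lat X _]addn0; apply: LatZ => //; exact: Lat_u.
have -> : \sum_k S k *: u (ttau ^+ k) = \sum_(x <- l) \sum_k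
    (\sum_(a < n) pe ^+ a * j (rho (lam a k f x.1) * x.2)) *: u (ttau ^+ k).
  rewrite exchange_big /=; apply: eq_bigr => k _; rewrite -scaler_suml; congr (_ *: _).
  rewrite exchange_big /=; apply: eq_bigr => a _.
  rewrite -mulr_sumr -rmorph_sum -G_iAj; congr (_ * j _).
  by rewrite -[e s](subrK (iAj ia i j l)) GD GU ?add0r //; exact: Ule hl.
rewrite {1}/iAj scaler_suml -sumrB; apply: Lat_sum => x _; exact: pure_approx.
Qed.

Lemma coord_extend (k : 'I_m) : exists f : N -> E,
  (forall c x y, f (c *: x + y) = c * f x + f y) /\ (forall x, f (u x) = coord k x).
Proof.
have [_ univ] := md_base MD.
have [|f [[fL fu] _]] := univ E^o (coord k : T -> E^o).
  split; first exact: coordD.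
  by move=> [a r] x; exact: coord_act.
by exists f; split.
Qed.

Definition crd (k : 'I_m) : N -> E := projT1 (cid (coord_extend k)).

Lemma crdL k c x y : crd k (c *: x + y) = c * crd k x + crd k y.
Proof. by rewrite /crd; case: cid => f []. Qed.

Lemma crd_u k f : crd k (u f) = coord k f.
Proof. by rewrite /crd; case: cid => g []. Qed.

Lemma crd0 k : crd k 0 = 0.
Proof. by have := crdL k 1 0 0; rewrite scale1r mul1r addr0 => /eqP; rewrite -subr_eq subrr eq_sym => /eqP. Qed.

Lemma crd_sum k (I : finType) (c : I -> E) (x : I -> N) :
  crd k (\sum_l c l *: x l) = \sum_l c l * crd k (x l).
Proof. by apply: lin_sum => *; exact: crdL. Qed.

Lemma crd_Lat k n y : Lat n y -> U n (crd k y).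
Proof.
move=> [c [hc ->]]; rewrite crd_sum; apply: Usum => l _.
rewrite mulrC; apply: UM => //; rewrite crd_u; exact: coord_int.
Qed.

Let proj y := \sum_k crd k y *: u (ttau ^+ k).

Let projL c x y : proj (c *: x + y) = c *: proj x + proj y.
Proof.
rewrite /proj scaler_sumr -big_split; apply: eq_bigr => k _.
by rewrite crdL scalerDl scalerA.
Qed.

Let proj_sum (I : finType) (c : I -> E) (x : I -> N) :
  proj (\sum_l c l *: x l) = \sum_l c l *: proj (x l).
Proof.
have p0 : proj 0 = 0 by rewrite /proj big1 // => k _; rewrite crd0 scale0r.
apply: (big_ind2 (fun x y => proj x = y)) => // [x1 x2 y1 y2 e1 e2|l _].
  by have := projL 1 x1 y1; rewrite !scale1r e1 e2.
by have := projL (c l) (x l) 0; rewrite p0 !addr0.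
Qed.

(** The defects [z l] have zero coordinates, and each is a combination of the generators with
    coefficients in [U 1]. Subtracting the projection of this combination gives [z = C z], whence
    [z = 0] by [geometric_inverse]. *)
Let proj_tau k : proj (u (ttau ^+ (k : 'I_m))) = u (ttau ^+ k).
Proof.
pose z (l : 'I_m) := u (ttau ^+ l) - proj (u (ttau ^+ l)).
have zE l : z l = u (ttau ^+ l) - \sum_k coord k (ttau ^+ l) *: u (ttau ^+ k).
  by congr (_ - _); apply: eq_bigr => a _; rewrite crd_u.
have z_crd l a : crd a (z l) = 0.
  by apply: (U_sep EC) => n; apply: crd_Lat; rewrite zE; exact: coord_approx.
have pz l : proj (z l) = 0 by rewrite /proj big1 // => a _; rewrite z_crd scale0r.
have [C hC] := choice (fun l => let: h := coord_approx 1 (ttau ^+ (l : 'I_m)) in h).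
have zC l : z l = \sum_a C l a *: z a.
  have e1 : z l = \sum_a C l a *: u (ttau ^+ a) by rewrite zE; have [_ <-] := hC l.
  have e2 : \sum_a C l a *: proj (u (ttau ^+ a)) = 0 by rewrite -proj_sum -e1 pz.
  transitivity (\sum_a C l a *: u (ttau ^+ a) - \sum_a C l a *: proj (u (ttau ^+ a))).
    by rewrite e2 subr0.
  by rewrite -sumrB; apply: eq_bigr => a _; rewrite scalerBr.
have [|V [VC _]] := geometric_inverse LD EC (C := \matrix_(l, a) C l a).
  by move=> l a; rewrite mxE; have [] := hC l.
suff zk : z k = 0 by apply/eqP; rewrite eq_sym -subr_eq0 -[X in X == _]/(z k) zk.
have -> : z k = \sum_l (1%:M : 'M[E]_m) k l *: z l.
  rewrite (bigD1 k) //= mxE eqxx scale1r big1 ?addr0 // => l lk.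
  by rewrite mxE eq_sym (negbTE lk) scale0r.
rewrite -VC.
transitivity (\sum_a V k a *: (z a - \sum_l C a l *: z l)).
  under [LHS]eq_bigr => l _ do rewrite mxE scaler_suml.
  rewrite exchange_big /=; apply: eq_bigr => a _.
  under [LHS]eq_bigr => l _ do rewrite -scalerA.
  rewrite -scaler_sumr; congr (_ *: _).
  under [LHS]eq_bigr => l _ do rewrite !mxE scalerBl.
  rewrite sumrB; congr (_ - _); rewrite (bigD1 a) //= eqxx scale1r big1 ?addr0 // => l la.
  by rewrite eq_sym (negbTE la) scale0r.
by rewrite big1 // => a _; rewrite -zC subrr scaler0.
Qed.

(** The identity and [proj] are linear and agree on the image of [u], which lies in the span of the
    [u (tau ^+ k)]. Uniqueness in the base change makes them equal. *)
Lemma crd_presents : presents (fun k : 'I_m => u (ttau ^+ k)) crd.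
Proof.
split=> [|y]; first exact: crdL.
have [_ univ] := md_base MD.
have [|f [_ uq]] := univ N u; first by case: (md_base MD).
have f1 : f = id by apply: uq; split=> // x; rewrite ?scale1r.
have f2 : f = proj.
  apply: uq; split=> [c x z|x]; first exact: projL.
  have [c [_ ->]] := Lat_u x.
  by rewrite proj_sum; apply: eq_bigr => k _; rewrite proj_tau.
by have := congr1 (fun g => g y) f1; rewrite f2.
Qed.

Lemma Lat_crd n y : Lat n y <-> forall k, U n (crd k y).
Proof.
split=> [hy k|hy]; first exact: crd_Lat.
by exists (fun k => crd k y); split=> //; have [_ /(_ y)] := crd_presents.
Qed.

Lemma Lat_exhaust y : exists c, Lat 0 (pe ^+ c *: y).
Proof.
have [c hc] := choice (fun k => U_exhaust LD EC (crd k y)).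
exists (\sum_k c k)%N; apply/Lat_crd => k.
have -> : crd k (pe ^+ (\sum_k c k) *: y) = pe ^+ (\sum_k c k) * crd k y.
  by have := crdL k (pe ^+ (\sum_k c k)) y 0; rewrite !addr0 crd0 addr0.
rewrite (bigD1 k) //= addnC exprD -mulrA; apply: UM => //.
exact: (Ule (leq0n _) (Upe _)).
Qed.

(* Elements of the motive that are divisible by a high power of the
   uniformizer in the lattice vanish to high order in [tau]. *)
Lemma detection n (l : seq (R' * T)) : Lat n (\sum_(x <- l) j x.1 *: u x.2) ->
  forall k, (k < n * (h * d))%N -> \sum_(x <- l) x.1 * rho (tcoef x.2 k) = 0.
Proof.
move=> hL.
(* The coordinates lie in [U n]; each component then has vanishing coefficients below [n], and
   summing over the components replaces [e s] by [1]. *)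
have dig0 a (k : 'I_m) : (a < n)%N ->
    \sum_(x <- l) x.1 * rho (dig a k (x.2 * phi (ep n))) = 0.
  move=> an.
  pose fs s n' : R' := \sum_(x <- l) x.1 * G n' k x.2 (e s).
  have h1 : U n (\sum_(s < d) e s * SER (fs s)).
    have -> : \sum_(s < d) e s * SER (fs s) = crd k (\sum_(x <- l) j x.1 *: u x.2).
      have -> : crd k (\sum_(x <- l) j x.1 *: u x.2) = \sum_(x <- l) j x.1 * coord k x.2.
        elim: l {hL fs} => [|x l IH]; first by rewrite !big_nil crd0.
        by rewrite !big_cons crdL IH crd_u.
      under [RHS]eq_bigr => x _ do rewrite /coord /coordH mulr_sumr.
      rewrite exchange_big /=; apply: eq_bigr => s _; rewrite /fs.
      transitivity (\sum_(x <- l) e s * SER (fun n' => x.1 * G n' k x.2 (e s))).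
        rewrite -mulr_sumr; congr (_ * _).
        elim: l {hL fs} => [|x l IH].
          by rewrite big_nil; under [fun n' => _]funext => n' do rewrite big_nil; exact: ser0.
        rewrite big_cons -IH -serD; congr SER; apply/funext => n'.
        by rewrite big_cons.
      by apply: eq_bigr => x _; rewrite serZ /compH mulr1 mulrCA.
    exact: crd_Lat.
  have h2 (s : 'I_d) : fs s a = 0.
    suff hs : U n (e s * SER (fs s)) by exact: (ser_comp_eq0 CD hs an).
    have -> : e s * SER (fs s) = e s * \sum_(t < d) e t * SER (fs t).
      rewrite mulr_sumr (bigD1 s) //= mulrA (cde_idem CD) big1 ?addr0 // => t ts.
      by rewrite mulrA (cde_orth CD) ?mul0r // !modn_small // eq_sym.
    exact: UM.
  have e1 : \sum_(s < d) fs s a = 0 by rewrite big1 // => s _; exact: h2.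
  rewrite -[RHS]e1 /fs exchange_big /=; apply: eq_bigr => x _; rewrite -mulr_sumr; congr (_ * _).
  rewrite -(big_morph _ (GD a k x.2) (G0 a k x.2)) (cde_sum CD).
  have -> : 1 = iA 1 * j 1 by rewrite !rmorph1 mulr1.
  by rewrite GE mulr1 (@lam_ep _ _ _ _ n) // mulr1.
(* A common denominator turns the combination with coefficients in [R'] into one twisted polynomial
   [f] over [R]. *)
have [x0 [r [x00 hr]]] : exists (x0 : R) (r : R' -> R), x0 != 0 /\
    forall x, x \in l -> rho x0 * x.1 = rho (r x.1).
  have [den hden] := choice (md_denom MD); have [num hnum] := choice hden.
  exists (\prod_(x <- l) den x.1).
  have : forall x, exists y, x \in [seq z.1 | z <- l] -> rho (\prod_(x <- l) den x.1) * x = rho y.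
    move=> x; have [/mapP[z zl ->]|] := boolP (x \in [seq z.1 | z <- l]); last by exists 0.
    exists (\prod_(x <- rem z l) den x.1 * num z.1) => _.
    by rewrite (big_rem z) //= !rmorphM mulrAC (proj2 (hnum z.1)) mulrC.
  move=> /choice[r hr]; exists r; split=> [|x xl]; last by apply: hr; exact: map_f.
  by rewrite prodf_seq_neq0; apply/allP => x _ /=; have [] := hnum x.1.
pose f : T := \sum_(x <- l) cst (r x.1) * x.2.
have fk k : rho (tcoef f k) = rho x0 * \sum_(x <- l) x.1 * rho (tcoef x.2 k).
  rewrite /f tcoef_sum rmorph_sum mulr_sumr; apply: eq_big_seq => x xl.
  by rewrite tcoef_cstM rmorphM -hr // mulrA.
have fdig a k : (a < n)%N -> dig a k (f * phi (ep n)) = 0.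
  move=> an; apply: (ld_rho_inj LD); rewrite rmorph0 -[RHS](mulr0 (rho x0)) -(dig0 a k an).
  rewrite /f mulr_suml digit_sum rmorph_sum mulr_sumr; apply: eq_big_seq => x xl.
  by rewrite -mulrA digitZ rmorphM -hr // mulrA.
have flow : low_ge (n * (h * d)) f.
  (* The first part is a left multiple of [phi p ^+ n] because its digits below [n] vanish; in the
     second, [1 - ep n] has valuation at least [n]. *)
  have -> : f = f * phi (ep n) + f * phi (1 - ep n).
    by rewrite -mulrDr -rmorphD addrC subrK rmorph1 mulr1.
  apply: low_geD; last by apply: low_ge_add_l; apply: low_ge_phi; exact: md_ep_val.
  rewrite (digit_eq0_dvd (fun a k an => fdig a k an)); apply: low_ge_add_l.
  by have [] := low_geX n (md_low MD).
move=> k kn; have := fk k; rewrite flow // rmorph0 => /esym/(R'_domain LD)[] // e0.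
by move: x00; rewrite -(inj_eq (ld_rho_inj LD)) rmorph0 e0 eqxx.
Qed.

(** * The [tau]-adic filtration and its graded pieces *)

Local Notation hd := (h * d)%N.

Let hd_gt0 : (0 < hd)%N. Proof. by rewrite muln_gt0 (md_h MD) (cd_d CD). Qed.

(* Filtration of the lattice by order of vanishing in [tau]: multiplication by
   the uniformizer raises the order by [h * d], and the slope [0] part is the
   intersection of all the [Fl k]. *)
Definition Fl (k : nat) : set N :=
  [set y | exists s : seq (E * T), (forall x, x \in s -> U 0 x.1 /\ low_ge k x.2) /\
     y = \sum_(x <- s) x.1 *: u x.2].

Lemma Fl_0 k : Fl k 0. Proof. by exists [::]; rewrite big_nil. Qed.

Lemma FlD k x y : Fl k x -> Fl k y -> Fl k (x + y).
Proof.
move=> [s [hs ->]] [s' [hs' ->]]; exists (s ++ s'); rewrite big_cat; split=> // z.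
by rewrite mem_cat => /orP[]; [exact: hs|exact: hs'].
Qed.

Lemma Fl_sum k (I : Type) (r : seq I) (P : pred I) (F : I -> N) :
  (forall x, P x -> Fl k (F x)) -> Fl k (\sum_(x <- r | P x) F x).
Proof. by move=> hF; apply: big_ind => //; [exact: Fl_0|move=> *; exact: FlD]. Qed.

Lemma Fl_sum_seq k (I : eqType) (r : seq I) (F : I -> N) :
  (forall x, x \in r -> Fl k (F x)) -> Fl k (\sum_(x <- r) F x).
Proof. by move=> hF; rewrite big_seq; apply: Fl_sum. Qed.

Lemma Fl_u k f : low_ge k f -> Fl k (u f).
Proof.
move=> hf; exists [:: (1, f)]; rewrite big_seq1 scale1r; split=> // x.
by rewrite inE => /eqP ->.
Qed.

Lemma Fl_le k k' y : (k <= k')%N -> Fl k' y -> Fl k y.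
Proof.
move=> kk' [s [hs ->]]; exists s; split=> // x /hs[h1 h2]; split=> // l lk.
by apply: h2; exact: leq_trans kk'.
Qed.

Lemma FlZ n k c y : U n c -> Fl k y -> Fl (k + n * hd) (c *: y).
Proof.
move=> /(U_div LD EC)[c' [hc' ->]] [s [hs ->]].
exists [seq (c' * x.1, x.2 * phi (p ^+ n)) | x <- s]; split.
  move=> _ /mapP[x /hs[h1 h2] ->]; split=> /=; first exact: UM.
  have hp : low_ge (n * hd) (phi (p ^+ n)).
    by rewrite rmorphXn; have [] := low_geX n (md_low MD).
  by have [] := low_geM h2 hp.
rewrite big_map scaler_sumr; apply: eq_bigr => x _ /=.
by rewrite u_phi !scalerA /= !rmorphXn; congr (_ *: _); ring.
Qed.

Lemma FlZ0 k c y : U 0 c -> Fl k y -> Fl k (c *: y).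
Proof. by move=> hc hy; have := FlZ hc hy; rewrite mul0n addn0. Qed.

Lemma FlN k y : Fl k y -> Fl k (- y).
Proof. by move=> hy; rewrite -scaleN1r; apply: FlZ0 => //; rewrite -sub0r; exact: UB. Qed.

Lemma FlB k x y : Fl k x -> Fl k y -> Fl k (x - y).
Proof. by move=> hx hy; apply: FlD => //; exact: FlN. Qed.

Lemma Lat_Fl n y : Lat n y -> Fl (n * hd) y.
Proof.
move=> [c [hc ->]]; apply: Fl_sum => k _; rewrite -[X in Fl X _]add0n; apply: FlZ => //.
exact: Fl_u.
Qed.

Lemma Fl_Lat k y : Fl k y -> Lat 0 y.
Proof.
move=> [s [hs ->]]; rewrite big_seq; apply: Lat_sum => x /hs[h1 _].
by rewrite -[X in Lat X _]addn0; apply: LatZ => //; exact: Lat_u.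
Qed.

Lemma Lat0_Fl y : Lat 0 y -> Fl 0 y.
Proof. by move/Lat_Fl; rewrite mul0n. Qed.

Lemma low_top k f : low_ge k f -> low_ge k.+1 (f - cst (tcoef f k) * ttau ^+ k).
Proof.
move=> hf l; rewrite ltnS tcoefD tcoefN tcoef_cstM tcoef_tauX leq_eqVlt => /predU1P[->|lk].
  by rewrite eqxx mulr1 subrr.
by rewrite hf // ltn_eqF // mulr0 subrr.
Qed.

Lemma low_tau k : low_ge k (ttau ^+ k : T).
Proof. by move=> l lk; rewrite tcoef_tauX ltn_eqF. Qed.

Let u_B f g : u (f - g) = u f - u g.
Proof.
have -> : f - g = f + cst (- 1) * g.
  by congr (_ + _); apply: twpolyP => l; rewrite tcoef_cstM tcoefN mulN1r.
by rewrite uD u_cst !rmorphN !rmorph1 scaleN1r.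
Qed.

(** The lowest term of [tau ^+ k * phi a] is [chi a ^+ (q ^ k) * tau ^+ k], so [U 0] acts on the
    [k]-th graded piece through the character [X k]. *)
Lemma Fl_residue_tau k y : U 0 y ->
  Fl k.+1 (y *: u (ttau ^+ k) - j (X k y) *: u (ttau ^+ k)).
Proof.
move=> hy; have [l hl hX] := X_approx LD EC (cdXD CD) (cdXU CD) hy.
have -> : y *: u (ttau ^+ k) - j (X k y) *: u (ttau ^+ k) =
    (y - iAj ia i j l) *: u (ttau ^+ k) + (iAj ia i j l *: u (ttau ^+ k) - j (X k y) *: u (ttau ^+ k)).
  by rewrite scalerBl addrA subrK.
apply: FlD.
  by apply: (@Fl_le _ (k + 1 * hd)); [lia|apply: FlZ => //; apply: Fl_u; exact: low_tau].
rewrite hX (X_iAj EC (cdXD CD) (cdXU CD) (cdXE CD)) rmorph_sum /iAj !scaler_suml -sumrB.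
apply: Fl_sum => x _.
have -> : (iA x.1 * j x.2) *: u (ttau ^+ k) - j (rho (chi x.1) ^+ (q ^ k) * x.2) *: u (ttau ^+ k) =
    j x.2 *: u (ttau ^+ k * phi x.1 - cst (chi x.1 ^+ (q ^ k)) * ttau ^+ k).
  by rewrite u_B u_phi u_cst scalerBr !scalerA -!rmorphXn -rmorphM ![_ * j _]mulrC [_ * x.2]mulrC rmorphM.
apply: FlZ0 => //; apply: Fl_u.
have -> : chi x.1 ^+ (q ^ k) = tcoef (ttau ^+ k * phi x.1) k.
  by rewrite tcoef_tauXM leqnn subnn (md_chi MD).
apply: low_top => a ak; by rewrite tcoef_tauXM leqNgt ak.
Qed.

(** Thus the [k]-th graded piece is generated by the class of [tau ^+ k] over [R']. *)
Lemma Fl_residue k y : Fl k y -> exists xi, Fl k.+1 (y - j xi *: u (ttau ^+ k)).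
Proof.
move=> [s [hs ->]]; elim: s hs => [|x s IH] hs.
  by exists 0; rewrite big_nil rmorph0 scale0r subrr; exact: Fl_0.
have [xi hxi] := IH (fun z hz => hs z (mem_tail x hz)).
have [h1 h2] := hs x (mem_head _ _).
exists (xi + X k x.1 * rho (tcoef x.2 k)); rewrite big_cons.
have -> : x.1 *: u x.2 + \sum_(z <- s) z.1 *: u z.2 - j (xi + X k x.1 * rho (tcoef x.2 k)) *: u (ttau ^+ k)
  = (\sum_(z <- s) z.1 *: u z.2 - j xi *: u (ttau ^+ k)) +
    (x.1 *: u (x.2 - cst (tcoef x.2 k) * ttau ^+ k) + j (rho (tcoef x.2 k)) *:
     (x.1 *: u (ttau ^+ k) - j (X k x.1) *: u (ttau ^+ k))).
  rewrite u_B u_cst scalerBr !scalerA [x.1 * j _]mulrC scalerBr !scalerA subrKA.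
  by rewrite rmorphD scalerDl rmorphM [j (X k _) * _]mulrC opprD [X in X + _ = _]addrC addrACA.
apply: FlD => //; apply: FlD; first by apply: FlZ0 => //; apply: Fl_u; exact: low_top.
by apply: FlZ0 => //; exact: Fl_residue_tau.
Qed.

(** Brings elements of the filtration into the form with coefficients in [R'] that [detection]
    requires. *)
Lemma Fl_approx k n y : Fl k y -> exists l : seq (R' * T),
  (forall x, x \in l -> low_ge k x.2) /\ Lat n (y - \sum_(x <- l) j x.1 *: u x.2).
Proof.
move=> [s [hs ->]]; elim: s hs => [|x s IH] hs.
  by exists [::]; split=> //; rewrite !big_nil subrr; exact: Lat0.
have [l [hl hL]] := IH (fun z hz => hs z (mem_tail x hz)).
have [h1 h2] := hs x (mem_head _ _).
have [t ht] := U0_dense LD EC n h1.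
exists ([seq (z.2, x.2 * phi z.1) | z <- t] ++ l); split.
  move=> z; rewrite mem_cat => /orP[/mapP[a _ ->]/=|/hl //].
  have : low_ge 0 (phi a.1) by [].
  by move=> /(low_geM h2)[]; rewrite addn0.
rewrite big_cons big_cat big_map /= opprD addrACA; apply: LatD => //.
have -> : \sum_(a <- t) j a.2 *: u (x.2 * phi a.1) = iAj ia i j t *: u x.2.
  by rewrite /iAj scaler_suml; apply: eq_bigr => a _; rewrite u_phi scalerA mulrC.
rewrite -scalerBl -[X in Lat X _]addn0; apply: LatZ => //; exact: Lat_u.
Qed.

Lemma Fl_detect k xi : Fl k.+1 (j xi *: u (ttau ^+ k)) -> xi = 0.
Proof.
(* Precision [k.+1] in the lattice controls the coefficient of [tau ^+ k] because [hd] is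
   positive. *)
move=> /(Fl_approx k.+1)[l [hl hL]].
have hs : Lat k.+1 (\sum_(x <- (xi, ttau ^+ k) :: [seq (- z.1, z.2) | z <- l]) j x.1 *: u x.2).
  rewrite big_cons big_map /=; under eq_bigr => x _ do rewrite rmorphN scaleNr.
  by rewrite sumrN.
have := detection hs (k := k); rewrite big_cons big_map tcoef_tauX eqxx rmorph1 mulr1.
rewrite big1_seq ?addr0; first by apply; nia.
by move=> x /andP[_ /hl hx]; rewrite hx ?rmorph0 ?mulr0.
Qed.

(** The lowest coefficient of [phi p] is a unit, so [pe] maps each graded piece isomorphically to
    the one [hd] steps further. The element [nu'] records the inverse. *)
Lemma pe_tau k n : exists nu nu', nu * nu' = 1 /\
  Fl (k + n * hd).+1 (pe ^+ n *: u (ttau ^+ k) - j nu *: u (ttau ^+ (k + n * hd))).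
Proof.
elim: n => [|n [nu [nu' [h1 IH]]]].
  exists 1, 1; rewrite mulr1 expr0 scale1r mul0n addn0 rmorph1 scale1r subrr; split=> //.
  exact: Fl_0.
have [xi hxi] := md_low_unit MD.
set c := tcoef (phi p) hd in hxi; set M0 := (k + n * hd)%N in IH *.
exists (nu * rho c ^+ (q ^ M0)), (nu' * xi ^+ (q ^ M0)); split.
  by rewrite mulrACA h1 mul1r -exprMn hxi expr1n.
have -> : (k + n.+1 * hd)%N = (M0 + hd)%N by rewrite /M0 mulSn; lia.
have -> : pe ^+ n.+1 *: u (ttau ^+ k) - j (nu * rho c ^+ (q ^ M0)) *: u (ttau ^+ (M0 + hd)) =
   pe *: (pe ^+ n *: u (ttau ^+ k) - j nu *: u (ttau ^+ M0)) +
   j nu *: u (ttau ^+ M0 * phi p - cst (c ^+ (q ^ M0)) * ttau ^+ (M0 + hd)).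
  by rewrite u_B u_phi u_cst !scalerBr !scalerA -exprS [_ * pe]mulrC subrKA rmorphM !rmorphXn.
apply: FlD.
  by have := FlZ Upe1 IH; apply: Fl_le; lia.
apply: FlZ0 => //; apply: Fl_u.
have := low_geM (@low_tau M0) (md_low MD); rewrite tcoef_tauX eqxx mul1r => -[h2 h3].
by rewrite /c -h3; exact: low_top.
Qed.

Lemma tau_pe k n : exists nu, Fl (k + n * hd).+1 (u (ttau ^+ (k + n * hd)) - (j nu * pe ^+ n) *: u (ttau ^+ k)).
Proof.
have [nu [nu' [h1 h2]]] := pe_tau k n; exists nu'.
have -> : u (ttau ^+ (k + n * hd)) - (j nu' * pe ^+ n) *: u (ttau ^+ k) =
   - (j nu' *: (pe ^+ n *: u (ttau ^+ k) - j nu *: u (ttau ^+ (k + n * hd)))).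
  by rewrite scalerBr !scalerA -rmorphM [nu' * _]mulrC h1 rmorph1 scale1r opprB.
by apply: FlN; apply: FlZ0.
Qed.

(** [U 0] acts on the class of [tau ^+ a] through component [a] modulo [d]. Hence [d] consecutive
    powers of [tau], one for each component, combine into a single basis vector over [E], and the
    first [h * d] powers give [h] vectors. *)
Definition yb (l : 'I_h) : N := \sum_(s < d) e s *: u (ttau ^+ (s + d * l)).

Lemma yb_comp (s : 'I_d) (l : 'I_h) : e s *: yb l = e s *: u (ttau ^+ (s + d * l)).
Proof.
rewrite /yb scaler_sumr (bigD1 s) //= scalerA (cde_idem CD) big1 ?addr0 // => t ts.
by rewrite scalerA (cde_orth CD) ?scale0r // !modn_small // eq_sym.
Qed.

Lemma Lat_yb l : Lat 0 (yb l).
Proof.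
apply: Lat_sum => s _; rewrite -[X in Lat X _]addn0; apply: LatZ => //; exact: Lat_u.
Qed.

Let comb (c : 'I_h -> E) : N := \sum_l c l *: yb l.

Let combB c c' : comb c - comb c' = comb (fun l => c l - c' l).
Proof. by rewrite /comb -sumrB; apply: eq_bigr => l _; rewrite scalerBl. Qed.

Let combZ a c : a *: comb c = comb (fun l => a * c l).
Proof. by rewrite /comb scaler_sumr; apply: eq_bigr => l _; rewrite scalerA. Qed.

Let comb_Lat n c : (forall l, U n (c l)) -> Lat n (comb c).
Proof.
by move=> hc; apply: Lat_sum => l _; rewrite -[X in Lat X _]addn0; apply: LatZ => //; exact: Lat_yb.
Qed.

Lemma Fl_step n a y : (a < hd)%N -> Fl (n * hd + a) y ->
  exists c, (forall l, U n (c l)) /\ Fl (n * hd + a).+1 (y - comb c).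
Proof.
move=> ah /Fl_residue[xi hxi]; have d0 := cd_d CD.
(* Division of [a] by [d] yields the component [s0] and the index [l0] of the basis vector. *)
have lh : (a %/ d < h)%N by rewrite ltn_divLR.
pose l0 := Ordinal lh; pose s0 := Ordinal (ltn_pmod a d0).
have aE : a = (s0 + d * l0)%N by rewrite /= addnC mulnC -divn_eq.
have [nu hnu] := tau_pe a n.
rewrite addnC in hxi *; set M0 := (a + n * hd)%N in hxi hnu *.
pose c0 := j xi * j nu * pe ^+ n.
have c0U : U n c0 by rewrite /c0; apply: UM => //; exact: UM.
exists (fun l => if l == l0 then c0 * e s0 else 0); split=> [l|].
  by case: (l == l0) => //; rewrite mulrC; apply: UM.
have -> : comb (fun l => if l == l0 then c0 * e s0 else 0) = c0 *: (e s0 *: u (ttau ^+ a)).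
  rewrite /comb (bigD1 l0) //= eqxx big1 ?addr0; last by move=> l /negbTE ->; rewrite scale0r.
  by rewrite -scalerA (yb_comp s0 l0) -aE.
have -> : y - c0 *: (e s0 *: u (ttau ^+ a)) = (y - j xi *: u (ttau ^+ M0)) +
  (j xi *: (u (ttau ^+ M0) - (j nu * pe ^+ n) *: u (ttau ^+ a)) -
   c0 *: (e s0 *: u (ttau ^+ a) - u (ttau ^+ a))).
  rewrite !scalerBr !scalerA mulrA -/c0 opprB addrA subrKA addrA subrK.
  by [].
apply: FlD => //; apply: FlB; first exact: FlZ0.
have -> : M0.+1 = (a.+1 + n * hd)%N by [].
apply: FlZ => //; have := @Fl_residue_tau a (e s0) (Ue s0).
by rewrite (cdXe CD) /= modn_mod eqxx rmorph1 scale1r.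
Qed.

Lemma Fl_block n y : Fl (n * hd) y ->
  exists c, (forall l, U n (c l)) /\ Fl (n.+1 * hd) (y - comb c).
Proof.
move=> hy; suff H a : (a <= hd)%N -> exists c, (forall l, U n (c l)) /\ Fl (n * hd + a) (y - comb c).
  by rewrite mulSnr; exact: H.
elim: a => [|a IH] ah.
  exists (fun=> 0); split=> //; rewrite addn0 /comb big1 ?subr0 // => l _.
  by rewrite scale0r.
have [c [hc hc']] := IH (ltnW ah); have [c1 [hc1 hc1']] := Fl_step ah hc'.
exists (fun l => c l + c1 l); split=> [l|]; first exact: UDD.
rewrite addnS; have -> : comb (fun l => c l + c1 l) = comb c + comb c1.
  by rewrite /comb -big_split; apply: eq_bigr => l _; rewrite scalerDl.
by rewrite opprD addrA.
Qed.

Definition L0 : set N := [set y | forall k, Fl k y].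

(** Clearing one block of [hd] graded pieces after the other gives coefficients in [U n], [U n.+1]
    and so on. Their sums converge, and what remains lies in all steps of the filtration. *)
Lemma Fl_comb n y : Fl (n * hd) y -> exists c, (forall l, U n (c l)) /\ L0 (y - comb c).
Proof.
move=> hy.
have blk (ky : nat * N) : exists c : 'I_h -> E, Fl (ky.1 * hd) ky.2 ->
    (forall l, U ky.1 (c l)) /\ Fl (ky.1.+1 * hd) (ky.2 - comb c).
  by have [/Fl_block[c hc]|nh] := pselect (Fl (ky.1 * hd) ky.2); [exists c|exists (fun=> 0)].
have [g hg] := choice blk.
pose r := fix r k := if k is k'.+1 then r k' - comb (g (n + k', r k')%N) else y.
have rF k : Fl ((n + k) * hd) (r k).
  elim: k => [|k IH]; first by rewrite addn0.
  by rewrite addnS; have [] := hg (n + k, r k)%N IH.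
pose f l k := g (n + k, r k)%N l.
have fU l k : U (n + k) (f l k) by have [hh _] := hg (n + k, r k)%N (rF k); exact: hh.
have [c hc] := choice (fun l => U_series EC (f := f l) (fun k => Ule (leq_addl n k) (fU l k))).
exists c; split=> [l|].
  rewrite -[c l](subrK (\sum_(k < n) f l k)); apply: UDD => //.
  by apply: Usum => k _; exact: Ule (leq_addr k n) (fU l k).
have rE k : r k = y - comb (fun l => \sum_(a < k) f l a).
  elim: k => [|k IH].
    by rewrite /comb big1 ?subr0 // => l _; rewrite big_ord0 scale0r.
  rewrite /= {1}IH -addrA -opprD; congr (_ - _).
  rewrite /comb -big_split; apply: eq_bigr => l _.
  by rewrite big_ord_recr scalerDl.
move=> M0; have -> : y - comb c = r M0 - comb (fun l => c l - \sum_(a < M0) f l a).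
  by rewrite rE -combB opprB addrA subrK.
apply: FlB; first by apply: Fl_le (rF M0); nia.
apply: (@Fl_le _ (M0 * hd)); first by nia.
by apply: Lat_Fl; apply: comb_Lat.
Qed.

(** The terms have distinct orders [r ls + n * hd]. By induction on [r ls], the terms of smaller
    order have an additional factor [pe] and move up by [hd], and those of larger order vanish in
    the graded piece. [Fl_detect] then kills the residue of the remaining term. *)
Lemma comb_Fl_step n c : (forall l, U n (c l)) -> Fl (n.+1 * hd) (comb c) ->
  forall l, U n.+1 (c l).
Proof.
move=> hc hF; have [c' hc'] := choice (fun l => U_div LD EC (hc l)).
have c'U l : U 0 (c' l) by have [] := hc' l.
pose r (ls : 'I_h * 'I_d) := (ls.2 + d * ls.1)%N.
have r_lt ls : (r ls < hd)%N.
  by have := ltn_ord ls.1; have := ltn_ord ls.2; rewrite /r; nia.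
have r_mod ls : (r ls %% d = ls.2)%N by rewrite /r addnC mulnC modnMDl modn_small.
have r_inj ls ls' : r ls = r ls' -> ls = ls'.
  move=> rr; have e2 : ls.2 = ls'.2 by apply: val_inj; rewrite /= -!r_mod rr.
  have e1 : ls.1 = ls'.1.
    apply: val_inj => /=; have d0 := cd_d CD; apply/eqP; rewrite -(eqn_pmul2l d0); apply/eqP.
    by move: rr; rewrite /r e2; lia.
  by case: ls ls' e1 e2 {rr} => [? ?] [? ?] /= -> ->.
have key (ls : 'I_h * 'I_d) : X ls.2 (c' ls.1) = 0.
  have [M] := ubnP (r ls); elim: M ls => // M IH ls; rewrite ltnS => rM.
  pose t (ls : 'I_h * 'I_d) := (c ls.1 * e ls.2) *: u (ttau ^+ r ls).
  have combE : comb c = \sum_ls t ls.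
    rewrite -(pair_bigA _ (fun l s => t (l, s))) /=; apply: eq_bigr => l _.
    by rewrite /yb scaler_sumr; apply: eq_bigr => s _; rewrite scalerA.
  have tF ls' : ls' != ls -> Fl (r ls + n * hd).+1 (t ls').
    move=> ne; have [lt|ge] := ltnP (r ls') (r ls).
      have h1 : U 1 (c' ls'.1 * e ls'.2).
        apply: (cdX_ker CD); first exact: UM.
        move=> s sd; rewrite (cdXM CD) // (cdXe CD).
        have [es|] := eqVneq (s %% d)%N (ls'.2 %% d)%N; last by rewrite mulr0.
        rewrite -(cdX_period CD s) // es (cdX_period CD) // IH ?mul0r //.
        exact: leq_trans lt rM.
      have h2 : U n.+1 (c ls'.1 * e ls'.2).
        have [_ ->] := hc' ls'.1; rewrite -mulrA -addn1; exact: UMM.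
      apply: Fl_le (FlZ h2 (Fl_u (@low_tau (r ls')))).
      by have := r_lt ls; rewrite mulSn; lia.
    have h2 : U n (c ls'.1 * e ls'.2) by rewrite mulrC; apply: UM.
    apply: Fl_le (FlZ h2 (Fl_u (@low_tau (r ls')))).
    have : r ls' != r ls by apply: contra ne => /eqP/r_inj ->.
    by lia.
  have h3 : Fl (r ls + n * hd).+1 (t ls).
    have -> : t ls = comb c - \sum_(ls' | ls' != ls) t ls'.
      by rewrite combE (bigD1 ls) //= addrK.
    apply: FlB; last by apply: Fl_sum => ls' /tF.
    by apply: Fl_le hF; have := r_lt ls; rewrite mulSn; lia.
  have [nu [nu' [hnu h4]]] := pe_tau (r ls) n.
  have h5 : Fl (r ls + n * hd).+1 (j (X ls.2 (c' ls.1) * nu) *: u (ttau ^+ (r ls + n * hd))).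
    have h6 : U 0 (c' ls.1 * e ls.2) by exact: UM.
    have XE : X (r ls) (c' ls.1 * e ls.2) = X ls.2 (c' ls.1).
      rewrite -(cdX_period CD (r ls)) // r_mod (cdXM CD) // (cdXe CD) eqxx mulr1.
      by [].
    have -> : j (X ls.2 (c' ls.1) * nu) *: u (ttau ^+ (r ls + n * hd)) =
      t ls - (pe ^+ n *: ((c' ls.1 * e ls.2) *: u (ttau ^+ r ls) - j (X (r ls) (c' ls.1 * e ls.2)) *: u (ttau ^+ r ls))
       + j (X ls.2 (c' ls.1)) *: (pe ^+ n *: u (ttau ^+ r ls) - j nu *: u (ttau ^+ (r ls + n * hd)))).
      rewrite XE /t; have [_ {1}->] := hc' ls.1.
      rewrite !scalerBr !scalerA [j _ * pe ^+ n]mulrC subrKA mulrA -rmorphM opprB addrC subrK.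
      by [].
    apply: FlB => //; apply: FlD; last exact: FlZ0.
    have := FlZ (Upe n) (Fl_residue_tau (r ls) h6).
    by rewrite addSn.
  have := Fl_detect h5 => /(congr1 (fun x => x * nu')).
  by rewrite -mulrA hnu mulr1 mul0r.
move=> l; have [_ ->] := hc' l; rewrite -addn1; apply: UMM => //.
by apply: (cdX_ker CD) => // s sd; have := key (l, Ordinal sd).
Qed.

Lemma L0Z a y : U 0 a -> L0 y -> L0 (a *: y).
Proof. by move=> ha hy k; apply: FlZ0. Qed.

Lemma L0D x y : L0 x -> L0 y -> L0 (x + y).
Proof. by move=> hx hy k; apply: FlD. Qed.

Lemma L0B x y : L0 x -> L0 y -> L0 (x - y).
Proof. by move=> hx hy k; apply: FlB. Qed.

Lemma L0_Lat y : L0 y -> Lat 0 y.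
Proof. by move=> /(_ 0%N)/Fl_Lat. Qed.

Let Upe0 n : U 0 (pe ^+ n). Proof. exact: (Ule (leq0n n) (Upe n)). Qed.

Lemma comb_L0 c : L0 (comb c) -> forall l, c l = 0.
Proof.
move=> hc; have [a ha] := choice (fun l => U_exhaust LD EC (c l)).
pose M := (\sum_l a l)%N.
have cU l : U 0 (pe ^+ M * c l).
  by rewrite /M (bigD1 l) //= addnC exprD -mulrA; apply: UM.
have hM : L0 (comb (fun l => pe ^+ M * c l)) by rewrite -combZ; apply: L0Z.
have all n : forall l, U n (pe ^+ M * c l).
  by elim: n => [//|n IH]; apply: comb_Fl_step => //; exact: hM.
move=> l; apply: (pe_inj LD (i := i) (n := M)); rewrite mulr0.
by apply: (U_sep EC) => n; exact: all.
Qed.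

Definition N0 : set N := [set y | exists n, L0 (pe ^+ n *: y)].

Lemma N0_sub : submodule setT N0.
Proof.
split; first by exists 0%N => k; rewrite scaler0; exact: Fl_0.
move=> c x y _ [n hx] [n' hy]; have [a ha] := U_exhaust LD EC c.
exists (a + n + n')%N; rewrite scalerDr; apply: L0D.
  rewrite scalerA (_ : _ * c = pe ^+ n' * (pe ^+ a * c) * pe ^+ n); last by rewrite !exprD; ring.
  by rewrite -scalerA; apply: L0Z => //; apply: UM.
by rewrite exprD -scalerA; apply: L0Z.
Qed.

Lemma L0_N0 y : L0 y -> N0 y.
Proof. by move=> hy; exists 0%N; rewrite expr0 scale1r. Qed.

Let N0D x y : N0 x -> N0 y -> N0 (x + y).
Proof. by move=> hx hy; rewrite -[x]scale1r; apply: (proj2 N0_sub). Qed.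

Let N0Z c y : N0 y -> N0 (c *: y).
Proof. by move=> hy; rewrite -[_ *: _]addr0; apply: (proj2 N0_sub) => //; case: N0_sub. Qed.

Let N0B x y : N0 x -> N0 y -> N0 (x - y).
Proof. by move=> hx hy; rewrite -scaleN1r; apply: N0D => //; exact: N0Z. Qed.

Lemma comb_N0 c : N0 (comb c) -> forall l, c l = 0.
Proof.
move=> [n]; rewrite combZ => /comb_L0 hc l.
by apply: (pe_inj LD (i := i) (n := n)); rewrite mulr0 hc.
Qed.

Lemma yb_coords y : exists c, N0 (y - comb c).
Proof.
have [n /Lat0_Fl hy] := Lat_exhaust y.
have [|c [_ hc]] := @Fl_comb 0 (pe ^+ n *: y); first by rewrite mul0n.
exists (fun l => i ((ia p)^-1) ^+ n * c l), n; rewrite scalerBr combZ.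
rewrite (_ : comb _ = comb c) //; apply: eq_bigr => l _; congr (_ *: _).
rewrite mulrA -exprMn -rmorphM mulfV ?rmorph1 ?expr1n ?mul1r //.
by apply/eqP => e0; have := ld_unif LD; rewrite e0 (place0 wP).
Qed.

Definition yc (y : N) : 'I_h -> E := projT1 (cid (yb_coords y)).

Lemma ycP y : N0 (y - comb (yc y)).
Proof. by rewrite /yc; case: cid. Qed.

Lemma yc_eq y c : N0 (y - comb c) -> yc y = c.
Proof.
move=> hc; apply/funext => l; apply/eqP; rewrite -subr_eq0; apply/eqP.
apply: (@comb_N0 (fun l => yc y l - c l)); rewrite -combB.
have -> : comb (yc y) - comb c = (y - comb c) - (y - comb (yc y)).
  by rewrite opprB [RHS]addrC addrA subrK.
by apply: N0B => //; exact: ycP.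
Qed.

Lemma ycL l c x y : yc (c *: x + y) l = c * yc x l + yc y l.
Proof.
rewrite (@yc_eq _ (fun l => c * yc x l + yc y l)) //.
have -> : comb (fun l => c * yc x l + yc y l) = c *: comb (yc x) + comb (yc y).
  by rewrite combZ /comb -big_split; apply: eq_bigr => a _; rewrite scalerDl.
rewrite opprD addrACA -scalerBr; apply: N0D; last exact: ycP.
by apply: N0Z; exact: ycP.
Qed.

Lemma yc_N0 y : N0 y <-> (forall l, yc y l = 0).
Proof.
split=> [hy l|hy]; first by rewrite (@yc_eq y (fun=> 0)) // /comb big1 ?subr0 // => a _; rewrite scale0r.
by have := ycP y; rewrite /comb big1 ?subr0 // => l _; rewrite hy scale0r.
Qed.

Lemma yc_comb c : yc (comb c) = c.
Proof. by apply: yc_eq; rewrite subrr; case: N0_sub. Qed.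

Lemma Fl_yc n y : Fl (n * hd) y -> (forall l, U n (yc y l)) /\ L0 (y - comb (yc y)).
Proof. by move=> /Fl_comb[c [hc hL]]; rewrite (yc_eq (L0_N0 hL)). Qed.

Lemma Lat_yc y : Lat 0 y -> (forall l, U 0 (yc y l)) /\ L0 (y - comb (yc y)).
Proof. by move=> /Lat0_Fl hy; apply: Fl_yc; rewrite mul0n. Qed.

Lemma N0_Lat y : Lat 0 y -> N0 y -> L0 y.
Proof.
move=> /Lat_yc[_]; have [h1 _] := yc_N0 y => h2 /h1 h3; move: h2.
by rewrite /comb big1 ?subr0 // => l _; rewrite h3 scale0r.
Qed.

(** * Action of [tau] on the filtration and on the slope [0] part *)

Lemma sigma_pe : sigma pe = pe.
Proof.
have [hs _] := sigma_frob; have := hs (ia p) 1.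
by rewrite rmorph1 expr1n !mulr1.
Qed.

Lemma tauD x y : tau (x + y) = tau x + tau y. Proof. by have [hh _] := md_tau MD. Qed.
Lemma tauZ c x : tau (c *: x) = sigma c *: tau x. Proof. by have [_ hh] := md_tau MD; exact: hh. Qed.
Lemma tau0 : tau 0 = 0.
Proof. by have := tauD 0 0; rewrite addr0 => /eqP; rewrite -subr_eq subrr eq_sym => /eqP. Qed.
Lemma tau_sum (I : Type) (r : seq I) (P : pred I) (F : I -> N) :
  tau (\sum_(x <- r | P x) F x) = \sum_(x <- r | P x) tau (F x).
Proof. exact: (big_morph tau tauD tau0). Qed.

Lemma tau_Fl k y : Fl k y -> Fl k.+1 (tau y).
Proof.
move=> [s [hs ->]]; rewrite tau_sum; apply: Fl_sum_seq => x /hs[h1 h2].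
rewrite tauZ (md_tau_u MD); apply: FlZ0; first by have [_ hh] := sigma_frob; exact: hh.
by apply: Fl_u; have := @low_tau 1; rewrite expr1 => /low_geM/(_ h2)[]; rewrite add1n.
Qed.

Lemma tau_L0 y : L0 y -> L0 (tau y).
Proof. by move=> hy k; apply: Fl_le (tau_Fl (hy k)). Qed.

Lemma tau_N0 y : N0 y -> N0 (tau y).
Proof.
move=> [n /tau_L0]; rewrite tauZ rmorphXn => hn; exists n.
by move: hn; rewrite sigma_pe.
Qed.

(** Coefficients of a twisted polynomial need not be [q]-th powers, so one obtains a combination of
    values of [tau] and not a single value. *)
Lemma Fl_tauP k y : Fl k.+1 y -> exists s : seq (E * N),
  (forall x, x \in s -> U 0 x.1 /\ Fl k x.2) /\ y = \sum_(x <- s) x.1 *: tau x.2.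
Proof.
move=> [s [hs ->]]; elim: s hs => [|x s IH] hs.
  by exists [::]; rewrite !big_nil.
have [s' [hs' e']] := IH (fun z hz => hs z (mem_tail x hz)).
have [h1 h2] := hs x (mem_head _ _).
pose n := size (x.2 : {poly R}).
pose s1 := [seq (x.1 * j (rho (tcoef x.2 (k.+1 + l))), u (ttau ^+ (k + l))) | l <- iota 0 n].
exists (s1 ++ s'); split.
  move=> z; rewrite mem_cat => /orP[/mapP[l _ ->]/=|/hs' //]; split; first exact: UM.
  by apply: Fl_u => a ak; apply: low_tau; lia.
rewrite big_cons big_cat /= e'; congr (_ + _).
rewrite /s1 big_map -[X in iota 0 X]subn0 -/(index_iota 0 n) big_mkord /=.
under eq_bigr => l _ do rewrite (md_tau_u MD) -exprS -scalerA -u_cst -addSn.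
rewrite -scaler_sumr -u_sum; congr (_ *: u _).
rewrite {1}(@twpoly_expand _ _ _ x.2 (k.+1 + n)) ?leq_addl // big_split_ord /=.
by rewrite big1 ?add0r // => a _; rewrite h2 // cst0 mul0r.
Qed.

Lemma Fl_tau_iter k y : Fl k y -> exists s : seq (E * N),
  (forall x, x \in s -> U 0 x.1 /\ Lat 0 x.2) /\ y = \sum_(x <- s) x.1 *: iter k tau x.2.
Proof.
elim: k y => [|k IH] y.
  move=> /Fl_Lat hy; exists [:: (1, y)]; rewrite big_seq1 scale1r; split=> // x.
  by rewrite inE => /eqP ->.
move=> /Fl_tauP[s [hs ->]]; elim: s hs => [|x s IHs] hs.
  by exists [::]; rewrite !big_nil.
have [s' [hs' e']] := IHs (fun z hz => hs z (mem_tail x hz)).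
have [h1 /IH[t [ht et]]] := hs x (mem_head _ _).
exists ([seq (x.1 * sigma z.1, z.2) | z <- t] ++ s'); split.
  move=> z; rewrite mem_cat => /orP[/mapP[a /ht[h2 h3] ->]/=|/hs' //]; split=> //.
  by apply: UM => //; have [_ hh] := sigma_frob; exact: hh.
rewrite big_cons big_cat e' big_map /=; congr (_ + _).
rewrite et tau_sum scaler_sumr; apply: eq_bigr => z _.
by rewrite tauZ scalerA.
Qed.

Lemma iter_tau_Fl k n y : Fl n y -> Fl (n + k) (iter k tau y).
Proof. by move=> hy; elim: k => [|k IH]; rewrite ?addn0 // addnS; exact: tau_Fl. Qed.

(** The projection onto [N0] along the span of the vectors [yb]. *)
Definition pr0 (y : N) : N := y - comb (yc y).

Lemma pr0_N0 y : N0 (pr0 y). Proof. exact: ycP. Qed.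

Lemma pr0L c x y : pr0 (c *: x + y) = c *: pr0 x + pr0 y.
Proof.
rewrite /pr0 scalerBr addrACA -opprD; congr (_ - _).
by rewrite combZ /comb -big_split; apply: eq_bigr => l _; rewrite ycL scalerDl.
Qed.

Lemma pr0_id y : N0 y -> pr0 y = y.
Proof. by move=> /yc_N0 hy; rewrite /pr0 /comb big1 ?subr0 // => l _; rewrite hy scale0r. Qed.

Lemma pr0_Lat y : Lat 0 y -> L0 (pr0 y). Proof. by move=> /Lat_yc[]. Qed.

Lemma pr0_sum (I : finType) (c : I -> E) (x : I -> N) :
  pr0 (\sum_l c l *: x l) = \sum_l c l *: pr0 (x l).
Proof.
have p0 : pr0 0 = 0 by apply: pr0_id; case: N0_sub.
apply: (big_ind2 (fun x y => pr0 x = y)) => // [x1 x2 y1 y2 e1 e2|l _].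
  by have := pr0L 1 x1 y1; rewrite !scale1r e1 e2.
by have := pr0L (c l) (x l) 0; rewrite p0 !addr0.
Qed.

Lemma N0_expand y : N0 y -> y = \sum_k crd k y *: pr0 (u (ttau ^+ (k : 'I_m))).
Proof.
move=> hy; rewrite -pr0_sum; have [_ /(_ y) <-] := crd_presents.
by rewrite pr0_id.
Qed.

(** Surjectivity modulo [pe]: [y] is a combination of [tau x] with [x] in [Fl hd], and by [Fl_yc]
    such an [x] differs from an element of [L0] by [pe] times a lattice vector. *)
Lemma L0_step y : L0 y -> exists z y', [/\ L0 z, Defs.span (U 0%N) [set tau x | x in L0] y' & y = pe *: z + y'].
Proof.
move=> hy; have [s [hs ey]] := Fl_tauP (hy hd.+1).
have lift (x : N) : exists zl : N * N, Fl hd x -> [/\ Lat 0 zl.1, L0 zl.2 & x = pe *: zl.1 + zl.2].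
  have [hx|nh] := pselect (Fl hd x); last by exists (0, 0).
  have [hc hL] : (forall l, U 1 (yc x l)) /\ L0 (x - comb (yc x)) by apply: Fl_yc; rewrite mul1n.
  have [c' hc'] := choice (fun l => U_div LD EC (hc l)).
  exists (comb c', x - comb (yc x)) => _; split=> //=.
    by apply: comb_Lat => l; have [] := hc' l.
  have -> : comb (yc x) = pe *: comb c'.
    by rewrite combZ; apply: eq_bigr => l _; have [_ ->] := hc' l; rewrite expr1.
  by rewrite addrC subrK.
have [g hg] := choice lift.
pose z := \sum_(x <- s) x.1 *: tau (g x.2).1.
pose y' := \sum_(x <- s) x.1 *: tau (g x.2).2.
have ey' : y = pe *: z + y'.
  rewrite ey /z /y' scaler_sumr -big_split; apply: eq_big_seq => x /hs[h1 /hg[h2 h3 {1}->]] /=.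
  by rewrite tauD tauZ sigma_pe scalerDr !scalerA [pe * _]mulrC.
have y'L : L0 y'.
  rewrite /y' => k; apply: Fl_sum_seq => x /hs[h1 /hg[h2 h3 _]].
  by apply: FlZ0 => //; exact: tau_L0.
exists z, y'; split=> //.
(* [L0] is saturated in the lattice, and [pe *: z] lies in [L0] as a difference of two of its
   elements. *)
- apply: N0_Lat.
    rewrite /z big_seq; apply: Lat_sum => x /hs[h1 /hg[h2 _ _]].
    rewrite -[X in Lat X _]addn0; apply: LatZ => //; apply: (@Fl_Lat 1); apply: tau_Fl; exact: Lat0_Fl.
  exists 1%N; rewrite expr1 (_ : pe *: z = y - y'); first exact: L0B.
  by rewrite ey' addrK.
- exists (size s), (fun k : 'I_(size s) => (tnth (in_tuple s) k).1),
    (fun k : 'I_(size s) => tau (g (tnth (in_tuple s) k).2).2).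
  split=> [k|k|].
  + by have [] := hs _ (mem_tnth k (in_tuple s)).
  + exists (g (tnth (in_tuple s) k).2).2 => //.
    by have [_ /hg[]] := hs _ (mem_tnth k (in_tuple s)).
  + by rewrite /y' big_tnth.
Qed.

Lemma spanD S (Y : set N) x y : Defs.span S Y x -> Defs.span S Y y -> Defs.span S Y (x + y).
Proof.
move=> [n [c [z [hc hz ->]]]] [n' [c' [z' [hc' hz' ->]]]].
exists (n + n')%N, (fun k => match split k with inl a => c a | inr a => c' a end),
  (fun k => match split k with inl a => z a | inr a => z' a end); split.
- by move=> k; case: split.
- by move=> k; case: split.
rewrite big_split_ord /=; congr (_ + _); apply: eq_bigr => k _.
  by rewrite (unsplitK (inl k)).
by rewrite (unsplitK (inr k)).
Qed.

Lemma span0 S (Y : set N) : Defs.span S Y 0.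
Proof. by exists 0%N, (fun=> 0), (fun=> 0); split=> [[]|[]|] //; rewrite big_ord0. Qed.

Lemma spanZ (Y : set N) a x : U 0 a -> Defs.span (U 0%N) Y x -> Defs.span (U 0%N) Y (a *: x).
Proof.
move=> ha [n [c [z [hc hz ->]]]]; exists n, (fun k => a * c k), z; split=> // [k|].
  exact: UM.
by rewrite scaler_sumr; apply: eq_bigr => k _; rewrite scalerA.
Qed.

Lemma span_mem (Y : set N) x : Y x -> Defs.span (U 0%N) Y x.
Proof.
by move=> hx; exists 1%N, (fun=> 1), (fun=> x); split=> //; rewrite big_ord1 scale1r.
Qed.

Lemma span_sum S (Y : set N) (I : Type) (r : seq I) (P : pred I) (F : I -> N) :
  (forall x, P x -> Defs.span S Y (F x)) -> Defs.span S Y (\sum_(x <- r | P x) F x).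
Proof. by move=> hF; apply: big_ind => //; [exact: span0|move=> *; exact: spanD]. Qed.

(** Nakayama for the generators [pr0 (u (tau ^+ k))] of [L0]: modulo [pe] they lie in the span of
    the image of [tau], and [1 - C] is invertible. *)
Lemma L0_span_tau y : L0 y -> Defs.span (U 0%N) [set tau x | x in L0] y.
Proof.
pose x (k : 'I_m) := pr0 (u (ttau ^+ k)).
have xL k : L0 (x k) by apply: pr0_Lat; exact: Lat_u.
have step k : exists zy : N * N, [/\ L0 zy.1, Defs.span (U 0%N) [set tau x | x in L0] zy.2 & x k = pe *: zy.1 + zy.2].
  by have [z [y' hh]] := L0_step (xL k); exists (z, y').
have [g hg] := choice step.
pose C : 'M[E]_m := \matrix_(k, a) (pe * crd a (g k).1).
have [|V [VC VU]] := geometric_inverse LD EC (C := C).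
  move=> k a; rewrite mxE -[1%N]addn0; apply: UMM => //; apply: crd_Lat; apply: L0_Lat.
  by have [] := hg k.
have xE k : x k = \sum_a C k a *: x a + (g k).2.
  have [h1 _ h3] := hg k; rewrite {1}h3; congr (_ + _).
  rewrite {1}(N0_expand (L0_N0 h1)) scaler_sumr; apply: eq_bigr => a _.
  by rewrite scalerA mxE.
have xV k : x k = \sum_a V k a *: (g a).2.
  transitivity (\sum_l (1%:M : 'M[E]_m) k l *: x l).
    rewrite (bigD1 k) //= mxE eqxx scale1r big1 ?addr0 // => l lk.
    by rewrite mxE eq_sym (negbTE lk) scale0r.
  rewrite -VC; under [LHS]eq_bigr => l _ do rewrite mxE scaler_suml.
  rewrite exchange_big /=; apply: eq_bigr => a _.
  under [LHS]eq_bigr => l _ do rewrite -scalerA.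
  rewrite -scaler_sumr; congr (_ *: _).
  under [LHS]eq_bigr => l _ do rewrite 2!mxE [(- C) _ _]mxE scalerBl.
  rewrite sumrB; apply/eqP; rewrite subr_eq; apply/eqP.
  rewrite addrC [RHS](_ : _ = x a); last by rewrite {1}xE; congr (_ + _); apply: eq_bigr => l _; rewrite !mxE.
  rewrite (bigD1 a) //= eqxx scale1r big1 ?addr0 // => l la.
  by rewrite eq_sym (negbTE la) scale0r.
move=> hy; rewrite (N0_expand (L0_N0 hy)); apply: span_sum => k _.
apply: spanZ; first by apply: crd_Lat; exact: L0_Lat.
rewrite -/(x k) xV; apply: span_sum => a _; apply: spanZ => //.
by have [] := hg a.
Qed.

Lemma L0_span_tau_iter n y : L0 y -> Defs.span (U 0%N) [set iter n tau x | x in L0] y.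
Proof.
elim: n y => [|n IH] y hy; first by apply: span_mem; exists y.
have [k [c [x [hc hx ->]]]] := L0_span_tau hy.
apply: span_sum => a _; apply: spanZ => //.
have [x' /IH[k' [c' [z [hc' hz ->]]]] <-] := hx a.
rewrite tau_sum; apply: span_sum => b' _; rewrite tauZ; apply: spanZ.
  by have [_ hh] := sigma_frob; exact: hh.
by have [z' hz' <-] := hz b'; apply: span_mem; exists z'.
Qed.

Lemma iter_tau_L0 n y : L0 y -> L0 (iter n tau y).
Proof. by move=> hy; elim: n => //= n IH; exact: tau_L0. Qed.


(** * Linearization of [tau] *)

Lemma sigma_iA a : sigma (iA a) = iA a.
Proof. by have [hs _] := sigma_frob; have := hs (ia a) 1; rewrite rmorph1 expr1n !mulr1. Qed.

Lemma sigma_j xi : sigma (j xi) = j (xi ^+ q).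
Proof. by have [hs _] := sigma_frob; have := hs 1 xi; rewrite rmorph1 !mul1r rmorphXn. Qed.

Let ip_pe : i (ia p)^-1 * pe = 1.
Proof.
rewrite -rmorphM mulVf ?rmorph1 //.
by apply/eqP => e0; have := ld_unif LD; rewrite e0 (place0 wP).
Qed.

Lemma phi_p_low f : tcoef (f * phi p) 0 = 0.
Proof.
rewrite tcoefM big_ord_recl big_ord0 addr0 subnn expn0 expr1 (md_chi MD).
have -> : chi p = 0 by apply/(ld_chi LD); right; rewrite (ld_unif LD).
by rewrite mulr0.
Qed.

Lemma twpoly_expandS (f : T) n : (size (f : {poly R}) <= n)%N -> tcoef f 0 = 0 ->
  f = \sum_(k < n) cst (tcoef f k.+1) * (ttau * ttau ^+ k).
Proof.
move=> fn f0; rewrite {1}(@twpoly_expand _ _ _ f n.+1) 1?ltnW //.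
by rewrite big_ord_recl f0 cst0 mul0r add0r; apply: eq_bigr => k _; rewrite exprS.
Qed.

Section Linearize.
Variables (W : lmodType E) (g : N -> W).
Hypothesis gs : semilinear_map sigma (fun e (x : N) => e *: x) g.

Let gD x y : g (x + y) = g x + g y. Proof. by case: gs. Qed.
Let gZ c x : g (c *: x) = sigma c *: g x. Proof. by case: gs => _ hh; exact: hh. Qed.
Let g0 : g 0 = 0.
Proof. by have := gZ 0 0; rewrite rmorph0 !scale0r. Qed.
Let g_sum (I : finType) (F : I -> N) : g (\sum_k F k) = \sum_k g (F k).
Proof. exact: (big_morph g gD g0). Qed.

(* [tau * f |-> g (u f)] on twisted polynomials without constant term. *)
Definition tshift (f : T) : W :=
  \sum_(k < size (f : {poly R})) j (rho (tcoef f k.+1)) *: g (u (ttau ^+ k)).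

Lemma tshiftE n (f : T) : (size (f : {poly R}) <= n)%N ->
  tshift f = \sum_(k < n) j (rho (tcoef f k.+1)) *: g (u (ttau ^+ k)).
Proof.
move=> fn; rewrite /tshift.
rewrite (big_ord_widen n (fun k => j (rho (tcoef f k.+1)) *: g (u (ttau ^+ k)))) // big_mkcond.
apply: eq_bigr => k _; case: ltnP => // sk.
by rewrite [tcoef _ _]nth_default ?rmorph0 ?scale0r // ltnW.
Qed.

Lemma tshiftD f f' : tshift (f + f') = tshift f + tshift f'.
Proof.
set n := (size (f : {poly R}) + size (f' : {poly R}))%N.
rewrite !(@tshiftE n) ?leq_addl ?leq_addr //; last first.
  apply/leq_sizeP => k nk; rewrite -[LHS]/(tcoef (f + f') k) tcoefD.
  by rewrite /tcoef !nth_default ?addr0 //; apply: leq_trans nk; rewrite ?leq_addl ?leq_addr.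
by rewrite -big_split; apply: eq_bigr => k _; rewrite tcoefD !rmorphD scalerDl.
Qed.

Lemma tshift_cst r f : tshift (cst r * f) = j (rho r) *: tshift f.
Proof.
rewrite !(@tshiftE (size (f : {poly R}))) //; last first.
  apply/leq_sizeP => k nk; rewrite -[LHS]/(tcoef (cst r * f) k) tcoef_cstM.
  by rewrite [tcoef _ _]nth_default // mulr0.
by rewrite scaler_sumr; apply: eq_bigr => k _; rewrite tcoef_cstM !rmorphM scalerA.
Qed.

Lemma tshift0 : tshift 0 = 0.
Proof. by have := tshift_cst 0 0; rewrite cst0 mul0r !rmorph0 scale0r. Qed.

Lemma tshift_sum (I : finType) (F : I -> T) : tshift (\sum_k F k) = \sum_k tshift (F k).
Proof. exact: (big_morph tshift tshiftD tshift0). Qed.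

Lemma tshift_tau f : tshift (ttau * f) = g (u f).
Proof.
set n := (size (f : {poly R})).+1.
have E1 k : tcoef (ttau * f) k.+1 = tcoef f k ^+ q.
  by have := tcoef_tauXM 1 f k.+1; rewrite expr1 subn1 expn1.
rewrite (@tshiftE n); last first.
  apply/leq_sizeP => -[//|k] nk; rewrite -[LHS]/(tcoef (ttau * f) k.+1) E1.
  by rewrite [tcoef _ _]nth_default // expr0n eqn0Ngt (ltnW (finNzRing_gt1 _)).
rewrite {2}(@twpoly_expand _ _ _ f n) // u_sum g_sum.
by apply: eq_bigr => k _; rewrite E1 u_cst gZ sigma_j rmorphXn.
Qed.

Lemma tshift_phi f a : tcoef f 0 = 0 -> tshift (f * phi a) = iA a *: tshift f.
Proof.
move=> f0; rewrite [X in X * _](twpoly_expandS (leqnn _) f0) mulr_suml tshift_sum.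
rewrite [in RHS]/tshift scaler_sumr; apply: eq_bigr => k _.
rewrite -!mulrA tshift_cst tshift_tau u_phi gZ sigma_iA !scalerA; congr (_ *: _).
by rewrite mulrC.
Qed.

(** A twisted polynomial [f] need not lie in the span of [tau R[tau]], but [f * phi p] does. So [H]
    is defined by shifting [f * phi p] down and dividing by [pe], which is invertible in [E] and
    fixed by [sigma]. *)
Lemma linearize : exists H : N -> W, linear H /\ forall x, H (tau x) = g x.
Proof.
have [_ univ] := md_base MD.
have [|H [[HL Hu] _]] := univ W (fun f => i (ia p)^-1 *: tshift (f * phi p)).
  split=> [x y|[a r] x] /=; first by rewrite mulrDl tshiftD scalerDr.
  have -> : cst r * x * phi a * phi p = cst r * (x * phi p * phi a).
    by rewrite -!mulrA -!rmorphM [p * a]mulrC.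
  rewrite tshift_cst tshift_phi ?phi_p_low // !scalerA; congr (_ *: _); rewrite /=; ring.
exists H; split=> // x; have [c ex] : exists c : 'I_m -> E, x = \sum_k c k *: u (ttau ^+ k).
  by exists (fun k => crd k x); have [_] := crd_presents.
have e1 : tau x = \sum_k sigma (c k) *: u (ttau * ttau ^+ k).
  by rewrite ex tau_sum; apply: eq_bigr => k _; rewrite tauZ (md_tau_u MD).
rewrite e1 linear_sum_seq // ex g_sum; apply: eq_bigr => k _.
by rewrite Hu -mulrA tshift_tau u_phi !gZ sigma_iA [X in _ *: X]scalerA ip_pe scale1r.
Qed.

End Linearize.

Lemma tau_spans : spanned_by_image tau.
Proof.
move=> y; have [_ /(_ y) ->] := crd_presents.
have sp_u f : exists s : seq (E * N), u f = \sum_(x <- s) x.1 *: tau x.2.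
  pose n := size (f * phi p : {poly R}).
  exists [seq (i (ia p)^-1 * j (rho (tcoef (f * phi p) k.+1)), u (ttau ^+ k)) | k <- iota 0 n].
  have -> : u f = i (ia p)^-1 *: u (f * phi p) by rewrite u_phi scalerA ip_pe scale1r.
  rewrite {1}(twpoly_expandS (leqnn _) (phi_p_low f)) -/n u_sum scaler_sumr.
  rewrite big_map -[X in iota 0 X]subn0 -/(index_iota 0 n) big_mkord.
  by apply: eq_bigr => k _; rewrite u_cst (md_tau_u MD) scalerA.
have [s hs] := choice sp_u.
exists (flatten [seq [seq (crd k y * x.1, x.2) | x <- s (ttau ^+ (k : 'I_m))] | k <- index_enum 'I_m]).
rewrite big_flatten big_map; apply: eq_bigr => k _; rewrite big_map {1}hs scaler_sumr.
by apply: eq_bigr => x _; rewrite scalerA.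
Qed.

Lemma motive_isocrystal : is_isocrystal sigma tau.
Proof.
split; [exact: presents_fg crd_presents|exact: md_tau MD|].
by apply: linearization_isoI; [exact: md_tau MD|exact: tau_spans|exact: linearize].
Qed.

(** * The isocrystals of slope [0] and slope [1 / h] *)

Local Notation X0 := (sublmod N0_sub).

Definition toX0 (y : N) : X0 := SubLmod (to_sublmod_proof N0_sub (pr0_N0 y)).

Lemma toX0L c x y : toX0 (c *: x + y) = c *: toX0 x + toX0 y.
Proof. by apply: val_inj; rewrite /= pr0L. Qed.

Lemma toX0K (x : X0) : toX0 (val x) = x.
Proof. by apply: val_inj; rewrite /= pr0_id //; exact: sublmodP. Qed.

Lemma val_toX0 y : N0 y -> val (toX0 y) = y.
Proof. exact: pr0_id. Qed.

Definition tauX0 (x : X0) : X0 := toX0 (tau (val x)).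

Lemma val_tauX0 x : val (tauX0 x) = tau (val x).
Proof. by apply: val_toX0; apply: tau_N0; exact: sublmodP. Qed.

Lemma val_iter_tauX0 n x : val (iter n tauX0 x) = iter n tau (val x).
Proof. by elim: n => // n IH; rewrite !iterS val_tauX0 IH. Qed.

Lemma X0_presents :
  presents (fun k : 'I_m => toX0 (u (ttau ^+ k))) (fun k x => crd k (val x)).
Proof.
split=> [k c y y'|y]; first exact: crdL.
rewrite -[LHS]toX0K {1}(proj2 crd_presents (val y)).
by rewrite (linear_sum_seq (f := toX0)) //; exact: toX0L.
Qed.

Lemma span_image_val S (X' : lmodType E) (f : N -> X') (Y : set N) y : linear f ->
  Defs.span S Y y -> Defs.span S (f @` Y) (f y).
Proof.
move=> fL [n [c [x [hc hx ->]]]]; exists n, c, (fun k => f (x k)); split=> // [k|].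
  by exists (x k).
exact: linear_sum_seq.
Qed.

Lemma tauX0_semilinear : semilinear_map sigma (fun e (x : X0) => e *: x) tauX0.
Proof.
split=> [x y|c x]; apply: val_inj; rewrite [LHS]val_tauX0 /= ?tauD ?tauZ !pr0_id //;
  by apply: tau_N0; exact: sublmodP.
Qed.

Lemma tauX0_spans : spanned_by_image tauX0.
Proof.
move=> y; have [n hn] := sublmodP y.
have [l [c [x [_ hx ey]]]] := L0_span_tau hn.
have [x' hx'] := choice (fun k => let: ex_intro2 x' h1 h2 := hx k in ex_intro _ x' (conj h1 h2)).
exists [seq (i (ia p)^-1 ^+ n * c k, toX0 (x' k)) | k <- index_enum 'I_l].
apply: val_inj; have -> : val y = i (ia p)^-1 ^+ n *: (pe ^+ n *: val y).
  by rewrite scalerA -exprMn ip_pe expr1n scale1r.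
rewrite ey scaler_sumr big_map (big_morph (val : X0 -> N) (fun _ _ => erefl) erefl).
apply: eq_bigr => k _; have [h1 h2] := hx' k.
by rewrite scalerA -h2 -{1}(val_toX0 (L0_N0 h1)) -val_tauX0.
Qed.

Lemma X0_isocrystal : is_isocrystal sigma tauX0.
Proof.
split; [exact: presents_fg X0_presents|exact: tauX0_semilinear|].
apply: linearization_isoI; [exact: tauX0_semilinear|exact: tauX0_spans|].
(* The projection [toX0] extends [g] to all of [N], where [linearize] applies. *)
move=> W g [gD gZ]; have [|H [HL Hg]] := @linearize W (g \o toX0).
  split=> [x y|c x] /=.
    by rewrite -gD -{1}[x]scale1r toX0L scale1r.
  rewrite -gZ; congr g; have := toX0L c x 0.
  have -> : toX0 0 = 0 by apply: val_inj => /=; apply: pr0_id; case: N0_sub.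
  by rewrite !addr0.
exists (fun x => H (val x)); split=> [c x y|x]; first exact: HL.
by rewrite val_tauX0 Hg /= toX0K.
Qed.

Local Notation X1 := 'rV[E]_h.

Definition toX1 (y : N) : X1 := \row_l yc y l.
Definition ofX1 (v : X1) : N := comb (v 0).
Definition tauX1 (v : X1) : X1 := toX1 (tau (ofX1 v)).

Lemma toX1L c x y : toX1 (c *: x + y) = c *: toX1 x + toX1 y.
Proof. by apply/rowP => l; rewrite !mxE ycL. Qed.

Lemma ofX1L c x y : ofX1 (c *: x + y) = c *: ofX1 x + ofX1 y.
Proof.
rewrite /ofX1 combZ /comb -big_split; apply: eq_bigr => l _.
by rewrite !mxE scalerDl.
Qed.

Lemma ofX1K v : toX1 (ofX1 v) = v.
Proof. by apply/rowP => l; rewrite mxE yc_comb. Qed.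

Lemma toX1_eq0 y : toX1 y = 0 <-> N0 y.
Proof.
split=> [h0|/yc_N0 h0]; last by apply/rowP => l; rewrite !mxE h0.
by apply/yc_N0 => l; have /rowP/(_ l) := h0; rewrite !mxE.
Qed.

Lemma toX1_decomp y : y = ofX1 (toX1 y) + pr0 y.
Proof.
rewrite /pr0 addrC (_ : ofX1 _ = comb (yc y)) ?subrK //.
by apply: eq_bigr => l _; rewrite mxE.
Qed.

Lemma toX1_tau y : toX1 (tau y) = tauX1 (toX1 y).
Proof.
rewrite {1}[y]toX1_decomp tauD -[tau (ofX1 _)]scale1r toX1L scale1r.
by have /toX1_eq0 -> := tau_N0 (pr0_N0 y); rewrite addr0.
Qed.

Lemma toX1_iter n y : toX1 (iter n tau y) = iter n tauX1 (toX1 y).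
Proof. by elim: n => //= n <-; rewrite toX1_tau. Qed.

Lemma tauX1_semilinear : semilinear_map sigma (fun e (x : X1) => e *: x) tauX1.
Proof.
have of0 : ofX1 0 = 0 by rewrite /ofX1 /comb big1 // => l _; rewrite mxE scale0r.
have to0 : toX1 0 = 0 by apply/toX1_eq0; case: N0_sub.
split=> [x y|c x]; rewrite /tauX1.
  by rewrite -{1}[x]scale1r ofX1L scale1r tauD -[tau (ofX1 x)]scale1r toX1L !scale1r.
rewrite -[c *: x]addr0 ofX1L of0 addr0 tauZ -[sigma c *: tau _]addr0 toX1L to0 addr0.
by [].
Qed.

Lemma X1_presents : presents (fun k : 'I_h => delta_mx 0 k : X1) (fun k v => v 0 k).
Proof.
split=> [k c y y'|y]; first by rewrite !mxE.
exact: row_sum_delta.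
Qed.

Lemma X1_isocrystal : is_isocrystal sigma tauX1.
Proof.
split; [exact: presents_fg X1_presents|exact: tauX1_semilinear|].
apply: linearization_isoI; first exact: tauX1_semilinear.
  move=> v; have [s es] := tau_spans (ofX1 v).
  exists [seq (x.1, toX1 x.2) | x <- s].
  rewrite -[LHS]ofX1K es (linear_sum_seq (f := toX1)); last exact: toX1L.
  by rewrite big_map; apply: eq_bigr => x _; rewrite toX1_tau.
move=> W g [gD gZ]; have g0 : g 0 = 0.
  by have := gZ 0 0; rewrite rmorph0 !scale0r.
have to0 : toX1 0 = 0 by apply/toX1_eq0; case: N0_sub.
have [|H [HL Hg]] := @linearize W (g \o toX1).
  split=> [x y|c x] /=.
    by rewrite -gD -{1}[x]scale1r toX1L scale1r.
  by rewrite -gZ -[c *: x]addr0 toX1L to0 addr0.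
(* [N0] is spanned by values of [tau] on [N0], and there [g \o toX1] vanishes; hence [H] descends to
   the quotient. *)
have H0 y : N0 y -> H y = 0.
  move=> hy; pose x : X0 := toX0 y.
  have [s es] := tauX0_spans x.
  rewrite -(val_toX0 hy) -/x es (big_morph (val : X0 -> N) (fun _ _ => erefl) erefl).
  have H00 : H 0 = 0.
    by have := HL 1 0 0; rewrite !scale1r addr0 => /eqP; rewrite -subr_eq subrr eq_sym => /eqP.
  elim: s {es} => [|z s IH]; first by rewrite big_nil.
  rewrite big_cons; have -> : val (z.1 *: tauX0 z.2) = z.1 *: tau (val z.2) by rewrite -val_tauX0.
  rewrite HL IH Hg /= addr0.
  have /toX1_eq0 -> : N0 (val z.2) by exact: sublmodP.
  by rewrite g0 scaler0.
have H1 y : H (ofX1 (toX1 y)) = H y.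
  rewrite [in RHS](toX1_decomp y) -[ofX1 (toX1 y) in RHS]scale1r HL (H0 _ (pr0_N0 y)).
  by rewrite addr0 scale1r.
exists (fun v => H (ofX1 v)); split=> [c x y|v]; first by rewrite ofX1L HL.
by rewrite /tauX1 H1 Hg /= ofX1K.
Qed.


(** * Purity and the slope filtration *)

Section Slopes.
Variable z : Fp.
Hypothesis wz : w z = 1.
Local Notation zE := (fun k : int => i (z ^ k)).

Let z0 : z != 0.
Proof. by apply/eqP => e0; move: wz; rewrite e0 (place0 wP). Qed.

Let p0 : ia p != 0.
Proof. by apply/eqP => e0; have := ld_unif LD; rewrite e0 (place0 wP). Qed.

(** Any two uniformizers differ by a unit of the ring of integers, so the given [z] may be exchanged
    for [ia p]. *)
Lemma z_pe n : exists a, [/\ U 0 a, a * i z ^+ n = pe ^+ n & exists2 a', U 0 a' & a' * pe ^+ n = i z ^+ n].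
Proof.
have V x y : x != 0 -> y != 0 -> w x = 1 -> w y = 1 -> U 0 (i (x / y)).
  move=> x0 y0 wx wy; apply: (U_i EC); right.
  by rewrite (placeM wP) ?invr_eq0 // (placeV wP) // wx wy.
exists (i (ia p / z) ^+ n); split.
- by apply: (U_X LD EC); apply: V => //; exact: ld_unif LD.
- by rewrite -exprMn -rmorphM divfK.
exists (i (z / ia p) ^+ n); last by rewrite -exprMn -rmorphM divfK.
by apply: (U_X LD EC); apply: V => //; exact: ld_unif LD.
Qed.

Lemma X0_pure : is_pure (U 0%N) zE d tauX0 0.
Proof.
exists 1%N, 0, [set x : X0 | L0 (val x)]; split=> //; rewrite ?mulr0 //.
- split; last first.
    move=> y; have [n hn] := sublmodP y; exists n.
    have [_ [_ _ [a ha ea]]] := z_pe n.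
    rewrite /= -exprnP rmorphXn -ea /= -scalerA; exact: L0Z.
  split; first by split=> [k|c x y hc hx hy]; [exact: Fl_0|apply: L0D => //; exact: L0Z].
  exists m, (fun k => toX0 (u (ttau ^+ k))), (fun k x => crd k (val x)).
  split=> [k|k y hy|k c y y' _ _ _|y _].
  + by apply: pr0_Lat; exact: Lat_u.
  + by apply: crd_Lat; exact: L0_Lat.
  + exact: crdL.
  + by have [_] := X0_presents; apply.
rewrite expr0z rmorph1 mul1n; apply/seteqP; split=> y.
  move=> [n [c [x [hc hx ->]]]]; exists (\sum_k c k *: x k); last by rewrite scale1r.
  rewrite /= (big_morph (val : X0 -> N) (fun _ _ => erefl) erefl).
  apply: (big_ind L0); first by move=> k; exact: Fl_0.
    by move=> *; exact: L0D.
  move=> k _; apply: L0Z => //; have [x' hx' <-] := hx k.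
  by rewrite val_iter_tauX0; exact: iter_tau_L0.
move=> [x hx <-]; rewrite scale1r -[x]toX0K.
have : Defs.span (U 0%N) [set toX0 y | y in [set iter d tau x | x in L0]] (toX0 (val x)).
  by apply: span_image_val; [exact: toX0L|exact: L0_span_tau_iter].
move=> [n [c [x' [hc hx' ->]]]]; exists n, c, x'; split=> // k.
have [_ [y' hy' <-] <-] := hx' k; exists (toX0 y') => /=.
  by rewrite pr0_id //; exact: L0_N0.
by apply: val_inj; rewrite val_iter_tauX0 !val_toX0 //; apply: L0_N0 => //; exact: iter_tau_L0.
Qed.

(** On the standard lattice, [h * d] applications of [tau] reach [Fl hd], whose coordinates lie in
    [U 1] by [Fl_yc]. Conversely [pe] times a lattice vector lies in [Fl hd], which [Fl_tau_iter]
    writes through values of this iterate. *)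
Lemma X1_pure : is_pure (U 0%N) zE d tauX1 h%:R^-1.
Proof.
exists h, 1, [set v : X1 | forall l, U 0 (v 0 l)]; split.
- exact: md_h MD.
- by rewrite mulfV // pnatr_eq0 -lt0n (md_h MD).
- split; last first.
    move=> y; have [a ha] := choice (fun l => U_exhaust LD EC (y 0 l)).
    have [_ [_ _ [c hc ec]]] := z_pe (\sum_l a l).
    exists (\sum_l a l)%N => l; rewrite mxE -exprnP rmorphXn -ec -mulrA; apply: UM => //.
    by rewrite (bigD1 l) //= addnC exprD -mulrA; apply: UM.
  split.
    split=> [l|c x y hc hx hy l]; rewrite !mxE //.
    by apply: UDD; [exact: UM|exact: hy].
  exists h, (fun k => delta_mx 0 k), (fun k (v : X1) => v 0 k); split.
  + by move=> k l; rewrite mxE; case: (_ && _).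
  + by move=> k y; exact.
  + by move=> k c y y' _ _ _; rewrite !mxE.
  + by move=> y _; exact: row_sum_delta.
have [a [ha ea [a' ha' ea']]] := z_pe 1; rewrite !expr1 in ea ea'.
rewrite expr1z; apply/seteqP; split=> y.
  move=> [n [c [x [hc hx ->]]]]; set y1 := \sum_k _.
  have hy l : exists t, U 0 t /\ y1 0 l = i z * t.
    suff /(U_div LD EC)[t [ht ->]] : U 1 (y1 0 l).
      by exists (a * t); split; [exact: UM|rewrite expr1 -ea mulrCA mulrA].
    rewrite summxE; apply: Usum => k _; rewrite mxE; apply: UM => //.
    have [v hv <-] := hx k; rewrite -[v]ofX1K -toX1_iter mxE.
    have [|hh _] := @Fl_yc 1 (iter (h * d) tau (ofX1 v)); last exact: hh.
    rewrite mul1n -[X in Fl X _]add0n; apply: iter_tau_Fl; apply: Lat0_Fl.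
    exact: comb_Lat.
  have [t ht] := choice hy; exists (\row_l t l) => [l|].
    by rewrite mxE; have [] := ht l.
  by apply/rowP => l; rewrite !mxE; have [_ ->] := ht l.
move=> [v hv <-].
have /Lat_Fl hF : Lat 1 (pe *: ofX1 v).
  by rewrite -[X in Lat X _]addn0; apply: LatZ => //; exact: comb_Lat.
rewrite mul1n in hF; have [s [hs es]] := Fl_tau_iter hF.
have -> : i z *: v = \sum_(x <- s) (a' * x.1) *: iter (h * d) tauX1 (toX1 x.2).
  have -> : i z *: v = a' *: toX1 (pe *: ofX1 v).
    have to0 : toX1 0 = 0 by apply/toX1_eq0; case: N0_sub.
    by rewrite -[pe *: _]addr0 toX1L to0 addr0 ofX1K scalerA ea'.
  rewrite es (linear_sum_seq (f := toX1)); last exact: toX1L.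
  by rewrite scaler_sumr; apply: eq_bigr => x _; rewrite scalerA toX1_iter.
apply: span_seq => x /hs[h1 h2]; split; first exact: UM.
by exists (toX1 x.2) => // l; rewrite mxE; have [hh _] := Lat_yc h2; exact: hh.
Qed.

Definition Fil (alpha : rat) : set N :=
  if alpha < 0 then [set 0] else if alpha < h%:R^-1 then N0 else setT.

Let h_inv_gt0 : 0 < (h%:R : rat)^-1.
Proof. by rewrite invr_gt0 ltr0n (md_h MD). Qed.

Lemma Fil_neg alpha : alpha < 0 -> Fil alpha = [set 0].
Proof. by rewrite /Fil => ->. Qed.

Lemma Fil_mid alpha : 0 <= alpha -> alpha < h%:R^-1 -> Fil alpha = N0.
Proof. by rewrite /Fil [alpha < 0]ltNge => -> ->. Qed.

Lemma Fil_top alpha : h%:R^-1 <= alpha -> Fil alpha = setT.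
Proof.
by move=> ha; rewrite /Fil !ltNge ha (le_trans (ltW h_inv_gt0) ha).
Qed.

Variant slope_cases (alpha : rat) : Prop :=
| SlopeNeg of alpha < 0
| Slope0 of alpha = 0
| SlopeMid of 0 < alpha & alpha < h%:R^-1
| Slope1 of alpha = h%:R^-1
| SlopeTop of h%:R^-1 < alpha.

Lemma slopeP alpha : slope_cases alpha.
Proof.
have [a0|a0|a0] := ltrgt0P alpha; [|exact: SlopeNeg|exact: Slope0].
by have [a1|a1|a1] := ltgtP alpha h%:R^-1; [exact: SlopeMid|exact: SlopeTop|exact: Slope1].
Qed.

Lemma Fil_le alpha beta : alpha <= beta -> Fil alpha `<=` Fil beta.
Proof.
move=> ab x; have [b0|b0] := ltP beta 0.
  by rewrite !Fil_neg //; exact: le_lt_trans b0.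
have [b1|b1] := ltP beta h%:R^-1; last by rewrite (Fil_top b1).
rewrite (Fil_mid b0 b1); have [a0|a0] := ltP alpha 0.
  by rewrite Fil_neg // => ->; case: N0_sub.
by rewrite Fil_mid //; exact: le_lt_trans b1.
Qed.

Lemma fil_ltE alpha beta : beta < alpha ->
  (forall gamma, gamma < alpha -> Fil gamma `<=` Fil beta) ->
  fil_lt Fil alpha = Fil beta.
Proof.
move=> ba hb; apply/seteqP; split=> [x [gamma ga hx]|x hx]; first exact: hb ga x hx.
by exists beta.
Qed.

Lemma fil_lt_neg alpha : alpha <= 0 -> fil_lt Fil alpha = [set 0].
Proof.
move=> a0; rewrite -(@Fil_neg (alpha - 1)); last by rewrite subr_lt0 (le_lt_trans a0).
apply: fil_ltE; first by rewrite ltrBlDr ltrDl.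
by move=> gamma ga; rewrite !Fil_neg ?(lt_le_trans ga) // subr_lt0 (le_lt_trans a0).
Qed.

Lemma fil_lt_mid alpha : 0 < alpha -> alpha <= h%:R^-1 -> fil_lt Fil alpha = N0.
Proof.
move=> a0 a1; rewrite -(@Fil_mid 0) //; apply: fil_ltE => // gamma ga.
have [g0|g0] := ltP gamma 0; first by apply: Fil_le; exact: ltW.
by rewrite !Fil_mid // (lt_le_trans ga).
Qed.

Lemma fil_lt_top alpha : h%:R^-1 < alpha -> fil_lt Fil alpha = setT.
Proof.
by move=> a1; rewrite -(Fil_top (lexx _)); apply: fil_ltE => // gamma _; rewrite (Fil_top (lexx _)).
Qed.

Lemma zero_subquotient (P : set N) : P 0 ->
  is_subquotient tau P P (id : 'rV[E]_0 -> 'rV[E]_0) (fun=> 0).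
Proof.
move=> P0; split=> [||x Px|]; try by move=> *; exact: rV0_eq.
  by move=> t; exists 0 => //; exact: rV0_eq.
by split.
Qed.

Lemma X0_subquotient : is_subquotient tau N0 [set 0] tauX0 toX0.
Proof.
split=> [e0 x y _ _|t|x hx|x hx].
- exact: toX0L.
- by exists (val t); [exact: sublmodP|exact: toX0K].
- split=> [h0|-> /=]; first by rewrite -(val_toX0 hx) h0.
  by apply: val_inj; rewrite val_toX0 //; case: N0_sub.
- by rewrite /tauX0 val_toX0.
Qed.

Lemma X1_subquotient : is_subquotient tau setT N0 tauX1 toX1.
Proof.
split=> [e0 x y _ _|t|x _|x _]; [exact: toX1L| |exact: toX1_eq0|exact: toX1_tau].
by exists (ofX1 t) => //; exact: ofX1K.
Qed.

Lemma N_subquotient : is_subquotient tau setT [set 0] tau id.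
Proof. by split=> // t; exists t. Qed.

Lemma motive_slopes : slope_filtration sigma (U 0%N) zE d tau Fil.
Proof.
have ip : 0 < (h%:R : rat)^-1 := h_inv_gt0.
split.
- move=> alpha; rewrite /Fil; case: ifP => _; last by case: ifP => _; [exact: N0_sub|split].
  by split=> // c x y _ -> -> /=; rewrite scaler0 addr0.
- move=> alpha x; rewrite /Fil; case: ifP => _; first by move=> ->; exact: tau0.
  by case: ifP => _ //; exact: tau_N0.
- move=> alpha; have [a0|a0] := ltP alpha 0.
    rewrite Fil_neg //; exists 'rV[E]_0, id, (fun=> 0); split; last exact: rV0_isocrystal.
    exact: zero_subquotient.
  have [a1|a1] := ltP alpha h%:R^-1.
    by rewrite Fil_mid //; exists X0, tauX0, toX0; split; [exact: X0_subquotient|exact: X0_isocrystal].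
  by rewrite Fil_top //; exists N, tau, id; split; [exact: N_subquotient|exact: motive_isocrystal].
- exact: Fil_le.
- by move=> x /(_ (-1)); rewrite Fil_neg.
- by move=> x; exists h%:R^-1; rewrite Fil_top.
(* The midpoint between [alpha] and the next jump lies in the same interval of constancy. *)
- move=> alpha x hx; have [a0|a0] := ltP alpha 0.
    have [l1 l2] := midf_lt a0.
    by have := hx _ l1; rewrite !Fil_neg.
  have [a1|a1] := ltP alpha h%:R^-1; last by rewrite Fil_top.
  have [l1 l2] := midf_lt a1.
  by have := hx _ l1; rewrite !Fil_mid // (le_trans a0) // ltW.
- move=> alpha; case: (slopeP alpha) => [a0|->|a0 a1|->|a1].
  + rewrite fil_lt_neg ?Fil_neg ?ltW //; exists 'rV[E]_0, id, (fun=> 0).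
    by split; [exact: zero_subquotient|exact: rV0_isocrystal|exact: rV0_pure].
  + rewrite fil_lt_neg ?Fil_mid //; exists X0, tauX0, toX0.
    by split; [exact: X0_subquotient|exact: X0_isocrystal|exact: X0_pure].
  + rewrite fil_lt_mid ?Fil_mid ?ltW //; exists 'rV[E]_0, id, (fun=> 0).
    by split; [apply: zero_subquotient; case: N0_sub|exact: rV0_isocrystal|exact: rV0_pure].
  + rewrite fil_lt_mid ?Fil_top //; exists X1, tauX1, toX1.
    by split; [exact: X1_subquotient|exact: X1_isocrystal|exact: X1_pure].
  + rewrite fil_lt_top ?Fil_top ?ltW //; exists 'rV[E]_0, id, (fun=> 0).
    by split; [exact: zero_subquotient|exact: rV0_isocrystal|exact: rV0_pure].
Qed.

Lemma motive_multiplicity r : has_rank X0 (r - h) -> has_rank X1 h ->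
  forall alpha, slope_multiplicity tau Fil alpha
    (if alpha == 0 then (r - h)%N else if alpha == h%:R^-1 then h else 0%N).
Proof.
have ip : 0 < (h%:R : rat)^-1 := h_inv_gt0.
move=> r0 r1 alpha; case: (slopeP alpha) => [a0|->|a0 a1|->|a1].
- rewrite lt_eqF // lt_eqF ?(lt_trans a0 ip) //; exists 'rV[E]_0, id, (fun=> 0).
  rewrite fil_lt_neg ?Fil_neg ?ltW //.
  by split; [exact: zero_subquotient|exact: rV0_rank].
- rewrite eqxx; exists X0, tauX0, toX0; rewrite fil_lt_neg ?Fil_mid //.
  by split=> //; exact: X0_subquotient.
- rewrite gt_eqF // lt_eqF //; exists 'rV[E]_0, id, (fun=> 0).
  rewrite fil_lt_mid ?Fil_mid ?ltW //.
  by split; [apply: zero_subquotient; case: N0_sub|exact: rV0_rank].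
- rewrite gt_eqF // eqxx; exists X1, tauX1, toX1; rewrite fil_lt_mid ?Fil_top //.
  by split=> //; exact: X1_subquotient.
- rewrite gt_eqF ?(lt_trans ip a1) // gt_eqF //; exists 'rV[E]_0, id, (fun=> 0).
  rewrite fil_lt_top ?Fil_top ?ltW //.
  by split; [exact: zero_subquotient|exact: rV0_rank].
Qed.

End Slopes.


(** * Ranks of the isocrystal and of its two slope pieces *)

Lemma G0_mul (k : 'I_m) f y y' : U 0 y -> U 0 y' ->
  G 0 k f (y * y') = \sum_(l < m) G 0 l f y * G 0 k (ttau ^+ l) y'.
Proof.
move=> hy hy'; move: y hy; apply: (@dens_eq _ 1 (fun y => G 0 k f (y * y'))
    (fun y => \sum_(l < m) G 0 l f y * G 0 k (ttau ^+ l) y')).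
- by move=> x x'; rewrite mulrDl GD.
- by move=> x x'; rewrite -big_split; apply: eq_bigr => l _; rewrite GD mulrDl.
- by move=> x hx; apply: GU; rewrite mulrC; exact: UM.
- by move=> x hx; rewrite big1 // => l _; rewrite GU // mul0r.
move=> a xi; set f' := f * phi (ep 1 * a).
(* Inserting [ep 1] is harmless: the difference has a factor in [U 1], which [G 0] kills. *)
have e1 : G 0 k f (iA a * j xi * y') = xi * G 0 k f' y'.
  have -> : iA a * j xi * y' = j xi * (iA (ep 1 * a) * y') + (1 - iA (ep 1)) * (iA a * j xi * y').
    by rewrite /= !rmorphM; ring.
  rewrite GD [X in _ + X]GU ?addr0; last first.
    by rewrite mulrC; apply: UM; [apply: UM => //; exact: UM|exact: U_1ep].
  by rewrite G_j ?G_phi //; apply: UM.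
have [g eg] := digit0_expand (md_size MD) (md_lead MD) f'.
rewrite e1 eg G_add // [G 0 k (g * _) y']G_phi // G_p0 // addr0.
have D0 : G 0 k 0 y' = 0.
  by have := G_cst 0 k 0 0 hy'; rewrite cst0 mul0r rmorph0 mul0r.
rewrite (big_morph (fun f => G 0 k f y') (fun f1 f2 => G_add 0 k f1 f2 hy') D0) mulr_sumr.
by apply: eq_bigr => l _; rewrite G_cst // GE /lam -/f'; ring.
Qed.

Local Notation PhiN := (pres_mx (fun k : 'I_m => u (ttau ^+ k)) crd).

Lemma PhiN_int k l : U 0 (PhiN k l).
Proof. by rewrite mxE crd_u; exact: coord_int. Qed.

Let kX s y := kap (X s y).

Let kXB s x y : U 0 x -> U 0 y -> kX s (x - y) = kX s x - kX s y.
Proof.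
by move=> _ _; rewrite /kX -rmorphB; congr (kap _); exact: (X_B EC (cdXD CD) (cdXU CD)).
Qed.

Let kXM s x y : U 0 x -> U 0 y -> kX s (x * y) = kX s x * kX s y.
Proof. by move=> hx hy; rewrite /kX (cdXM CD) // rmorphM. Qed.

Let kX1 s : kX s 1 = 1.
Proof. by rewrite /kX -(rmorph1 j) (cdXj CD) rmorph1. Qed.

(** Reduction modulo [pe] of the action of the idempotent [e s], written in the powers of [tau]
    modulo [phi p]. *)
Definition compQ s : 'M[K]_m := \matrix_(l, k) kap (G 0 k (ttau ^+ (l : 'I_m)) (e s)).

Lemma map_PhiN (s : 'I_d) : map_mx (kX s) PhiN = compQ s.
Proof.
apply/matrixP => l k; rewrite !mxE crd_u /kX; congr (kap _).
rewrite /coord /coordH (X_sum EC (cdXD CD) (cdXU CD)) (bigD1 s) //= [X in _ + X]big1 ?addr0.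
  rewrite /compH (cdXM CD) ?(cdXe CD) ?eqxx ?mul1r //; last exact: ser_int.
  rewrite mulr1; apply/eqP; rewrite -subr_eq0 -[X in _ - X == _](cdXj CD s).
  rewrite -(X_B EC (cdXD CD) (cdXU CD)) (cdXU CD) //.
  by have := ser_approx LD EC (fun n => G n k (ttau ^+ l) (e s)) 1; rewrite big_ord1 expr0 mul1r.
move=> t ts; rewrite /compH (cdXM CD) ?(cdXe CD) //; last exact: ser_int.
by rewrite !modn_small // eq_sym (negbTE (ts : (t : nat) != s)) mul0r.
Qed.

Lemma compQ_mul (s t : 'I_d) : compQ s *m compQ t = if s == t then compQ s else 0.
Proof.
have -> : compQ s *m compQ t = \matrix_(l, k) kap (G 0 k (ttau ^+ (l : 'I_m)) (e s * e t)).
  apply/matrixP => l k; rewrite !mxE G0_mul // rmorph_sum; apply: eq_bigr => a _.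
  by rewrite !mxE rmorphM.
have [<-|st] := eqVneq; first by rewrite (cde_idem CD).
apply/matrixP => l k; rewrite !mxE (cde_orth CD) ?G0 ?rmorph0 //.
by rewrite !modn_small.
Qed.

(** Links the ranks of the components to the dimension count for the [wp]-primary part, since the
    idempotents sum to [1] and [ep 1] is the projection onto that part. *)
Lemma compQ_sum : \sum_(s < d) compQ s =
  map_mx (kap \o rho) (dg_mx (md_size MD) (md_lead MD) m (ep 1)).
Proof.
apply/matrixP => l k; rewrite summxE !mxE.
under eq_bigr => s _ do rewrite mxE.
rewrite -rmorph_sum -(big_morph _ (GD 0 k (ttau ^+ l)) (G0 0 k _)) (cde_sum CD).
have -> : 1 = iA 1 * j 1 by rewrite !rmorph1 mulr1.
by rewrite GE mulr1 /lam mulr1.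
Qed.

(* Comparison with [crd_presents] shows that [sigma] preserves the rank of [N]. *)
Lemma sigma_presents : exists c : 'I_m -> N -> E,
  presents (fun k => tau (u (ttau ^+ (k : 'I_m)))) c /\ forall k y, c k (tau y) = sigma (crd k y).
Proof.
have ex k : exists H : N -> E^o, linear H /\ forall x, H (tau x) = sigma (crd k x).
  apply: linearize; split=> [x y|a x].
    by rewrite -rmorphD -[x]scale1r crdL scale1r mul1r.
  by rewrite -[a *: x]addr0 crdL crd0 addr0 rmorphM.
have [c hc] := choice ex; exists c; split; last by move=> k; have [] := hc k.
have cL k a y y' : c k (a *: y + y') = a * c k y + c k y' by have [+ _] := hc k; apply.
split=> // y; have [s ->] := tau_spans y.
have L2 : linear (fun y => \sum_k c k y *: tau (u (ttau ^+ (k : 'I_m)))).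
  move=> a y1 y2; rewrite scaler_sumr -big_split; apply: eq_bigr => k _.
  by rewrite cL scalerDl scalerA.
rewrite (linear_sum_seq _ _ _ L2); apply: eq_bigr => x _; congr (_ *: _).
rewrite {1}(proj2 crd_presents x.2) tau_sum; apply: eq_bigr => k _.
by rewrite tauZ; have [_ ->] := hc k.
Qed.

Lemma PhiN_sigma (k : fieldType) (ev : {rmorphism E -> k}) :
  \rank (map_mx (ev \o sigma) PhiN) = \rank (map_mx ev PhiN).
Proof.
have [c [Pc hc]] := sigma_presents.
rewrite (pres_rank_eq ev crd_presents Pc); congr (\rank _).
by apply/matrixP => a b'; rewrite !mxE hc.
Qed.

(** The character [kX s] is a ring homomorphism on [U 0], where the entries of [PhiN] lie, and it
    kills every integral element that [e s] kills. *)
Lemma compQ_rank (s : 'I_d) (k : fieldType) (ev : {rmorphism E -> k}) :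
  (forall y, ev y = 0 <-> e s * y = 0) -> \rank (compQ s) = \rank (map_mx ev PhiN).
Proof.
move=> evs; rewrite -map_PhiN.
apply: (rank_map_idem_on U1 (UB (n := 0)) (UM (n := 0)) (kX1 s) (@kXB s) (@kXM s)).
- exact: pres_mx_idem crd_presents.
- exact: PhiN_int.
move=> x hx /evs ex; have := kXM s (Ue s) hx.
rewrite ex /kX (cdXe CD) eqxx rmorph1 mul1r => <-.
by rewrite (X_0 EC (cdXU CD)) rmorph0.
Qed.

Variable r : nat.
Hypothesis rank_ep :
  \rank (map_mx (kap \o rho) (dg_mx (md_size MD) (md_lead MD) m (ep 1))) = (r * d)%N.

Let idP : PhiN *m PhiN = PhiN. Proof. exact: pres_mx_idem crd_presents. Qed.

(** [sigma] maps elements killed by [e s] to elements killed by [e s.+1], and it does not change the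
    rank by [PhiN_sigma]; so the rank passes from each component to the next. *)
Lemma component_rank_const s (k0 k : fieldType) (ev0 : {rmorphism E -> k0})
    (ev : {rmorphism E -> k}) :
  (forall y, ev0 y = 0 <-> e 0 * y = 0) -> (forall y, ev y = 0 <-> e s * y = 0) ->
  \rank (map_mx ev PhiN) = \rank (map_mx ev0 PhiN).
Proof.
move=> h0; elim: s k ev => [|s IH] k ev hs.
  by apply: (rank_map_idem idP) => x /h0/hs.
have [k1 [ev1 h1]] := residue_field_exists (comp_prime LD EC CD s).
rewrite -(IH _ ev1 h1) -PhiN_sigma; apply: (rank_map_idem idP) => x /h1 ex /=; apply/hs.
by rewrite -(cde_sigma CD) -rmorphM ex rmorph0.
Qed.

Lemma motive_rank (k : fieldType) (ev : {rmorphism E -> k}) : \rank (map_mx ev PhiN) = r.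
Proof.
have [k0 [ev0 h0]] := residue_field_exists (comp_prime LD EC CD 0).
have rk (s : 'I_d) : \rank (compQ s) = \rank (map_mx ev0 PhiN).
  have [k1 [ev1 h1]] := residue_field_exists (comp_prime LD EC CD s).
  by rewrite (compQ_rank (s := s) h1); exact: component_rank_const h0 h1.
have r0 : \rank (map_mx ev0 PhiN) = r.
  have := rank_ep; rewrite -compQ_sum mxrank_sum_orth.
  - rewrite (eq_bigr _ (fun s _ => rk s)) sum_nat_const card_ord mulnC => /eqP.
    by rewrite eqn_pmul2r ?(cd_d CD) // => /eqP.
  - by move=> s; rewrite compQ_mul eqxx.
  - by move=> s t st; rewrite compQ_mul (negbTE st).
(* Some idempotent survives in [k]. Then everything killed by [e s] is killed by [ev], and the rank
   is that of component [s]. *)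
have [s hs] : exists s : 'I_d, ev (e s) <> 0.
  apply: contrapT => /forallNP hn; have := congr1 ev (cde_sum CD).
  rewrite rmorph_sum rmorph1 big1 => [/esym/eqP|s _]; first by rewrite oner_eq0.
  by apply: contrapT; exact: hn.
have [k1 [ev1 h1]] := residue_field_exists (comp_prime LD EC CD s).
rewrite -r0 -(component_rank_const h0 h1); apply: (rank_map_idem idP) => x /h1 /= ex.
have := congr1 ev ex; rewrite rmorphM rmorph0 => /eqP; rewrite mulf_eq0 => /orP[]/eqP //.
Qed.

Lemma X1_rank : has_rank X1 h.
Proof.
move=> P /residue_field_exists[k [ev hev]].
apply: (local_basis X1_presents hev).
have -> : pres_mx (fun k : 'I_h => delta_mx 0 k : X1) (fun k (v : X1) => v 0 k) = 1%:M.
  by apply/matrixP => a c; rewrite !mxE eqxx eq_sym.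
by rewrite map_mx1 mxrank1.
Qed.

Lemma pr0_yc y l : yc (pr0 y) l = 0.
Proof. by have /yc_N0 := pr0_N0 y. Qed.

(** A dual basis adapted to the decomposition of [N] into [N0] and the span of the [yb]. Its matrix
    is block diagonal, and the rank of [N0] follows by subtraction. *)
Lemma N_split_presents : presents
  (fun k : 'I_(m + h) => match split k with inl a => pr0 (u (ttau ^+ a)) | inr l => yb l end)
  (fun k y => match split k with inl a => crd a (pr0 y) | inr l => yc y l end).
Proof.
split=> [k c y y'|y].
  by case: split => a; rewrite ?pr0L ?crdL ?ycL.
rewrite big_split_ord /= {1}[y](toX1_decomp y) [X in X = _]addrC; congr (_ + _).
  rewrite {1}(N0_expand (pr0_N0 y)); apply: eq_bigr => a _.
  by rewrite (unsplitK (inl a)).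
apply: eq_bigr => l _; by rewrite (unsplitK (inr l)) mxE.
Qed.

Lemma X0_rank : has_rank X0 (r - h).
Proof.
move=> P /residue_field_exists[k [ev hev]].
apply: (local_basis X0_presents hev).
have rN := motive_rank ev; rewrite (pres_rank_eq ev crd_presents N_split_presents) in rN.
set Phi0 := pres_mx _ _; move: rN.
have -> : pres_mx
  (fun k : 'I_(m + h) => match split k with inl a => pr0 (u (ttau ^+ a)) | inr l => yb l end)
  (fun k y => match split k with inl a => crd a (pr0 y) | inr l => yc y l end) =
  block_mx Phi0 0 0 1%:M.
  have pr0_yb l : pr0 (yb l) = 0.
    rewrite /pr0; have -> : yb l = comb (fun l' => (l' == l)%:R).
      by rewrite /comb (bigD1 l) //= eqxx scale1r big1 ?addr0 // => l' /negbTE ->; rewrite scale0r.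
    by rewrite yc_comb subrr.
  have yc_yb l l' : yc (yb l) l' = (l' == l)%:R.
    have -> : yb l = comb (fun l' => (l' == l)%:R).
      by rewrite /comb (bigD1 l) //= eqxx scale1r big1 ?addr0 // => a /negbTE ->; rewrite scale0r.
    by rewrite yc_comb.
  apply/matrixP => a c; rewrite [LHS]mxE -[a]splitK -[c]splitK !unsplitK.
  case: (split a) => a'; case: (split c) => c' /=.
  - by rewrite block_mxEul mxE (pr0_id (pr0_N0 _)).
  - by rewrite block_mxEur mxE pr0_yc.
  - by rewrite block_mxEdl mxE pr0_yb crd0.
  - by rewrite block_mxEdr mxE yc_yb eq_sym.
rewrite map_block_mx !map_mx0 map_mx1 rank_diag_block_mx mxrank1 => <-.
by rewrite addnK.
Qed.

Theorem motive_isocrystal_slopes z : w z = 1 ->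
  is_isocrystal sigma tau /\ exists Fil : rat -> set N,
    slope_filtration sigma (U 0%N) (fun k : int => i (z ^ k)) d tau Fil /\
    forall alpha, slope_multiplicity tau Fil alpha
      (if alpha == 0 then (r - h)%N else if alpha == h%:R^-1 then h else 0%N).
Proof.
move=> wz; split; first exact: motive_isocrystal.
exists Fil; split; first exact: motive_slopes.
by move=> alpha; apply: motive_multiplicity; [exact: X0_rank|exact: X1_rank].
Qed.

End Motive.

(** * Transfer of the height from [phi a_wp] to [phi p] *)

Section ConstantTerm.
Variables (Fq : finFieldType) (R : idomainType) (iR : {rmorphism Fq -> R}).
Local Notation T := (twpoly iR).

Definition tconst (f : T) : R := tcoef f 0.

Lemma tconst_zmod : zmod_morphism tconst.
Proof. by move=> f g; rewrite /tconst tcoefD tcoefN. Qed.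

Lemma tconst_monoid : monoid_morphism tconst.
Proof.
split=> [|f g]; first by rewrite /tconst [LHS]coefC.
by rewrite /tconst tcoefM big_ord1 subnn expn0 expr1.
Qed.

HB.instance Definition _ := GRing.isZmodMorphism.Build T R tconst tconst_zmod.
HB.instance Definition _ := GRing.isMonoidMorphism.Build T R tconst tconst_monoid.

(** Over a domain the lowest coefficient of [f ^+ n] is a product of powers of that of [f], so the
    first equation bounds the order of [f] below. The second shows that the coefficient of [f] in
    degree [D] divides that of [g] in degree [n * D]. *)
Lemma order_root (f g x y c : T) n D : (0 < n)%N ->
  f ^+ n = x * g -> c * g = f ^+ n * y -> low_ge (n * D) g -> tcoef c 0 = 1 ->
  low_ge D f /\ exists z, tcoef f D * z = tcoef g (n * D).
Proof.
move=> n0 fg cg gl c1.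
have fl : low_ge D f.
  move=> k; elim/ltn_ind: k => k IH kD.
  have fk : low_ge k f by move=> l lk; apply: IH => //; exact: ltn_trans kD.
  have [_ e1] := low_geX n fk.
  have e0 : tcoef (f ^+ n) (n * k) = 0.
    by rewrite fg; apply: (low_ge_add_l x gl); rewrite ltn_pmul2l.
  move: e1; rewrite e0 => /esym/eqP/prodf_eq0[i _].
  by rewrite expf_eq0 => /andP[_ /eqP].
split=> //; case: n n0 fg cg gl => // n _ fg cg gl.
have [hl e1] := low_geX n.+1 fl.
have [_ e2] := low_geM (@low_ge0 _ _ _ c) gl.
have [_ e3] := low_geM hl (@low_ge0 _ _ _ y).
exists (\prod_(i < n) tcoef f D ^+ (#|Fq| ^ (lift ord0 i * D)) * tcoef y 0 ^+ (#|Fq| ^ (n.+1 * D))).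
move: e2; rewrite add0n c1 mul1r expn0 expr1 => <-; rewrite cg.
by rewrite addn0 in e3; rewrite e3 e1 big_ord_recl mul0n expn0 expr1 mulrA.
Qed.

End ConstantTerm.

Theorem proposition17p6
  (* the curve [C], the point [infty], and the ring [A := coord_ring infty] *)
  (Fq : finFieldType) (F : fieldType) (iF : {rmorphism Fq -> F})
  (F_curve : function_field iF)
  (infty : F -> int) (infty_place : is_place infty)
  (* the base ring [R] and the Drinfeld module [phi] of rank [r] *)
  (R : idomainType) (iR : {rmorphism Fq -> R}) (R_noeth : noetherian R)
  (r : nat) (r_ge1 : (1 <= r)%N)
  (phi : {rmorphism coord_ring infty -> twpoly iR})
  (phi_drinfeld : is_drinfeld iF r phi)
  (* the maximal ideal [wp := ker_cstar phi], and [a_wp], [h], [eps_wp] *)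
  (wp_max : maximal_ideal (ker_cstar phi))
  (a_wp : coord_ring infty) (n_wp : nat) (n_wp_ge1 : (1 <= n_wp)%N)
  (a_wp_gen : principal_ideal a_wp = ideal_exp (ker_cstar phi) n_wp)
  (h : nat) (h_bounds : (1 <= h <= r)%N) (eps : R) (eps_neq0 : eps != 0)
  (h_low : forall k, (k < h * degA iF a_wp)%N -> (phi a_wp : {poly R})`_k = 0)
  (h_eps : (phi a_wp : {poly R})`_(h * degA iF a_wp) = eps)
  (* the closed point [v] of [C] given by [wp] and the completion [Fp] of [F] *)
  (v : F -> int) (v_place : is_place v) (v_finite : v <> infty)
  (v_wp : forall a : coord_ring infty,
     ker_cstar phi a <-> val_ge v 1 (coord_val a))
  (Fp : fieldType) (iFp : {rmorphism F -> Fp}) (w : Fp -> int)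
  (Fp_compl : is_completion v iFp w)
  (z : Fp) (z_unif : w z = 1)
  (* the completed tensor product [E] of [Fp] and [R[1/eps]] *)
  (E : comNzRingType) (i : {rmorphism Fp -> E})
  (j : {rmorphism away eps -> E}) (U : nat -> set E)
  (E_ctensor : is_ctensor (iFp \o iF) w (to_away eps \o iR) i j U)
  (sigma : {rmorphism E -> E}) (sigma_frob : is_frobenius #|Fq| i j U sigma)
  (* the base change [N] of the motive of [phi], with its induced [tau] *)
  (N : lmodType E) (u : twpoly iR -> N)
  (N_base_change :
     is_base_change
       (fun s : coord_ring infty * R =>
          i (iFp (coord_val s.1)) * j (to_away eps s.2))
       (motive_act phi) u)
  (tau : N -> N)
  (tau_semilinear : semilinear_map sigma (fun e (x : N) => e *: x) tau)
  (tau_motive : forall m : twpoly iR, tau (u m) = u (twtau iR * m)) :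
  is_isocrystal sigma tau /\
  exists Fil : rat -> set N,
    slope_filtration sigma (U 0%N) (fun m : int => i (z ^ m))
      (quotient_dim (iFp \o iF) (val_ge w 0) (val_ge w 1)) tau Fil /\
    forall alpha : rat,
      slope_multiplicity tau Fil alpha
        (if alpha == 0 then (r - h)%N else if alpha == h%:R^-1 then h else 0%N).
Proof.
set wp := ker_cstar phi in wp_max a_wp_gen v_wp *.
set t := a_wp; pose cv := @coord_val F infty.
have /andP[h0 hr] := h_bounds.
have t0 : t != 0.
  by apply: contra_neq eps_neq0 => t0; rewrite -h_eps -/t t0 rmorph0 coef0.
have wpt : wp t := wp_t wp_max n_wp_ge1 a_wp_gen.
(* In degree [0] the element [eps] would be the constant coefficient of [phi t], which vanishes
   because [t] lies in [wp]. *)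
have D0 : (0 < degA iF t)%N.
  rewrite lt0n; apply: contra_neq eps_neq0 => D0.
  by rewrite -h_eps D0 muln0; exact: wpt.
have [p [s [vp ns ps]]] :=
  uniformizer_exists F_curve v_place v_finite wp_max v_wp n_wp_ge1 a_wp_gen t0.
have [s' e1] := wp_inv_mod wp_max ns; pose e := s * s'.
have [d [b _ hb']] := residue_basis v_place v_finite wp_max v_wp n_wp_ge1 a_wp_gen t0 vp ps
  (erefl e) e1 D0.
have hb a : exists! c, wp (a - lcomb iF b c) by exact: hb'.
have tD : degA iF t = (n_wp * d)%N := degA_factor v_place v_finite wp_max v_wp n_wp_ge1
  a_wp_gen t0 vp ps (erefl e) e1 D0 hb.
have wP := compl_place Fp_compl.
have conv k (x : F) : val_ge w k (iFp x) <-> val_ge v k x.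
  rewrite /val_ge /= (compl_ext Fp_compl).
  split=> -[h1|]; [left|by right|left|by right]; last by rewrite h1 rmorph0.
  by apply/eqP; rewrite -(fmorph_eq0 iFp) h1.
pose ia : {rmorphism coord_ring infty -> Fp} := iFp \o (val : coord_ring infty -> F).
pose rho : {rmorphism R -> away eps} := to_away eps.
pose kap : {rmorphism away eps -> {fraction R}} := (val : away eps -> {fraction R}).
pose chi : {rmorphism coord_ring infty -> R} := @tconst _ _ iR \o phi.
have chiE a : chi a = 0 <-> wp a by [].
have tofrac_inj : injective (@FracField.tofrac R).
  by move=> x y /eqP; rewrite -subr_eq0 -tofracB tofrac_eq0 subr_eq0 => /eqP.
have dense y (k : nat) : val_ge w 0 y -> exists a, val_ge w k%:Z (y - ia a).
  move=> hy; have [x hx] := compl_dense Fp_compl y k.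
  have hx0 : val_ge v 0 x.
    apply/conv; have -> : iFp x = y - (y - iFp x) by rewrite opprB addrC subrK.
    by apply: (val_geB wP) => //; apply: val_geW hx.
  have [a ha] := coord_dense F_curve v_place v_finite wp_max v_wp n_wp_ge1 a_wp_gen t0 vp ps
    (erefl e) e1 k hx0.
  exists a; have -> : y - ia a = (y - iFp x) + iFp (x - cv a).
    by rewrite rmorphB addrA subrK.
  by apply: (placeD wP) => //; apply/conv.
have LD : local_data (iFp \o iF) w iR (to_away eps \o iR) rho kap
    (coord_const iF infty) ia p chi b.
  split=> //.
  - by move=> a; apply/conv; exact: coord_val_ge0.
  - by rewrite /= (compl_ext Fp_compl).
  - exact: val_inj.
  - by move=> x y /(congr1 val)/tofrac_inj.
  - by move=> a; split=> [/v_wp/conv|/conv/v_wp].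
  - move=> c; rewrite /chi /= (drinfeld_const phi_drinfeld) /tconst.
    by rewrite [LHS]coefC.
  - move=> a; have [c [hc uc]] := hb a; exists c; split=> [|c' hc'].
      by apply/conv/v_wp.
    by apply: uc; apply/v_wp/conv.
  - exact: (residue_char_frob wp_max hb chiE).
  - by move=> *; exact: (residue_char_distinct wp_max hb chiE).
  - move=> a a0; have na : ~ wp a by move/chiE => /eqP; exact/negP.
    have [a' ha'] := wp_inv_mod wp_max na; exists a'.
    have hc : chi (1 - a * a') = 0 := ha'.
    by move/eqP: hc; rewrite rmorphB rmorph1 rmorphM subr_eq0 eq_sym => /eqP.
have [X [es CD]] := comp_data_exists LD E_ctensor sigma_frob.
pose ep := approx_idem e.
have ep_val k : val_ge v k%:Z (cv (1 - ep k)).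
  exact: (approx_idem_val v_place wp_max v_wp e1 k).
have ep_div k m a : (m <= k)%N -> val_ge v m%:Z (cv a) -> exists a', ep k * a = p ^+ m * a'.
  exact: (approx_idem_div v_place v_finite v_wp n_wp_ge1 t0 vp ps (erefl e)).
have pval := principal_val v_place v_finite wp_max v_wp n_wp_ge1 a_wp_gen t0 vp ps (erefl e) e1.
have p_neq0 : p != 0.
  by apply/eqP => p0; move: vp; rewrite p0 (place0 v_place).
have h3 : exists x, p ^+ n_wp = x * t.
  by apply/pval; right; rewrite (unif_pow_val v_place n_wp_ge1 t0 vp).
have vt : val_ge v n_wp%:Z (cv t) by apply/pval; exists 1; rewrite mul1r.
have h4 : exists x, ep n_wp * t = p ^+ n_wp * x by exact: ep_div.
have h5 : exists x, 1 - ep n_wp = x * t by apply/pval.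
have h1 : exists x, t * ep 1 = x * p.
  have [|x hx] := @ep_div 1 1%N t (leqnn _); first by apply/v_wp.
  by exists x; rewrite mulrC hx expr1 mulrC.
have h2 : exists x y, 1 - ep 1 = x * p + y * t.
  have [x hx] := @ep_div n_wp 1%N _ n_wp_ge1 (ep_val 1%N).
  have [y hy] := h5; exists x, (y * (1 - ep 1)).
  rewrite mulrAC -hy [x * p]mulrC -[X in X * x]expr1 -hx; ring.
have pS := drinfeld_degree phi_drinfeld p_neq0.
have tS := drinfeld_degree phi_drinfeld t0.
have pL := drinfeld_lead phi_drinfeld p_neq0.
have tL := drinfeld_lead phi_drinfeld t0.
have hdD : (h * degA iF t = n_wp * (h * d))%N by rewrite tD mulnCA.
have [x3 e3] := h3; have [x4 e4] := h4.
(* [p ^+ n_wp] is a multiple of [t], and [ep n_wp * t] is a multiple of [p ^+ n_wp]. *)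
have [||||plow [zz plead]] := @order_root _ _ iR (phi p) (phi t) (phi x3) (phi x4) (phi (ep n_wp))
    n_wp (h * d) n_wp_ge1.
- by rewrite -rmorphXn e3 rmorphM.
- by rewrite -rmorphM e4 rmorphM rmorphXn.
- by move=> k; rewrite -hdD; exact: h_low.
- have /v_wp hc : val_ge v 1 (cv (1 - ep n_wp)).
    by apply: val_geW (ep_val n_wp); lia.
  have : chi (1 - ep n_wp) = 0 := hc.
  by rewrite rmorphB rmorph1 => /eqP; rewrite subr_eq0 eq_sym => /eqP.
have MD : motive_data w rho (coord_const iF infty) ia p chi d i j sigma phi
    (r * degA iF p) h ep u tau.
  split=> //.
  - exact: drinfeld_const phi_drinfeld.
  - by move=> k; apply/conv.
  - by move=> m k a mk /conv; exact: ep_div.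
  (* The lowest coefficient of [phi p] divides [eps], so its inverse is [zz] divided by [eps]. *)
  - have ie : (FracField.tofrac eps)^-1 \in away_pred eps.
      by apply/asboolP; exists 1, 1%N; rewrite tofrac1 expr1 div1r.
    exists (rho zz * Away ie); rewrite mulrA -rmorphM plead -hdD [tcoef _ _]h_eps.
    by apply: val_inj; rewrite /= mulfV // tofrac_eq0.
  - move=> [xi hxi]; have /asboolP[a [k xiE]] := hxi.
    exists (eps ^+ k), a; split; first by rewrite expf_neq0.
    apply: val_inj; rewrite /= xiE tofracXn mulrC divfK //.
    by rewrite expf_neq0 // tofrac_eq0.
have rk : \rank (map_mx (kap \o rho)
    (dg_mx (md_size MD) (md_lead MD) (r * degA iF p) (ep 1))) = (r * d)%N.
  (* The quotient by [phi t] has dimension [r * degA t = n_wp * (r * d)]. *)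
  apply: (rank_wp_part _ _ tS tL n_wp_ge1 h1 h2 h3 h4 h5).
  by rewrite tD mulnCA.
have -> : quotient_dim (iFp \o iF) (val_ge w 0) (val_ge w 1) = d.
  apply: quotient_dimE.
  - by move=> x y; exact: (val_geB wP).
  - move=> c x hx; rewrite -[0]addr0; apply: (val_geM wP) => //.
    exact: (ld_int LD (coord_const iF infty c)).
  - by move=> x y; exact: (placeD wP).
  - by left.
  exists (fun k => ia (b k)) => [k|y hy]; first exact: ld_int LD _.
  have [a ha] := dense y 1%N hy; have [c [hc uc]] := ld_basis LD a.
  have sE (c' : {ffun 'I_d -> Fq}) : \sum_k (iFp \o iF) (c' k) * ia (b k) =
      ia (\sum_k coord_const iF infty (c' k) * b k).
    by rewrite rmorph_sum; apply: eq_bigr => k _; rewrite rmorphM.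
  exists c; split=> [|c' hc'].
    rewrite sE; have -> : y - ia (\sum_k coord_const iF infty (c k) * b k) =
      (y - ia a) + ia (a - \sum_k coord_const iF infty (c k) * b k) by rewrite [ia (_ - _)]rmorphB addrA subrK.
    exact: (placeD wP).
  apply: uc; rewrite sE in hc'.
  have -> : ia (a - \sum_k coord_const iF infty (c' k) * b k) =
    (y - ia (\sum_k coord_const iF infty (c' k) * b k)) - (y - ia a).
    by rewrite [LHS]rmorphB; ring.
  exact: (val_geB wP).
exact: (motive_isocrystal_slopes LD E_ctensor sigma_frob CD rk z_unif).
Qed.
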